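(* Let $n=\dim M>2$. The following $\pi$-tensor fields associated with a Finsler structure $L$ on $M$ are invariant under every projective change $L\to\widetilde L$ (i.e. $\widetilde G=G-2\lambda\,\mathcal C$), that is $\widetilde W_1=W_1$ and $\widetilde W_2=W_2$: (a) the projective deviation tensor $$W_1(\overline X):=H(\overline X)-k\,\overline X+\frac1{n+1}\{3R_1(\overline X)-(n+1)\,D^\circ_{\gamma\overline X}k\}\,\overline\eta;$$ (b) the Weyl torsion tensor $$W_2(\overline X,\overline Y):=\widehat R^\circ(\overline X,\overline Y)+\frac1{n+1}\,\mathfrak U_{\overline X,\overline Y}\{R_1(\overline Y)\,\overline X+(D^\circ_{\gamma\overline X}R_1)(\overline Y)\,\overline\eta\},$$ where $\mathfrak U_{\overline X,\overline Y}\{A(\overline X,\overline Y)\}:=A(\overline X,\overline Y)-A(\overline Y,\overline X)$.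
   Context: $M$ is a real paracompact $C^\infty$ manifold of dimension $n$; $\pi:\mathcal TM\to M$ is the bundle of nonzero tangent vectors; $\pi^{-1}(TM)\to\mathcal TM$ is the pullback of $TM$ by $\pi$. Sections of $\pi^{-1}(TM)$ are called $\pi$-vector fields and written $\overline X$; tensor fields on $\pi^{-1}(TM)$ are called $\pi$-tensor fields (scalar-valued covariant ones: $\pi$-forms). $\overline\eta$ is the $\pi$-vector field $\overline\eta(u)=(u,u)$. There is an exact sequence $0\to\pi^{-1}(TM)\xrightarrow{\gamma}T(\mathcal TM)\xrightarrow{\rho}\pi^{-1}(TM)\to0$, where $\gamma$ is the vertical lift $\gamma(u,w)=\frac{d}{dt}\big|_{t=0}(u+tw)$ and $\rho$ sends $X\in T_u(\mathcal TM)$ to $(u,d\pi(X))$. Put $J:=\gamma\circ\rho$ and $\mathcal C:=\gamma\circ\overline\eta$. For a function $f$, $d_Jf(X)=(JX)\cdot f$. For a Finsler manifold $(M,L)$ with $E=\frac12L^2$: the canonical spray $G$ is the vector field with $i_G\,dd_JE=-dE$; the Barthel connection is $\Gamma=[J,G]$, i.e. $\Gamma(X)=[JX,G]-J[X,G]$; $h=\frac12(I+\Gamma)$, $v=\frac12(I-\Gamma)$. The horizontal map $\beta:\pi^{-1}(TM)\to T(\mathcal TM)$ sends $\overline X$ to the unique vector in the image of $h$ with $\rho(\beta\overline X)=\overline X$; $K:T(\mathcal TM)\to\pi^{-1}(TM)$ is determined by $\gamma\circ K=v$. The Berwald connection $D^\circ$ is the linear connection on $\pi^{-1}(TM)$ with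 $D^\circ_{\gamma\overline X}\overline Y=\rho[\gamma\overline X,\beta\overline Y]$ and $D^\circ_{\beta\overline X}\overline Y=K[\beta\overline X,\gamma\overline Y]$. On functions, $D^\circ_{\gamma\overline X}k=\gamma\overline X\cdot k$. Curvature: $\mathbf K(X,Y)\overline Z=-D^\circ_XD^\circ_Y\overline Z+D^\circ_YD^\circ_X\overline Z+D^\circ_{[X,Y]}\overline Z$; $R^\circ(\overline X,\overline Y)\overline Z=\mathbf K(\beta\overline X,\beta\overline Y)\overline Z$; $\widehat R^\circ(\overline X,\overline Y)=R^\circ(\overline X,\overline Y)\overline\eta$; deviation tensor $H(\overline X)=\widehat R^\circ(\overline\eta,\overline X)$. Further $R_2(\overline X,\overline Y):=\mathrm{Tr}\{\overline Z\mapsto R^\circ(\overline X,\overline Z)\overline Y\}$, $R_1(\overline X):=\frac1{n-1}\{nR_2(\overline X,\overline\eta)+R_2(\overline\eta,\overline X)\}$ and $k:=\frac1{n-1}R_2(\overline\eta,\overline\eta)$. Projective change: a change $L\to\widetilde L$ of Finsler structures on $M$ whose canonical sprays satisfy $\widetilde G=G-2\lambda\mathcal C$ for a function $\lambda$ on $TM$ (smooth on $\mathcal TM$) positively homogeneous of degree 1 in $y$. Tilded objects are those of $(M,\widetilde L)$. *)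

(* Defs.v *)
From HB Require Import structures.
From mathcomp Require Import all_boot all_order all_algebra.
From mathcomp Require Import all_classical all_reals all_analysis.
Set Implicit Arguments.
Unset Strict Implicit.
Unset Printing Implicit Defensive.
Import Order.TTheory GRing.Theory Num.Theory.
Import numFieldNormedType.Exports.

Local Open Scope classical_set_scope.
Local Open Scope ring_scope.

Fixpoint Ck_on (R : realType) (V W : normedModType R) (k : nat) (D : set V)
    (f : V -> W) : Prop :=
  match k with
  | 0 => forall x, D x -> {for x, continuous f}
  | k'.+1 => (forall x, D x -> differentiable f x) /\
             (forall v, Ck_on k' D (fun x => 'D_v f x))
  end.

Definition smooth_on (R : realType) (V W : normedModType R) (D : set V)
  (f : V -> W) : Prop := forall k, Ck_on k D f.

Definition smooth_at (R : realType) (V W : normedModType R) (f : V -> W)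
  (x : V) : Prop := exists2 O, open_nbhs x O & smooth_on O f.

Definition paracompact_space (T : topologicalType) : Prop :=
  forall C : set (set T), (forall U, C U -> open U) ->
    \bigcup_(U in C) U = setT ->
  exists D : set (set T),
    [/\ forall V, D V -> open V,
        \bigcup_(V in D) V = setT,
        forall V, D V -> exists2 U, C U & V `<=` U &
        forall x : T, exists2 N : set T, nbhs x N &
          finite_set [set V | D V /\ V `&` N !=set0]].

(* The data of an [m]-dimensional atlas on [T].  [coord c] is meaningful on
   [dom c] only, and [param c] is its inverse on [coord c @` dom c].  Every
   point carries a preferred chart [chart_at p]; the tangent space at [p] is
   represented as ['rV_m], a vector being identified with its components in
   [chart_at p].  The axioms are stated in [smooth_atlas]. *)
Record atlas (R : realType) (m : nat) (T : Type) := Atlas {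
  chart : Type ;
  dom : chart -> set T ;
  coord : chart -> T -> 'rV[R]_m ;
  param : chart -> 'rV[R]_m -> T ;
  chart_at : T -> chart }.

Record smooth_atlas (R : realType) (m : nat) (T : topologicalType)
    (A : atlas R m T) : Prop := SmoothAtlas {
  dom_chart_at : forall p, dom (chart_at A p) p ;
  dom_open : forall c : chart A, open (dom c) ;
  image_open : forall c : chart A, open (coord c @` dom c) ;
  coordK : forall (c : chart A) p, dom c p -> param c (coord c p) = p ;
  coord_continuous : forall (c : chart A) p, dom c p ->
    {for p, continuous (coord c)} ;
  param_continuous : forall (c : chart A) x, (coord c @` dom c) x ->
    {for x, continuous (param c)} ;
  transition_smooth : forall c d : chart A,
    smooth_on (coord c @` (dom c `&` dom d)) (coord d \o param c) }.

Section Calculus.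
Context {R : realType} {m : nat} {T : Type} (A : atlas R m T).

Definition coord_at (p : T) : 'rV[R]_m := coord (chart_at A p) p.

(* the derivative of [f] along the tangent vector [v] at [p] *)
Definition dmap (W : normedModType R) (f : T -> W) (p : T) (v : 'rV[R]_m) : W :=
  'D_v (f \o param (chart_at A p)) (coord_at p).

Definition lie_der (W : normedModType R) (X : T -> 'rV[R]_m) (f : T -> W)
  : T -> W := fun p => dmap f p (X p).

(* components in the chart [c] of the tangent vector [v] at [p] *)
Definition tcoord (c : chart A) (p : T) (v : 'rV[R]_m) : 'rV[R]_m :=
  dmap (coord c) p v.

(* the tangent vector at [param c x] with components [v] in the chart [c] *)
Definition tparam (c : chart A) (x v : 'rV[R]_m) : 'rV[R]_m :=
  'D_v (coord (chart_at A (param c x)) \o param c) x.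

Definition local_field (c : chart A) (X : T -> 'rV[R]_m)
  : 'rV[R]_m -> 'rV[R]_m := fun x => tcoord c (param c x) (X (param c x)).

Definition local_form (c : chart A) (w : T -> 'rV[R]_m -> R) (v : 'rV[R]_m)
  : 'rV[R]_m -> R := fun x => w (param c x) (tparam c x v).

Definition smooth_fun_on (S : set T) (f : T -> R) : Prop :=
  forall p, S p -> smooth_at (f \o param (chart_at A p)) (coord_at p).

Definition smooth_field_at (X : T -> 'rV[R]_m) (p : T) : Prop :=
  smooth_at (local_field (chart_at A p) X) (coord_at p).

Definition bracket (X Y : T -> 'rV[R]_m) : T -> 'rV[R]_m := fun p =>
  'D_(X p) (local_field (chart_at A p) Y) (coord_at p) -
  'D_(Y p) (local_field (chart_at A p) X) (coord_at p).

(* normalised so that dw(X,Y) = X.w(Y) - Y.w(X) - w([X,Y]) *)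
Definition ext_d (w : T -> 'rV[R]_m -> R) (p : T) (v1 v2 : 'rV[R]_m) : R :=
  'D_v1 (local_form (chart_at A p) w v2) (coord_at p) -
  'D_v2 (local_form (chart_at A p) w v1) (coord_at p).

Definition velocity (c : R -> T) : 'rV[R]_m :=
  'D_1 (coord (chart_at A (c 0)) \o c) (0 : R).

End Calculus.

Definition tmap (R : realType) (m m' : nat) (T T' : Type) (A : atlas R m T)
    (B : atlas R m' T') (F : T -> T') (p : T) (v : 'rV[R]_m) : 'rV[R]_m' :=
  dmap A (coord (chart_at B (F p)) \o F) p v.

Section TangentBundle.
Context {R : realType} {n : nat} {M : Type} (A : atlas R n M).

(* TM is represented by [M * 'rV_n], with the atlas of induced charts (x, y);
   its topology is the one defined by these charts, not the product one. *)
Local Notation TM := (M * 'rV[R]_n)%type.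

Definition tangent_atlas : atlas R (n + n) TM :=
  @Atlas R (n + n) TM (chart A)
    (fun c => [set u | dom c u.1])
    (fun c u => row_mx (coord c u.1) (tcoord c u.1 u.2))
    (fun c z => (param c (lsubmx z), tparam c (lsubmx z) (rsubmx z)))
    (fun u => chart_at A u.1).

Definition slit : set TM := [set u | u.2 != 0].

(* vector fields on TM, and pi-vector fields: [X u] is in the tangent space
   of M at [u.1]; only their values on [slit] are relevant. *)
Definition vfield := TM -> 'rV[R]_(n + n).
Definition pfield := TM -> 'rV[R]_n.

Definition smooth_vfield_on (S : set TM) (X : vfield) : Prop :=
  forall u, S u -> smooth_field_at tangent_atlas X u.

Definition smooth_pfield_on (S : set TM) (X : pfield) : Prop :=
  forall u, S u -> smooth_at
    (fun z => let u' := param (chart_at tangent_atlas u) z in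
              tcoord (chart_at A u.1) u'.1 (X u'))
    (coord_at tangent_atlas u).

Definition gamma (u : TM) (w : 'rV[R]_n) : 'rV[R]_(n + n) :=
  velocity tangent_atlas (fun t : R => (u.1, u.2 + t *: w)).

Definition rho (u : TM) (v : 'rV[R]_(n + n)) : 'rV[R]_n :=
  tmap tangent_atlas A fst u v.

Definition J (u : TM) (v : 'rV[R]_(n + n)) : 'rV[R]_(n + n) :=
  gamma u (rho u v).

Definition gamma_f (X : pfield) : vfield := fun u => gamma u (X u).
Definition rho_f (X : vfield) : pfield := fun u => rho u (X u).
Definition J_f (X : vfield) : vfield := fun u => J u (X u).

Definition eta : pfield := snd.
Definition liouville : vfield := gamma_f eta.

Definition d_J (f : TM -> R) (u : TM) (v : 'rV[R]_(n + n)) : R :=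
  dmap tangent_atlas f u (J u v).

Definition pos_homogeneous1 (f : TM -> R) : Prop :=
  forall (p : M) (y : 'rV[R]_n) (t : R), 0 < t -> f (p, t *: y) = t * f (p, y).

Definition energy (L : TM -> R) : TM -> R := fun u => 2^-1 * L u ^+ 2.

Definition Omega (L : TM -> R) := ext_d tangent_atlas (d_J (energy L)).

(* Regularity is required as non-degeneracy (maximal rank) of dd_J E; positive
   definiteness of the fundamental tensor implies it. *)
Record finsler (L : TM -> R) : Prop := Finsler {
  finsler_smooth : smooth_fun_on tangent_atlas slit L ;
  finsler_gt0 : forall u, slit u -> 0 < L u ;
  finsler_zero : forall p, L (p, 0) = 0 ;
  finsler_homogeneous : pos_homogeneous1 L ;
  finsler_nondegenerate : forall u, slit u ->
    forall v, (forall v', Omega L u v v' = 0) -> v = 0 }.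

Definition canonical_spray (L : TM -> R) (G : vfield) : Prop :=
  smooth_vfield_on slit G /\
  forall u, slit u -> forall v,
    Omega L u (G u) v = - dmap tangent_atlas (energy L) u v.

Definition projectively_related (G G' : vfield) : Prop :=
  exists lam : TM -> R,
    [/\ smooth_fun_on tangent_atlas slit lam, pos_homogeneous1 lam &
        forall u, slit u -> G' u = G u - (2 * lam u) *: liouville u].

Section Spray.
Context (G : vfield).

Local Notation "[: X , Y :]" := (bracket tangent_atlas X Y).

Definition barthel (X : vfield) : vfield := fun u =>
  [: J_f X, G :] u - J u ([: X, G :] u).

Definition hproj (X : vfield) : vfield := fun u => 2^-1 *: (X u + barthel X u).
Definition vproj (X : vfield) : vfield := fun u => 2^-1 *: (X u - barthel X u).

(* [h] is a tensor, so its image at [u] is obtained by applying it to the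
   vector fields defined near [u]. *)
Definition beta (X : pfield) : vfield := fun u =>
  xget 0 [set v | rho u v = X u /\
                  exists2 Y, smooth_field_at tangent_atlas Y u & hproj Y u = v].

Definition K (X : vfield) : pfield := fun u =>
  xget 0 [set w | gamma u w = vproj X u].

(* X = gamma (K X) + beta (rho X) *)
Definition berwald (X : vfield) (Y : pfield) : pfield := fun u =>
  rho u ([: gamma_f (K X), beta Y :] u) + K [: beta (rho_f X), gamma_f Y :] u.

Definition berwald_form (X : vfield) (w : pfield -> TM -> R) (Y : pfield)
  : TM -> R := fun u =>
  lie_der tangent_atlas X (w Y) u - w (berwald X Y) u.

Definition curvature (X Y : vfield) (Z : pfield) : pfield := fun u =>
  - berwald X (berwald Y Z) u + berwald Y (berwald X Z) u
  + berwald [: X, Y :] Z u.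

Definition h_curvature (X Y Z : pfield) : pfield :=
  curvature (beta X) (beta Y) Z.

Definition h_torsion (X Y : pfield) : pfield := h_curvature X Y eta.

Definition deviation (X : pfield) : pfield := h_torsion eta X.

(* the pi-vector field, defined near [u], with constant components [e] in the
   preferred chart at [u.1]; its value at [u] is [e] *)
Definition pextend (u : TM) (e : 'rV[R]_n) : pfield := fun u' =>
  tparam (chart_at A u.1) (coord (chart_at A u.1) u'.1) e.

(* the trace at [u] of the endomorphism of the fibre induced by a tensorial
   [F], for which the choice of extension of the basis vectors is immaterial *)
Definition ptrace (F : pfield -> pfield) (u : TM) : R :=
  \sum_(i < n) F (pextend u (delta_mx 0 i)) u 0 i.

Definition R2 (X Y : pfield) : TM -> R := ptrace (fun Z => h_curvature X Z Y).

Definition R1 (X : pfield) : TM -> R := fun u =>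
  (n%:R - 1)^-1 * (n%:R * R2 X eta u + R2 eta X u).

Definition kscal : TM -> R := fun u => (n%:R - 1)^-1 * R2 eta eta u.

Definition W1 (X : pfield) : pfield := fun u =>
  deviation X u - kscal u *: X u
  + ((n%:R + 1)^-1 *
     (3 * R1 X u - (n%:R + 1) * lie_der tangent_atlas (gamma_f X) kscal u))
    *: eta u.

Definition antisym (F : pfield -> pfield -> pfield) (X Y : pfield) : pfield :=
  fun u => F X Y u - F Y X u.

Definition W2 (X Y : pfield) : pfield := fun u =>
  h_torsion X Y u
  + (n%:R + 1)^-1 *:
    antisym (fun X Y u => R1 Y u *: X u
                          + berwald_form (gamma_f X) R1 Y u *: eta u) X Y u.

End Spray.
End TangentBundle.

(* Main.v *)
(** In a chart [(x, y)] of [TM] a spray reads [(y, B)], and the curvature of the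
    Berwald connection is the vertical derivative of the curvature [S] of the
    nonlinear connection with coefficients [N = - 1/2 dB/dy].  When [B] is
    homogeneous of degree 2, [S] is homogeneous of degree 1 and equals the
    torsion of the Berwald connection.  With [T a = tr (S (a, .))] one gets
    [k = T y / (n - 1)] and [R1 = T + dk/dy].
    A projective change [B' = B - 2 P y] gives, for the covector
    [Q a = delta_a P - P * dP/dy (a)], where [delta_a] is the horizontal
    derivative and [d_a] the vertical one,
      [S' (a, b) = S (a, b) - ((d_b Q a - d_a Q b) y + Q a b - Q b a)],
    hence [k' = k - Q y] and [R1' = R1 - (n + 1) Q], and all the terms in [Q]
    cancel in [W1] and [W2].  That a canonical spray has the form [(y, B)] with
    [B] homogeneous of degree 2 follows from the homogeneity of the energy and
    the nondegeneracy of [dd_J E]. *)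

Require Import Defs.
From HB Require Import structures.
From mathcomp Require Import all_boot all_order all_algebra.
From mathcomp Require Import all_classical all_reals all_analysis.
From mathcomp Require Import ring lra.
Import Order.TTheory GRing.Theory Num.Theory.
Import numFieldNormedType.Exports.
(* [all_algebra] declares a [coord] that hides the one of [Defs]. *)
Import Defs.
Set Implicit Arguments.
Unset Strict Implicit.
Unset Printing Implicit Defensive.
Local Open Scope classical_set_scope.
Local Open Scope ring_scope.

(** * Differential calculus of smooth maps *)

#[local] Opaque derive.

(** The operators [bracket], [berwald] and [curvature] are evaluated at each point in the preferred
    chart of that point, and [beta] and [K] come from a choice operator, so none of them can be
    differentiated as it stands. Each is therefore replaced, on an open set of one fixed chart, by
    an explicit formula for its components [vrep] or [prep]: an identity at a single point would not
    survive the next derivative, and the curvature takes several. Symmetry of second derivatives is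
    what makes the bracket independent of the chart, the Berwald connection torsion free, and the
    Euler identity stable under differentiation. The cancellation is possible because the whole
    change of [S] is governed by the single covector [Q]: its trace can produce nothing but [Q] and
    the vertical derivative of [Q y]. The change of [R1] detects the former and that of [k] the
    latter, and the factors 3 and n + 1 in the correction terms are the multiplicities found when
    taking this trace and when setting one argument of [S] equal to y. *)

Section DirectionalDerivatives.
Context {R : realType}.
Implicit Types V W U : normedModType R.

(** The difference [g - f] vanishes near [x], so it has differential [\0] there, and [g] is the sum
    of two differentiable maps. *)
Lemma differentiable_near_eq V W (f g : V -> W) (x : V) :
  (\near x, f x = g x) -> differentiable f x -> differentiable g x.
Proof.
move=> fg df.
have -> : g = f + (g - f) by apply/funext => y /=; rewrite -[RHS]/(f y + (g y -
  f y)) addrC subrK.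
apply: differentiableD => //.
set h := g - f.
have h0 : \forall y \near x, h y = 0.
  near=> y; rewrite -[h y]/(g y - f y).
  by apply/eqP; rewrite subr_eq0; apply/eqP/esym; near: y.
have hx : h x = 0 by exact: (nbhs_singleton h0).
have E : h \o shift x = cst (h x) + (\0 : V -> W) +o_ (0 : V) id.
  apply/eqaddoP => e e0.
  have : \forall y \near (0 : V), h (y + x) = 0 by move: h0; rewrite
    (near_shift 0) /= subr0.
  apply: filterS => y hy.
  by rewrite /= /cst -[_ y]/(h (y + x) - (h x + 0)) hy hx addr0 subr0 normr0
    mulr_ge0// ltW.
have c0 : continuous (\0 : {linear V -> W}) by move=> z; exact: cvg_cst.
have := @diff_unique _ _ _ h \0 x c0 E.
move=> dE; apply/diff_locallyP; split; last by rewrite dE.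
by rewrite dE.
Unshelve. all: by end_near. Qed.

Lemma derive_comp U V W (f : V -> U) (g : U -> W) (x v : V) :
  differentiable f x -> differentiable g (f x) ->
  'D_v (g \o f) x = 'D_('D_v f x) g (f x).
Proof.
move=> df dg; rewrite (deriveE v df) (deriveE _ dg).
by rewrite (deriveE v (differentiable_comp df dg)) diff_comp.
Qed.

Lemma derive_dirD V W (f : V -> W) (x v w : V) : differentiable f x ->
  'D_(v + w) f x = 'D_v f x + 'D_w f x.
Proof. by move=> df; rewrite !(deriveE _ df) linearD. Qed.

Lemma derive_dirZ V W (f : V -> W) (x v : V) k : differentiable f x ->
  'D_(k *: v) f x = k *: 'D_v f x.
Proof. by move=> df; rewrite !(deriveE _ df) linearZ. Qed.

Lemma derive_dirB V W (f : V -> W) (x v w : V) : differentiable f x ->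
  'D_(v - w) f x = 'D_v f x - 'D_w f x.
Proof. by move=> df; rewrite !(deriveE _ df) linearB. Qed.

Lemma derive_dir_sum V W (I : finType) (f : V -> W) (x : V) (v : I -> V) :
  differentiable f x -> 'D_(\sum_i v i) f x = \sum_i 'D_(v i) f x.
Proof.
by move=> df; rewrite (deriveE _ df) linear_sum; apply: eq_bigr => i _; rewrite
  (deriveE _ df).
Qed.

(** The product is the continuous bilinear map [*:%R] composed with the pair of [k] and [f], which
    gives the Leibniz rule for values in any normed module. *)
Lemma differentiable_derive_scale V W (k : V -> R) (f : V -> W) (x v : V) :
  differentiable k x -> differentiable f x ->
  differentiable (fun y => k y *: f y) x /\
  'D_v (fun y => k y *: f y) x = 'D_v k x *: f x + k x *: 'D_v f x.
Proof.
move=> dk df.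
have Bb : bilinear_for (GRing.Scale.Law.clone _ _ *:%R _)
    (GRing.Scale.Law.clone _ _ *:%R _) ( *:%R : R -> W -> W).
  by split=> [u'|u] a y z /=; rewrite ?scalerDl ?scalerDr !scalerA// mulrC.
pose B0 := bilinear_isBilinear.Build R R W W _ _ ( *:%R : R -> W -> W) Bb.
pose B : {bilinear R -> W -> W} := HB.pack ( *:%R : R -> W -> W) B0.
have Bc : continuous (fun p : R * W => B p.1 p.2) by exact: scale_continuous.
have dp : differentiable (fun y => (k y, f y)) x by exact: differentiable_pair.
have -> : (fun y => k y *: f y) = (fun p => B p.1 p.2) \o (fun y => (k y, f y))
  by [].
have dB := @differentiable_bilin _ _ _ _ B (k x, f x) Bc.
split; first exact: differentiable_comp.
rewrite (derive_comp v dp dB) (deriveE _ dB) (@diff_bilin _ _ _ _ B _ Bc)/=.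
by rewrite (deriveE _ dp) diff_pair//= (deriveE _ dk) (deriveE _ df) addrC.
Qed.

(** Chart formulas hold only on open sets; this is the form in which they are passed under a
    derivative. *)
Lemma derive_eq_near V W (f g : V -> W) (D : set V) (x v : V) : open D -> D x ->
  {in D, f =1 g} -> 'D_v f x = 'D_v g x.
Proof.
move=> oD Dx fg; apply: near_eq_derive.
by apply: filterS (open_nbhs_nbhs (conj oD Dx)) => y Dy; apply: fg; rewrite inE.
Qed.

Lemma linear_rV_continuous m W (f : {linear 'rV[R]_m -> W}) : continuous f.
Proof.
have -> : f = \sum_i (fun x : 'rV_m => x 0 i *: f (delta_mx 0 i)) :> (_ -> _).
  apply/funext => x; rewrite fct_sumE {1}[x]row_sum_delta linear_sum.
  by apply: eq_bigr => i _; rewrite linearZ.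
move=> x; apply: differentiable_continuous; apply: differentiable_sum => i.
by apply: differentiableZl; exact: differentiable_coord.
Qed.

Lemma differentiable_linear m W (f : 'rV[R]_m -> W) (x : 'rV[R]_m) :
  linear f -> differentiable f x.
Proof.
move=> lf; pose fl := GRing.isLinear.Build _ _ _ _ _ lf.
pose F : {linear _ -> _} := HB.pack f fl.
by apply: (@linear_differentiable _ _ _ F); exact: linear_rV_continuous.
Qed.

Lemma derive_linear m W (f : 'rV[R]_m -> W) (x v : 'rV[R]_m) :
  linear f -> 'D_v f x = f v.
Proof.
move=> lf; rewrite (deriveE _ (differentiable_linear x lf)).
pose fl := GRing.isLinear.Build _ _ _ _ _ lf.
pose F : {linear _ -> _} := HB.pack f fl.
by rewrite (@diff_lin _ _ _ F)//; exact: linear_rV_continuous.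
Qed.

Lemma linear_entry m (i : 'I_m) : linear (fun v : 'rV[R]_m => v 0 i : R^o).
Proof. by move=> a u v; rewrite !mxE. Qed.

Lemma differentiable_entry V m (f : V -> 'rV[R]_m) (x : V) i :
  differentiable f x -> differentiable (fun y => f y 0 i : R) x.
Proof.
move=> df; apply: (@differentiable_comp _ _ _ _ f (fun v : 'rV[R]_m => v 0 i :
  R)) => //.
exact: differentiable_coord.
Qed.

Lemma derive_entry V m (f : V -> 'rV[R]_m) (x v : V) i :
  differentiable f x -> 'D_v f x 0 i = 'D_v (fun y => f y 0 i : R) x.
Proof.
move=> df; rewrite (@derive_comp _ _ _ f (fun v : 'rV[R]_m => v 0 i : R))//;
  last exact: differentiable_coord.
by rewrite (@derive_linear _ _ (fun v : 'rV[R]_m => v 0 i : R^o))//; exact: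
  linear_entry.
Qed.

Lemma derive_basis m W (f : 'rV[R]_m -> W) (x v : 'rV[R]_m) :
  differentiable f x -> 'D_v f x = \sum_i v 0 i *: 'D_(delta_mx 0 i) f x.
Proof.
move=> df; rewrite {1}[v]row_sum_delta derive_dir_sum//.
by apply: eq_bigr => i _; rewrite derive_dirZ.
Qed.

End DirectionalDerivatives.

(** * Closure properties of smooth maps *)

Section Smoothness.
Context {R : realType}.
Implicit Types V W U : normedModType R.

Lemma Ck_on_sub V W k (D D' : set V) (f : V -> W) :
  D' `<=` D -> Ck_on k D f -> Ck_on k D' f.
Proof.
move=> DD; elim: k f => [|k IH] f /=; first by move=> fc x /DD; exact: fc.
by case=> df Df; split=> [x /DD|v]; [exact: df|exact/IH/Df].
Qed.

Lemma Ck_onW V W k (D : set V) (f : V -> W) : Ck_on k.+1 D f -> Ck_on k D f.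
Proof.
elim: k f => [|k IH] f [df Df].
  by move=> x /df dfx; exact: differentiable_continuous.
by split=> // v; apply: IH; exact: Df.
Qed.

Lemma Ck_on_eq V W k (D : set V) (f g : V -> W) : open D ->
  {in D, f =1 g} -> Ck_on k D f -> Ck_on k D g.
Proof.
move=> oD; elim: k f g => [|k IH] f g fg /=.
  move=> cf x Dx; have := cf x Dx; rewrite /prop_for /continuous_at (fg x)
    ?inE//.
  apply: cvg_trans; apply: near_eq_cvg.
  by apply: filterS (open_nbhs_nbhs (conj oD Dx)) => y Dy; apply: fg; rewrite
    inE.
case=> df Df; split=> [x Dx|v].
  apply: differentiable_near_eq (df x Dx).
  by apply: filterS (open_nbhs_nbhs (conj oD Dx)) => y Dy; apply: fg; rewrite
    inE.
apply: IH (Df v) => x; rewrite inE => Dx.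
exact: (derive_eq_near v oD Dx fg).
Qed.

Lemma Ck_on_cst V W k (D : set V) (c : W) : Ck_on k D (fun=> c).
Proof.
elim: k c => [|k IH] c /=; first by move=> x _; exact: cvg_cst.
split=> [x _|v]; first exact: differentiable_cst.
have -> : (fun x => 'D_v (fun=> c) x) = (fun=> 0) :> (V -> W).
  by apply/funext => x; exact: derive_cst.
exact: IH.
Qed.

Lemma Ck_on_add V W k (D : set V) (f g : V -> W) : open D ->
  Ck_on k D f -> Ck_on k D g -> Ck_on k D (fun x => f x + g x).
Proof.
move=> oD; elim: k f g => [|k IH] f g /=.
  by move=> cf cg x Dx; apply: cvgD; [exact: cf|exact: cg].
case=> df Df [dg Dg]; split=> [x Dx|v].
  by apply: differentiableD; [exact: df|exact: dg].
apply: (Ck_on_eq oD _ (IH _ _ (Df v) (Dg v))) => x; rewrite inE => Dx.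
by apply/esym/deriveD; apply: diff_derivable; [exact: df|exact: dg].
Qed.

Lemma Ck_on_sum V W k (D : set V) (I : Type) (r : seq I) (f : I -> V -> W) :
  open D -> (forall i, Ck_on k D (f i)) ->
  Ck_on k D (fun x => \sum_(i <- r) f i x).
Proof.
move=> oD cf; elim: r => [|i r IH].
  by under eq_fun do rewrite big_nil; exact: Ck_on_cst.
by under eq_fun do rewrite big_cons; exact: Ck_on_add.
Qed.

Lemma Ck_on_scale V W k (D : set V) (a : V -> R) (f : V -> W) : open D ->
  Ck_on k D a -> Ck_on k D f -> Ck_on k D (fun x => a x *: f x).
Proof.
move=> oD; elim: k a f => [|k IH] a f.
  by move=> ca cf x Dx; apply: cvgZ; [exact: ca|exact: cf].
(* Each term of the Leibniz rule leaves one factor undifferentiated, so both factors are also needed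
   at the lower order [k]. *)
move=> Ca Cf; have Ca' := Ck_onW Ca; have Cf' := Ck_onW Cf.
case: Ca Cf => da Da [df Df]; split=> [x Dx|v].
  exact: (differentiable_derive_scale 0 (da x Dx) (df x Dx)).1.
apply: (Ck_on_eq oD _ (Ck_on_add oD (IH _ _ (Da v) Cf') (IH _ _ Ca' (Df v)))).
move=> x; rewrite inE => Dx.
by rewrite (differentiable_derive_scale v (da x Dx) (df x Dx)).2.
Qed.

Lemma Ck_on_entry V m k (D : set V) (f : V -> 'rV[R]_m) i : open D ->
  Ck_on k D f -> Ck_on k D (fun x => f x 0 i : R).
Proof.
move=> oD; elim: k f => [|k IH] f.
  move=> cf x Dx; apply: (@continuous_comp _ _ _ f (fun v : 'rV[R]_m => v 0 i)).
    exact: cf.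
  exact: matrix_normedtype.coord_continuous.
case=> df Df; split=> [x Dx|v]; first by apply: differentiable_entry; exact: df.
apply: (Ck_on_eq oD _ (IH _ (Df v))) => x; rewrite inE => Dx.
by rewrite derive_entry//; exact: df.
Qed.

(** By the chain rule the derivative of [f] is taken in a direction that varies with [x], whereas
    [Ck_on] speaks of fixed directions. Expanding that direction in the standard basis of ['rV_m]
    restores fixed directions, to which the induction applies. *)
Lemma Ck_on_comp V m W k (D : set V) (D' : set 'rV[R]_m) (f : 'rV[R]_m -> W)
  (g : V -> 'rV[R]_m) : open D -> (forall x, D x -> D' (g x)) ->
  Ck_on k D' f -> Ck_on k D g -> Ck_on k D (fun x => f (g x)).
Proof.
move=> oD gD; elim: k f => [|k IH] f.
  move=> cf cg x Dx; apply: (@continuous_comp _ _ _ g f); first exact: cg.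
  by apply: cf; exact: gD.
move=> [df Df] Cg; have Cg' := Ck_onW Cg; case: Cg => dg Dg.
split=> [x Dx|v].
  by apply: (@differentiable_comp _ _ _ _ g f); [exact: dg|exact/df/gD].
have C : Ck_on k D (fun x => \sum_i ('D_v g x) 0 i *: 'D_(delta_mx 0 i) f (g
  x)).
  apply: Ck_on_sum => // i; apply: Ck_on_scale => //.
    by apply: Ck_on_entry => //; exact: Dg.
  exact: (IH ('D_(delta_mx 0 i) f) (Df _) Cg').
apply: (Ck_on_eq oD _ C) => x; rewrite inE => Dx.
have dfg := df _ (gD _ Dx).
by rewrite (derive_comp v (dg _ Dx) dfg) (derive_basis _ dfg).
Qed.

Lemma smooth_on_sub V W (D D' : set V) (f : V -> W) :
  D' `<=` D -> smooth_on D f -> smooth_on D' f.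
Proof. by move=> DD cf k; apply: Ck_on_sub DD _. Qed.

Lemma smooth_on_eq V W (D : set V) (f g : V -> W) : open D ->
  {in D, f =1 g} -> smooth_on D f -> smooth_on D g.
Proof. by move=> oD fg cf k; apply: Ck_on_eq (cf k). Qed.

Lemma smooth_on_differentiable V W (D : set V) (f : V -> W) x :
  smooth_on D f -> D x -> differentiable f x.
Proof. by move=> /(_ 1%N)[df _]; exact: df. Qed.

Lemma smooth_on_continuous V W (D : set V) (f : V -> W) x :
  smooth_on D f -> D x -> {for x, continuous f}.
Proof. by move=> /(_ 0%N); exact. Qed.

Lemma smooth_on_derive V W (D : set V) (f : V -> W) v :
  smooth_on D f -> smooth_on D ('D_v f).
Proof. by move=> sf k; have [_] := sf k.+1; exact. Qed.

(** Every order of [Ck_on] imposes conditions at single points only, and smoothness near a point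
    passes to directional derivatives, so the induction on the order closes. *)
Lemma smooth_on_at V W (D : set V) (f : V -> W) :
  (forall x, D x -> smooth_at f x) -> smooth_on D f.
Proof.
move=> sf k; elim: k f sf => [|k IH] f sf /=.
  by move=> x /sf[U [_ Ux] sU]; exact: smooth_on_continuous sU Ux.
split=> [x /sf[U [_ Ux] sU]|v]; first exact: smooth_on_differentiable sU Ux.
by apply: IH => x /sf[U nU sU]; exists U => //; exact: smooth_on_derive.
Qed.

Lemma smooth_on_cst V W (D : set V) (c : W) : smooth_on D (fun=> c).
Proof. by move=> k; exact: Ck_on_cst. Qed.

Lemma smooth_on_add V W (D : set V) (f g : V -> W) : open D ->
  smooth_on D f -> smooth_on D g -> smooth_on D (fun x => f x + g x).
Proof. by move=> oD sf sg k; exact: Ck_on_add. Qed.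

Lemma smooth_on_scale V W (D : set V) (a : V -> R) (f : V -> W) : open D ->
  smooth_on D a -> smooth_on D f -> smooth_on D (fun x => a x *: f x).
Proof. by move=> oD sf sg k; exact: Ck_on_scale. Qed.

Lemma smooth_on_scale_cst V W (D : set V) (a : R) (f : V -> W) : open D ->
  smooth_on D f -> smooth_on D (fun x => a *: f x).
Proof. by move=> oD sf; apply: smooth_on_scale => //; exact: smooth_on_cst. Qed.

Lemma smooth_on_opp V W (D : set V) (f : V -> W) : open D ->
  smooth_on D f -> smooth_on D (fun x => - f x).
Proof.
by move=> oD sf; under eq_fun do rewrite -scaleN1r; exact: smooth_on_scale_cst.
Qed.

Lemma smooth_on_sub_fun V W (D : set V) (f g : V -> W) : open D ->
  smooth_on D f -> smooth_on D g -> smooth_on D (fun x => f x - g x).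
Proof. by move=> oD sf sg; apply: smooth_on_add => //; exact: smooth_on_opp.
  Qed.

Lemma smooth_on_sum V W (D : set V) (I : Type) (r : seq I) (f : I -> V -> W) :
  open D -> (forall i, smooth_on D (f i)) ->
  smooth_on D (fun x => \sum_(i <- r) f i x).
Proof. by move=> oD sf k; apply: Ck_on_sum => // i; exact: sf. Qed.

Lemma smooth_on_entry V m (D : set V) (f : V -> 'rV[R]_m) i : open D ->
  smooth_on D f -> smooth_on D (fun x => f x 0 i : R).
Proof. by move=> oD sf k; exact: Ck_on_entry. Qed.

Lemma smooth_on_comp V m W (D : set V) (D' : set 'rV[R]_m) (f : 'rV[R]_m -> W)
  (g : V -> 'rV[R]_m) : open D -> (forall x, D x -> D' (g x)) ->
  smooth_on D' f -> smooth_on D g -> smooth_on D (fun x => f (g x)).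
Proof. by move=> oD gD sf sg k; apply: Ck_on_comp (sf k) (sg k). Qed.

Lemma smooth_on_linear m W (D : set 'rV[R]_m) (f : 'rV[R]_m -> W) :
  linear f -> smooth_on D f.
Proof.
move=> lf; case=> [|k].
  by move=> x _; apply: differentiable_continuous; exact: differentiable_linear.
split=> [x _|v]; first exact: differentiable_linear.
have -> : (fun x => 'D_v f x) = (fun=> f v) by apply/funext => x; exact:
  derive_linear.
exact: Ck_on_cst.
Qed.

Lemma smooth_on_linear_comp V m W (D : set V) (f : 'rV[R]_m -> W)
  (g : V -> 'rV[R]_m) : open D -> linear f ->
  smooth_on D g -> smooth_on D (fun x => f (g x)).
Proof.
move=> oD lf; apply: (@smooth_on_comp _ _ _ D setT) => //.
exact: smooth_on_linear.
Qed.

(** With [f] a transition map, this gives the smoothness of the components of a vector field after a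
    change of chart. *)
Lemma smooth_on_derive_along m p W (D : set 'rV[R]_m) (D' : set 'rV[R]_p)
  (f : 'rV[R]_p -> W) (g h : 'rV[R]_m -> 'rV[R]_p) : open D ->
  (forall x, D x -> D' (g x)) -> smooth_on D' f -> smooth_on D g ->
  smooth_on D h -> smooth_on D (fun x => 'D_(h x) f (g x)).
Proof.
move=> oD gD sf sg sh.
have C : smooth_on D (fun x => \sum_i (h x) 0 i *: 'D_(delta_mx 0 i) f (g x)).
  apply: smooth_on_sum => // i; apply: smooth_on_scale => //.
    exact: smooth_on_entry.
  exact: (smooth_on_comp oD gD (smooth_on_derive (delta_mx 0 i) sf) sg).
apply: (smooth_on_eq oD _ C) => x; rewrite inE => Dx.
by rewrite -derive_basis//; apply: smooth_on_differentiable sf (gD _ Dx).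
Qed.

Lemma linear_row_mxl m p : linear (fun v : 'rV[R]_m => row_mx v (0 : 'rV_p)).
Proof. by move=> a u v; rewrite scale_row_mx add_row_mx scaler0 addr0. Qed.

Lemma linear_row_mxr m p : linear (fun v : 'rV[R]_p => row_mx (0 : 'rV_m) v).
Proof. by move=> a u v; rewrite scale_row_mx add_row_mx scaler0 addr0. Qed.

Lemma smooth_on_row_mx V m p (D : set V) (f : V -> 'rV[R]_m) (g : V ->
  'rV[R]_p) :
  open D -> smooth_on D f -> smooth_on D g ->
  smooth_on D (fun x => row_mx (f x) (g x)).
Proof.
move=> oD sf sg.
have -> : (fun x => row_mx (f x) (g x)) = (fun x => row_mx (f x) 0 + row_mx 0
  (g x)).
  by apply/funext => x; rewrite add_row_mx addr0 add0r.
apply: smooth_on_add => //.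
  by apply: (smooth_on_linear_comp oD (@linear_row_mxl m p)).
by apply: (smooth_on_linear_comp oD (@linear_row_mxr m p)).
Qed.

Lemma linear_lsub m p : linear (@lsubmx R 1 m p).
Proof. by move=> a u v; rewrite linearP. Qed.

Lemma linear_rsub m p : linear (@rsubmx R 1 m p).
Proof. by move=> a u v; rewrite linearP. Qed.

Lemma smooth_on_lsub V m p (D : set V) (f : V -> 'rV[R]_(m + p)) : open D ->
  smooth_on D f -> smooth_on D (fun x => lsubmx (f x)).
Proof. by move=> oD; apply: (smooth_on_linear_comp oD (@linear_lsub m p)). Qed.

Lemma smooth_on_rsub V m p (D : set V) (f : V -> 'rV[R]_(m + p)) : open D ->
  smooth_on D f -> smooth_on D (fun x => rsubmx (f x)).
Proof. by move=> oD; apply: (smooth_on_linear_comp oD (@linear_rsub m p)). Qed.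

Lemma derive_linear_comp V m W (f : 'rV[R]_m -> W) (g : V -> 'rV[R]_m) (x v :
  V) :
  linear f -> differentiable g x -> 'D_v (fun y => f (g y)) x = f ('D_v g x).
Proof.
move=> lf dg.
have := @derive_comp _ _ _ _ g f x v dg (differentiable_linear (g x) lf).
by rewrite (derive_linear _ _ lf).
Qed.

End Smoothness.

(** * Symmetry of second derivatives *)

Section Schwarz.
Context {R : realType}.
Implicit Types V W : normedModType R.

Lemma derive_line V (y v : V) (a : R) :
  differentiable (fun a : R => y + a *: v) a /\
  'D_1 (fun a : R => y + a *: v) a = v.
Proof.
have dv : differentiable (fun a : R => a *: v) a by exact: differentiableZl.
split; first exact: differentiableD.
rewrite deriveD ?derive_cst ?add0r//; last exact: diff_derivable.
rewrite (deriveE _ dv) diffZl//.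
by rewrite -(deriveE _ _)// derive_id scale1r.
Qed.

Lemma derive_on_line V W (f : V -> W) (z v : V) : differentiable f z ->
  'D_v f z = 'D_1 (fun a : R => f (z + a *: v)) 0.
Proof.
move=> df; have [dl Dl] := derive_line z v 0.
have df' : differentiable f (z + 0 *: v) by rewrite scale0r addr0.
have := @derive_comp _ _ _ _ (fun a : R => z + a *: v) f 0 1 dl df'.
by rewrite Dl scale0r addr0.
Qed.

Lemma mean_value_line V (f : V -> R) (y v : V) (s : R) : 0 < s ->
  (forall a, 0 <= a <= s -> differentiable f (y + a *: v)) ->
  exists2 c, 0 <= c <= s & f (y + s *: v) - f y = s * 'D_v f (y + c *: v).
Proof.
move=> s0 df.
pose l := fun a : R => y + a *: v.
have dl a : differentiable l a := (derive_line y v a).1.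
have Dl a : 'D_1 l a = v := (derive_line y v a).2.
have dfl a : 0 <= a <= s -> differentiable (f \o l) a.
  by move=> /df dfa; exact: differentiable_comp.
have [||c cs E] := @MVT R (f \o l) (fun a => 'D_v f (l a)) 0 s s0.
- move=> a; rewrite in_itv/= => /andP[a0 as_].
  have as' : 0 <= a <= s by rewrite !ltW.
  apply: DeriveDef; first by apply: diff_derivable; exact: dfl.
  by rewrite derive_comp ?Dl//; exact: df.
- apply: continuous_in_subspaceT => a; rewrite inE/= in_itv/= => /dfl.
  exact: differentiable_continuous.
exists c; first by move: cs; rewrite in_itv/= => /andP[c0 cs]; rewrite !ltW.
by move: E; rewrite /= /l scale0r addr0 subr0 mulrC.
Qed.

(** The mean value theorem is used twice: for the increment [f (y + s *: w) - f y] along [v], then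
    for ['D_v f] along [w]. The intermediate point stays in the parallelogram spanned by [s *: v]
    and [s *: w]. *)
Lemma second_difference V (f : V -> R) (D : set V) (x v w : V) (s : R) : 0 < s
  ->
  (forall y, D y -> differentiable f y) ->
  (forall y, D y -> differentiable ('D_v f) y) ->
  (forall a b, 0 <= a <= s -> 0 <= b <= s -> D (x + a *: v + b *: w)) ->
  exists a b, [/\ 0 <= a <= s, 0 <= b <= s &
    f (x + s *: v + s *: w) - f (x + s *: v) - (f (x + s *: w) - f x) =
    s * (s * 'D_w ('D_v f) (x + a *: v + b *: w))].
Proof.
move=> s0 df dDf xD.
have sI : 0 <= s <= s by rewrite lexx ltW.
have I0 : 0 <= (0 : R) <= s by rewrite lexx ltW.
have dsh z (b : R) : differentiable (fun y : V => y + b *: w) z.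
  by apply: differentiableD.
have Dsh z (b : R) : 'D_v (fun y : V => y + b *: w) z = v.
  by rewrite deriveD// derive_cst addr0 derive_id.
pose F := fun y => f (y + s *: w) - f y.
have dF a : 0 <= a <= s -> differentiable F (x + a *: v) /\
    'D_v F (x + a *: v) = 'D_v f (x + a *: v + s *: w) - 'D_v f (x + a *: v).
  move=> as_.
  have d1 : differentiable f (x + a *: v) by apply: df; have := xD a 0 as_ I0;
    rewrite scale0r addr0.
  have d2 : differentiable f (x + a *: v + s *: w) by apply: df; exact: xD.
  have d3 : differentiable (f \o (fun y => y + s *: w)) (x + a *: v) by exact:
    differentiable_comp.
  split; first by apply: differentiableB.
  have -> : 'D_v F (x + a *: v) = 'D_v (f \o (fun y => y + s *: w)) (x + a *:
    v) - 'D_v f (x + a *: v).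
    by apply: deriveB; exact: diff_derivable.
  by rewrite (derive_comp v (dsh _ s) d2) Dsh.
have [a as_ E1] := mean_value_line s0 (fun a h => (dF a h).1).
have [b bs E2] := @mean_value_line _ ('D_v f) (x + a *: v) w s s0 (fun b h =>
  dDf _ (xD a b as_ h)).
exists a, b; split=> //.
by rewrite -E2 -(dF a as_).2 -E1 /F.
Qed.

Lemma ball_near2 V (g h : V -> R) (D : set V) (x : V) (e : R) : open D -> D x ->
  {for x, continuous g} -> {for x, continuous h} -> 0 < e ->
  exists2 r, 0 < r & forall y, ball x r y ->
    [/\ D y, `|g x - g y| < e & `|h x - h y| < e].
Proof.
move=> oD Dx /cvgrPdist_lt cg /cvgrPdist_lt ch e0.
have /nbhs_ballP[r /= r0 rP] :
    \forall y \near x, [/\ D y, `|g x - g y| < e & `|h x - h y| < e].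
  by near=> y; split; near: y; [exact: open_nbhs_nbhs|exact: cg|exact: ch].
by exists r.
Unshelve. all: by end_near. Qed.

Lemma dist_lt_half (d p q z : R) :
  `|p - z| < d / 2 -> `|q - z| < d / 2 -> `|p - q| < d.
Proof.
move=> pz qz; have := ler_normD (p - z) (z - q).
by rewrite addrA subrK (distrC z); lra.
Qed.

(** The second difference is symmetric in [v] and [w], so the two mixed derivatives take a common
    value at two points of a small parallelogram. If they differed by [d] at [x], continuity would
    bring each within [d / 2] of that common value, a contradiction. *)
Lemma derive_comm_scalar V (f : V -> R) (D : set V) (x v w : V) :
  open D -> D x -> smooth_on D f -> 'D_v ('D_w f) x = 'D_w ('D_v f) x.
Proof.
move=> oD Dx sf; apply/eqP; rewrite -subr_eq0 -normr_le0 leNgt; apply/negP.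
set d := `|_| => d0.
have c1 := smooth_on_continuous (smooth_on_derive v (smooth_on_derive w sf)) Dx.
have c2 := smooth_on_continuous (smooth_on_derive w (smooth_on_derive v sf)) Dx.
have e0 : 0 < d / 2 by rewrite divr_gt0.
have [r r0 rP] := ball_near2 oD Dx c1 c2 e0.
(* This scale puts the whole parallelogram inside the ball of radius [r]; the summand 1 keeps the
   denominator positive and the inclusion strict. *)
pose s := r / (`|v| + `|w| + 1).
have q0 : 0 < `|v| + `|w| + 1 by rewrite ltr_wpDl// addr_ge0.
have s0 : 0 < s by rewrite divr_gt0.
have inb a b : 0 <= a <= s -> 0 <= b <= s -> ball x r (x + a *: v + b *: w).
  move=> /andP[a0 as_] /andP[b0 bs]; rewrite -ball_normE/= -addrA opprD addrA
    subrr add0r normrN.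
  apply: (le_lt_trans (ler_normD _ _)); rewrite !normrZ !ger0_norm//.
  apply: (@le_lt_trans _ _ (s * (`|v| + `|w|))).
    by rewrite mulrDr lerD// ler_wpM2r.
  by rewrite /s mulrAC ltr_pdivrMr// ltr_pM2l// ltrDl.
have df y : ball x r y -> differentiable f y by move=> /rP[Dy _ _]; exact:
  smooth_on_differentiable sf Dy.
have ddf u y : ball x r y -> differentiable ('D_u f) y.
  by move=> /rP[Dy _ _]; exact: smooth_on_differentiable (smooth_on_derive u
    sf) Dy.
have [a [b [as_ bs E1]]] := second_difference s0 df (ddf v) inb.
have inb' p q : 0 <= p <= s -> 0 <= q <= s -> ball x r (x + p *: w + q *: v).
  by move=> ha hb; rewrite addrAC; exact: inb.
have [a' [b' [as' bs' E2]]] := second_difference s0 df (ddf w) inb'.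
have E : 'D_w ('D_v f) (x + a *: v + b *: w) = 'D_v ('D_w f) (x + a' *: w + b'
  *: v).
  apply: (mulfI (lt0r_neq0 s0)); apply: (mulfI (lt0r_neq0 s0)).
  have swap (p q t z : R) : p - q - (t - z) = p - t - (q - z) by ring.
  apply: (etrans (esym E1)); apply: (etrans (swap _ _ _ _)).
  by rewrite (addrAC x).
have [_ _ h2] := rP _ (inb _ _ as_ bs).
have [_ h1 _] := rP _ (inb' _ _ as' bs').
rewrite E in h2.
by have := dist_lt_half h1 h2; rewrite ltxx.
Qed.

Lemma derive_comm V m (f : V -> 'rV[R]_m) (D : set V) (x v w : V) :
  open D -> D x -> smooth_on D f -> 'D_v ('D_w f) x = 'D_w ('D_v f) x.
Proof.
move=> oD Dx sf; apply/rowP => i.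
have d1 u : differentiable ('D_u f) x := smooth_on_differentiable
  (smooth_on_derive u sf) Dx.
have E u : {in D, (fun y => 'D_u f y 0 i) =1 'D_u (fun y => f y 0 i : R)}.
  by move=> y; rewrite inE => Dy; apply: derive_entry; exact:
    smooth_on_differentiable sf Dy.
apply: (etrans (derive_entry v i (d1 w))); apply/esym.
apply: (etrans (derive_entry w i (d1 v))); apply/esym.
apply: (etrans (derive_eq_near v oD Dx (E w))); apply/esym.
apply: (etrans (derive_eq_near w oD Dx (E v))); apply/esym.
exact: (derive_comm_scalar v w oD Dx (smooth_on_entry i oD sf)).
Qed.

End Schwarz.

Lemma derive_scale_sum {R : realType} (V W : normedModType R) (I : finType)
    (a : I -> V -> R) (f : I -> V -> W) (x v : V) :
  (forall i, differentiable (a i) x) -> (forall i, differentiable (f i) x) ->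
  'D_v (fun y => \sum_i a i y *: f i y) x =
  \sum_i ('D_v (a i) x *: f i x + a i x *: 'D_v (f i) x).
Proof.
move=> da df.
have dd i := differentiable_derive_scale v (da i) (df i).
suff /(_ (index_enum I))[_ //] : forall r,
  differentiable (fun y => \sum_(i <- r) a i y *: f i y) x /\
  'D_v (fun y => \sum_(i <- r) a i y *: f i y) x =
  \sum_(i <- r) ('D_v (a i) x *: f i x + a i x *: 'D_v (f i) x).
elim=> [|i r [IHd IH]].
  have -> : (fun y => \sum_(i <- [::]) a i y *: f i y) = cst 0 by apply/funext
    => y; rewrite big_nil.
  by rewrite big_nil derive_cst; split=> //; exact: differentiable_cst.
have -> : (fun y => \sum_(j <- i :: r) a j y *: f j y) =
    (fun y => a i y *: f i y) + (fun y => \sum_(j <- r) a j y *: f j y).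
  by apply/funext => y; rewrite big_cons.
split; first exact: differentiableD (dd i).1 IHd.
rewrite big_cons -IH -(dd i).2.
by apply: deriveD; apply: diff_derivable => //; exact: (dd i).1.
Qed.

Section FunctionForms.
Context {R : realType}.
Implicit Types V W : normedModType R.

Lemma derive_addf V W (f g : V -> W) (x v : V) : differentiable f x ->
  differentiable g x -> 'D_v (fun y => f y + g y) x = 'D_v f x + 'D_v g x.
Proof. by move=> df dg; apply: deriveD; exact: diff_derivable. Qed.

Lemma derive_subf V W (f g : V -> W) (x v : V) : differentiable f x ->
  differentiable g x -> 'D_v (fun y => f y - g y) x = 'D_v f x - 'D_v g x.
Proof. by move=> df dg; apply: deriveB; exact: diff_derivable. Qed.

Lemma derive_scalef V W (k : R) (f : V -> W) (x v : V) : differentiable f x ->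
  'D_v (fun y => k *: f y) x = k *: 'D_v f x.
Proof. by move=> df; apply: deriveZ; exact: diff_derivable. Qed.

Lemma derive_mulf V W (k : V -> R) (f : V -> W) (x v : V) :
  differentiable k x -> differentiable f x ->
  'D_v (fun y => k y *: f y) x = 'D_v k x *: f x + k x *: 'D_v f x.
Proof. by move=> dk df; exact: (differentiable_derive_scale v dk df).2. Qed.

Lemma derive_sumf V W (I : finType) (f : I -> V -> W) (x v : V) :
  (forall i, differentiable (f i) x) ->
  'D_v (fun y => \sum_i f i y) x = \sum_i 'D_v (f i) x.
Proof.
move=> df; have dc (i : I) : differentiable (cst 1 : V -> R) x by exact:
  differentiable_cst.
have := derive_scale_sum v dc df.
under eq_fun do under eq_bigr do rewrite scale1r.
by move=> ->; apply: eq_bigr => i _; rewrite derive_cst scale0r add0r scale1r.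
Qed.

End FunctionForms.

(** * Families of linear maps depending smoothly on a point *)

Section LinearFamilies.
Context {R : realType} {V W : normedModType R} {p : nat}.
Variables (D : set V) (P : V -> 'rV[R]_p -> W).
Hypotheses (oD : open D) (linP : forall y, D y -> linear (P y))
  (sP : forall w, smooth_on D (P^~ w)).

Lemma linear_family_basis (y : V) (w : 'rV[R]_p) : D y ->
  P y w = \sum_i w 0 i *: P y (delta_mx 0 i).
Proof.
move=> Dy; have lP := linP Dy.
pose Pl := GRing.isLinear.Build _ _ _ _ _ lP.
pose F : {linear _ -> _} := HB.pack (P y) Pl.
rewrite {1}[w]row_sum_delta -[LHS]/(F _) linear_sum.
by apply: eq_bigr => i _; rewrite linearZ.
Qed.

Lemma smooth_on_linear_family (h : V -> 'rV[R]_p) :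
  smooth_on D h -> smooth_on D (fun y => P y (h y)).
Proof.
move=> sh.
have C : smooth_on D (fun y => \sum_i h y 0 i *: P y (delta_mx 0 i)).
  apply: smooth_on_sum => // i; apply: smooth_on_scale => //.
  exact: smooth_on_entry.
apply: (smooth_on_eq oD _ C) => y; rewrite inE => Dy.
by rewrite -linear_family_basis.
Qed.

(** Expanding [h y] in the standard basis reduces this to the product rule with scalar coefficients.
    It later serves for derivatives along fields and for [hor], [htrace], [Q] and [R1_loc], all
    linear in one argument. *)
Lemma derive_linear_family (h : V -> 'rV[R]_p) (x v : V) : D x ->
  differentiable h x ->
  'D_v (fun y => P y (h y)) x = P x ('D_v h x) + 'D_v (P^~ (h x)) x.
Proof.
move=> Dx dh.
have dPi (i : 'I_p) : differentiable (P^~ (delta_mx 0 i)) x.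
  exact: smooth_on_differentiable (sP _) Dx.
have dhi i : differentiable (fun y => h y 0 i : R) x by exact:
  differentiable_entry.
have E1 : {in D, (fun y => P y (h y)) =1
    (fun y => \sum_i h y 0 i *: P y (delta_mx 0 i))}.
  by move=> y; rewrite inE; exact: linear_family_basis.
have E2 : {in D, P^~ (h x) =1 (fun y => \sum_i h x 0 i *: P y (delta_mx 0 i))}.
  by move=> y; rewrite inE; exact: linear_family_basis.
apply: (etrans (derive_eq_near v oD Dx E1)).
rewrite (derive_eq_near v oD Dx E2).
rewrite (derive_scale_sum v dhi dPi).
rewrite (derive_scale_sum v (fun i => differentiable_cst (h x 0 i) x) dPi).
rewrite (linear_family_basis _ Dx) -big_split/=; apply: eq_bigr => i _.
by rewrite derive_cst scale0r add0r (derive_entry v i dh).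
Qed.

End LinearFamilies.

Section DerivativeAlongFields.
Context {R : realType} {m : nat} {W : normedModType R}.
Variables (D : set 'rV[R]_m) (f : 'rV[R]_m -> W).
Hypotheses (oD : open D) (sf : smooth_on D f).

Let P y w := 'D_w f y.

Let linP y : D y -> linear (P y).
Proof.
move=> Dy a u v; have df := smooth_on_differentiable sf Dy.
by rewrite /P derive_dirD// derive_dirZ.
Qed.

Lemma smooth_on_derive_field (h : 'rV[R]_m -> 'rV[R]_m) :
  smooth_on D h -> smooth_on D (fun y => 'D_(h y) f y).
Proof.
exact: (smooth_on_linear_family oD linP (fun w => smooth_on_derive w sf)).
Qed.

Lemma derive_derive_along (h : 'rV[R]_m -> 'rV[R]_m) (x v : 'rV[R]_m) :
  D x -> differentiable h x ->
  'D_v (fun y => 'D_(h y) f y) x = 'D_('D_v h x) f x + 'D_v ('D_(h x) f) x.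
Proof.
exact: (derive_linear_family oD linP (fun w => smooth_on_derive w sf)).
Qed.

End DerivativeAlongFields.

(* The library's derivative unfolds to a limit, which makes failing conversion
   tests between two derivatives prohibitively slow; hence a sealed copy. *)
HB.lock Definition dd (R : realType) (V W : normedModType R) (f : V -> W)
  (v x : V) : W := 'D_v f x.

Lemma ddE (R : realType) (V W : normedModType R) (f : V -> W) (v x : V) :
  'D_v f x = dd f v x.
Proof. by rewrite dd.unlock. Qed.

Lemma dd_funE (R : realType) (V W : normedModType R) (f : V -> W) (v : V) :
  'D_v f = dd f v.
Proof. by apply/funext => x; exact: ddE. Qed.

Section SealedDerivative.
Context {R : realType} {m : nat} {W : normedModType R}.
Local Notation V := 'rV[R]_m.
Variables (D : set V) (oD : open D).
Implicit Types (f g : V -> W) (v w x : V).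

Lemma smooth_on_dd f v : smooth_on D f -> smooth_on D (dd f v).
Proof. by rewrite -dd_funE; exact: smooth_on_derive. Qed.

Lemma smooth_on_dd_field f (h : V -> V) :
  smooth_on D f -> smooth_on D h -> smooth_on D (fun y => dd f (h y) y).
Proof.
move=> sf sh; under eq_fun do rewrite -ddE.
exact: (smooth_on_derive_field oD sf sh).
Qed.

Lemma dd_eq f g v x : D x -> {in D, f =1 g} -> dd f v x = dd g v x.
Proof. by move=> Dx E; rewrite -!ddE; exact: derive_eq_near oD Dx E. Qed.

Lemma dd_cst (c : W) v x : dd (fun=> c) v x = 0.
Proof. by rewrite -ddE; exact: derive_cst. Qed.

Section At.
Variables (f g : V -> W) (x : V).
Hypotheses (Dx : D x) (sf : smooth_on D f) (sg : smooth_on D g).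

Let df := smooth_on_differentiable sf Dx.
Let dg := smooth_on_differentiable sg Dx.

Lemma dd_dirD v w : dd f (v + w) x = dd f v x + dd f w x.
Proof. by rewrite -!ddE; exact: derive_dirD. Qed.

Lemma dd_dirZ (k : R) v : dd f (k *: v) x = k *: dd f v x.
Proof. by rewrite -!ddE; exact: derive_dirZ. Qed.

Lemma dd_dirB v w : dd f (v - w) x = dd f v x - dd f w x.
Proof. by rewrite -!ddE; exact: derive_dirB. Qed.

Lemma ddD v : dd (fun y => f y + g y) v x = dd f v x + dd g v x.
Proof. by rewrite -!ddE; exact: derive_addf. Qed.

Lemma ddB v : dd (fun y => f y - g y) v x = dd f v x - dd g v x.
Proof. by rewrite -!ddE; exact: derive_subf. Qed.

Lemma ddZ (k : R) v : dd (fun y => k *: f y) v x = k *: dd f v x.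
Proof. by rewrite -!ddE; exact: derive_scalef. Qed.

Lemma dd_field (h : V -> V) v : smooth_on D h ->
  dd (fun y => dd f (h y) y) v x = dd f (dd h v x) x + dd (dd f (h x)) v x.
Proof.
move=> sh; rewrite -!ddE -(dd_funE f (h x)).
under eq_fun do rewrite -ddE.
exact: (derive_derive_along oD sf v Dx (smooth_on_differentiable sh Dx)).
Qed.

End At.

Lemma ddM (a : V -> R) f v x : D x -> smooth_on D a -> smooth_on D f ->
  dd (fun y => a y *: f y) v x = dd a v x *: f x + a x *: dd f v x.
Proof.
move=> Dx sa sf; rewrite -!ddE; apply: derive_mulf.
  exact: smooth_on_differentiable sa Dx.
exact: smooth_on_differentiable sf Dx.
Qed.

Lemma dd_sum (I : finType) (f : I -> V -> W) v x : D x ->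
  (forall i, smooth_on D (f i)) ->
  dd (fun y => \sum_i f i y) v x = \sum_i dd (f i) v x.
Proof.
move=> Dx sf; rewrite -ddE; under eq_bigr do rewrite -ddE.
by apply: derive_sumf => i; exact: smooth_on_differentiable (sf i) Dx.
Qed.

Lemma dd_linear p (l : 'rV[R]_p -> W) (f : V -> 'rV[R]_p) v x : linear l ->
  D x -> smooth_on D f -> dd (fun y => l (f y)) v x = l (dd f v x).
Proof.
move=> ll Dx sf; rewrite -!ddE; apply: derive_linear_comp => //.
exact: smooth_on_differentiable sf Dx.
Qed.

Lemma dd_family p (P : V -> 'rV[R]_p -> W) (h : V -> 'rV[R]_p) v x :
  (forall y, D y -> linear (P y)) -> (forall w : 'rV_p, smooth_on D (P^~ w)) ->
  D x -> smooth_on D h ->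
  dd (fun y => P y (h y)) v x = P x (dd h v x) + dd (P^~ (h x)) v x.
Proof.
move=> lP sP Dx sh; rewrite -!ddE.
exact: (derive_linear_family oD lP sP v Dx (smooth_on_differentiable sh Dx)).
Qed.

End SealedDerivative.

Lemma dd_comm {R : realType} {m p : nat} (D : set 'rV[R]_m)
    (f : 'rV[R]_m -> 'rV[R]_p) (v w x : 'rV[R]_m) : open D -> D x ->
  smooth_on D f -> dd (dd f w) v x = dd (dd f v) w x.
Proof.
by move=> oD Dx sf; rewrite -!ddE -!dd_funE; exact: derive_comm oD Dx sf.
Qed.

Lemma dd_comm_scalar {R : realType} {m : nat} (D : set 'rV[R]_m)
    (f : 'rV[R]_m -> R) (v w x : 'rV[R]_m) : open D -> D x ->
  smooth_on D f -> dd (dd f w) v x = dd (dd f v) w x.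
Proof.
by move=> oD Dx sf; rewrite -!ddE -!dd_funE; exact: derive_comm_scalar oD Dx sf.
Qed.

Lemma dd_lin {R : realType} {m p : nat} (l : 'rV[R]_m -> 'rV[R]_p)
  (v x : 'rV[R]_m) : linear l -> dd l v x = l v.
Proof. by move=> ll; rewrite -ddE; exact: derive_linear. Qed.

(** * Changes of charts *)

(* The part of [smooth_atlas] that does not mention a topology on [T]: unlike
   [smooth_atlas], it makes sense for [TM], which carries none here. *)
Record smooth_charts (R : realType) (m : nat) (T : Type) (A : atlas R m T)
    : Prop := SmoothCharts {
  charts_at : forall p, dom (chart_at A p) p ;
  charts_open : forall c d : chart A, open (coord c @` (dom c `&` dom d)) ;
  charts_K : forall (c : chart A) p, dom c p -> param c (coord c p) = p ;
  charts_smooth : forall c d : chart A,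
    smooth_on (coord c @` (dom c `&` dom d)) (coord d \o param c) }.

Lemma open_setI_preimage (T U : topologicalType) (D : set T) (D' : set U)
    (f : T -> U) : open D -> open D' -> (forall x, D x -> {for x, continuous
      f}) ->
  open (D `&` f @^-1` D').
Proof.
move=> oD oD' cf; rewrite openE => x [Dx Dfx].
apply: filterI; first exact: open_nbhs_nbhs.
by apply: (cf x Dx); exact: open_nbhs_nbhs.
Qed.

(** The image of an overlap is the part of the image of [dom c] that [param c] sends into [dom d],
    hence open by continuity of [param c]. *)
Lemma smooth_atlas_charts (R : realType) (m : nat) (T : topologicalType)
  (A : atlas R m T) : smooth_atlas A -> smooth_charts A.
Proof.
move=> sA; split; [exact: dom_chart_at| |exact: coordK|exact:
  transition_smooth].
move=> c d.
have -> : coord c @` (dom c `&` dom d) = (coord c @` dom c) `&` param c @^-1`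
  dom d.
  apply/seteqP; split=> x /=.
    by case=> p [cp dp] <-; split; [exists p|rewrite (coordK sA)].
  by case=> -[p cp <-]; rewrite (coordK sA)// => dp; exists p.
apply: open_setI_preimage; [exact: image_open|exact: dom_open|].
by move=> x; exact: param_continuous.
Qed.

Lemma linear_subr (R : pzRingType) (V W : lmodType R) (f : V -> W) (a b : V) :
  linear f -> f (a - b) = f a - f b.
Proof. by move=> lf; rewrite addrC -scaleN1r lf scaleN1r addrC. Qed.

Lemma linear_scal (R : pzRingType) (V W : lmodType R) (f : V -> W) (k : R) (v :
  V) :
  linear f -> f (k *: v) = k *: f v.
Proof.
move=> lf; have l0 := linear_subr 0 0 lf; rewrite !subrr in l0.
by have := lf k v 0; rewrite l0 !addr0.
Qed.

Lemma subr_addr2 (V : zmodType) (a b c : V) : (a + c) - (b + c) = a - b.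
Proof. by rewrite opprD addrACA subrr addr0. Qed.

Section Charts.
Context {R : realType} {m : nat} {T : Type} {A : atlas R m T}.
Hypothesis cA : smooth_charts A.
Implicit Types (c d e : chart A) (p q : T) (v w : 'rV[R]_m).

Definition overlap c d : set 'rV[R]_m := coord c @` (dom c `&` dom d).

Lemma overlapP c d p : dom c p -> dom d p -> overlap c d (coord c p).
Proof. by move=> cp dp; exists p. Qed.

Lemma overlap_open c d : open (overlap c d).
Proof. exact: charts_open. Qed.
Arguments overlap_open : clear implicits.

Lemma transition_differentiable c d p : dom c p -> dom d p ->
  differentiable (coord d \o param c) (coord c p).
Proof.
move=> cp dp; exact: smooth_on_differentiable (charts_smooth cA c d) (overlapP
  cp dp).
Qed.

(** A tangent vector is stored as its components in the preferred chart, so [tcoord] and [tparam]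
    are themselves derivatives of transition maps. This cocycle rule makes them mutually inverse and
    gives their change of chart. *)
Lemma transition_comp c d e p v : dom c p -> dom d p -> dom e p ->
  'D_v (coord e \o param c) (coord c p) =
  'D_('D_v (coord d \o param c) (coord c p)) (coord e \o param d) (coord d p).
Proof.
move=> cp dp ep.
have E : {in overlap c d, coord e \o param c =1
    (coord e \o param d) \o (coord d \o param c)}.
  by move=> x; rewrite inE => -[q [cq dq] <-] /=; rewrite !(charts_K cA).
apply: (etrans (derive_eq_near v (overlap_open c d) (overlapP cp dp) E)).
have := @derive_comp _ _ _ _ (coord d \o param c) (coord e \o param d) (coord c
  p) v
  (transition_differentiable cp dp).
by rewrite /= (charts_K cA cp); apply; exact: transition_differentiable.
Qed.

Lemma transition_self c p v : dom c p -> 'D_v (coord c \o param c) (coord c p)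
  = v.
Proof.
move=> cp.
have E : {in overlap c c, coord c \o param c =1 id}.
  by move=> x; rewrite inE => -[q [cq _] <-] /=; rewrite (charts_K cA).
apply: (etrans (derive_eq_near v (overlap_open c c) (overlapP cp cp) E)).
exact: derive_id.
Qed.

Lemma tcoord_chart_at p v : tcoord (chart_at A p) p v = v.
Proof. exact/transition_self/charts_at. Qed.

Lemma tcoord_change c d p v : dom c p -> dom d p ->
  tcoord d p v = 'D_(tcoord c p v) (coord d \o param c) (coord c p).
Proof. by move=> cp dp; apply: transition_comp => //; exact: charts_at. Qed.

Lemma tparamE c p v : dom c p ->
  tparam c (coord c p) v = 'D_v (coord (chart_at A p) \o param c) (coord c p).
Proof. by move=> cp; rewrite /tparam (charts_K cA). Qed.

Lemma tparamK c p v : dom c p -> tcoord c p (tparam c (coord c p) v) = v.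
Proof.
move=> cp; rewrite tparamE// /tcoord /dmap /coord_at -transition_comp//.
  exact: transition_self.
exact: charts_at.
Qed.

Lemma tcoordK c p v : dom c p -> tparam c (coord c p) (tcoord c p v) = v.
Proof.
move=> cp; rewrite tparamE// -tcoord_change//; last exact: charts_at.
exact: tcoord_chart_at.
Qed.

Lemma tcoord_linear c p : dom c p -> linear (tcoord c p).
Proof.
move=> cp a v w; have dt := transition_differentiable (charts_at cA p) cp.
by rewrite /tcoord /dmap derive_dirD// derive_dirZ.
Qed.

Lemma tparam_linear c p : dom c p -> linear (tparam c (coord c p)).
Proof.
move=> cp a v w; have dt := transition_differentiable cp (charts_at cA p).
by rewrite !tparamE// derive_dirD// derive_dirZ.
Qed.

Lemma tcoord_inj c p : dom c p -> injective (tcoord c p).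
Proof. by move=> cp v w E; rewrite -(tcoordK v cp) E tcoordK. Qed.

Lemma dmapE (W : normedModType R) c (f : T -> W) p v : dom c p ->
  differentiable (f \o param c) (coord c p) ->
  dmap A f p v = 'D_(tcoord c p v) (f \o param c) (coord c p).
Proof.
move=> cp df; set e := chart_at A p; have ep := charts_at cA p.
have E : {in overlap e c, f \o param e =1
    (f \o param c) \o (coord c \o param e)}.
  by move=> x; rewrite inE => -[q [eq cq] <-] /=; rewrite !(charts_K cA).
apply: (etrans (derive_eq_near v (overlap_open e c) (overlapP ep cp) E)).
have := @derive_comp _ _ _ _ (coord c \o param e) (f \o param c) (coord e p) v
  (transition_differentiable ep cp).
by rewrite /= (charts_K cA ep); apply.
Qed.

Lemma smooth_at_param (W : normedModType R) c d (f : T -> W) p :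
  dom c p -> dom d p ->
  smooth_at (f \o param c) (coord c p) -> smooth_at (f \o param d) (coord d p).
Proof.
move=> cp dp [U [oU Up] sf].
pose D := overlap d c `&` (coord c \o param d) @^-1` U.
have oD : open D.
  apply: open_setI_preimage; [exact: overlap_open|exact: oU|].
  by move=> x; exact: smooth_on_continuous (charts_smooth cA d c).
have st : smooth_on D (coord c \o param d).
  exact: smooth_on_sub (@subIsetl _ _ _) (charts_smooth cA d c).
exists D.
  by split=> //; split; [exact: overlapP|rewrite /= (charts_K cA dp)].
have DU x : D x -> U ((coord c \o param d) x) by case.
have S := smooth_on_comp oD DU sf st.
apply: (smooth_on_eq oD _ S) => x; rewrite inE => -[[q [dq cq] <-] _] /=.
by rewrite !(charts_K cA).
Qed.

Lemma local_field_coord c X p : dom c p ->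
  local_field c X (coord c p) = tcoord c p (X p).
Proof. by move=> cp; rewrite /local_field (charts_K cA). Qed.

Lemma local_field_change c d X x : overlap c d x ->
  local_field d X (coord d (param c x)) =
  'D_(local_field c X x) (coord d \o param c) x.
Proof.
case=> p [cp dp] <-; rewrite (charts_K cA)// !local_field_coord//.
exact: tcoord_change.
Qed.

Lemma smooth_on_local_field c d X (D D' : set 'rV[R]_m) : open D ->
  D `<=` overlap d c -> (forall x, D x -> D' (coord c (param d x))) ->
  D' `<=` overlap c d ->
  smooth_on D' (local_field c X) -> smooth_on D (local_field d X).
Proof.
move=> oD Dd DD' D'c sX.
have st : smooth_on D (coord c \o param d).
  exact: smooth_on_sub Dd (charts_smooth cA d c).
have st' := smooth_on_sub D'c (charts_smooth cA c d).
have S := smooth_on_derive_along oD DD' st' st (smooth_on_comp oD DD' sX st).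
apply: (smooth_on_eq oD _ S) => x; rewrite inE => Dx /=.
have [p [dp cp] <-] := Dd _ Dx; rewrite (charts_K cA)// -local_field_change.
  by rewrite (charts_K cA).
exact: overlapP.
Qed.

Lemma smooth_at_local_field c d X p : dom c p -> dom d p ->
  smooth_at (local_field c X) (coord c p) -> smooth_at (local_field d X) (coord
    d p).
Proof.
move=> cp dp [U [oU Up] sX].
pose D := overlap d c `&` (coord c \o param d) @^-1` (U `&` overlap c d).
have oD : open D.
  apply: open_setI_preimage; [exact: overlap_open| |].
    by apply: openI; [exact: oU|exact: overlap_open].
  by move=> x; exact: smooth_on_continuous (charts_smooth cA d c).
exists D.
  split=> //; split; first exact: overlapP.
  by rewrite /= (charts_K cA dp); split=> //; exact: overlapP.
exact: (smooth_on_local_field oD (fun x h => proj1 h) (fun x h => proj2 h)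
  (@subIsetr _ _ _) (smooth_on_sub (@subIsetl _ _ _) sX)).
Qed.

(** Each half of the bracket changes by a second derivative of the transition map in the directions
    [X p] and [Y p]. The two extra terms agree by symmetry of second derivatives and cancel in the
    difference. *)
Lemma bracket_local c p X Y : dom c p ->
  smooth_at (local_field c X) (coord c p) ->
  smooth_at (local_field c Y) (coord c p) ->
  tcoord c p (bracket A X Y p) =
  'D_(tcoord c p (X p)) (local_field c Y) (coord c p) -
  'D_(tcoord c p (Y p)) (local_field c X) (coord c p).
Proof.
move=> cp sX sY; have ep := charts_at cA p; set e := chart_at A p in ep.
have oO := overlap_open e c; have Op := overlapP ep cp.
have sT := charts_smooth cA e c.
have dX : differentiable (local_field e X) (coord e p).
  have [U [_ Ue] sXe] := smooth_at_local_field cp ep sX.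
  exact: smooth_on_differentiable sXe Ue.
have dY : differentiable (local_field e Y) (coord e p).
  have [U [_ Ue] sYe] := smooth_at_local_field cp ep sY.
  exact: smooth_on_differentiable sYe Ue.
(* Read in the preferred chart [e], the components of [Y'] in [c] are the derivative of the
   transition along [local_field e Y']; differentiating this product-like expression yields the
   tensorial term and the Hessian term. *)
have half (X' Y' : T -> 'rV[R]_m) : smooth_at (local_field c Y') (coord c p) ->
    differentiable (local_field e Y') (coord e p) ->
  'D_(tcoord c p (X' p)) (local_field c Y') (coord c p) =
  tcoord c p ('D_(X' p) (local_field e Y') (coord e p)) +
  'D_(X' p) ('D_(Y' p) (coord c \o param e)) (coord e p).
  move=> [U [_ Ue] sYc] dYe.
  have dYc : differentiable (local_field c Y') (coord c p) by exact:
    smooth_on_differentiable sYc Ue.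
  have := @derive_comp _ _ _ _ (coord c \o param e) (local_field c Y') (coord e
    p) (X' p)
    (transition_differentiable ep cp).
  rewrite /= (charts_K cA ep) => /(_ dYc) <-.
  have E : {in overlap e c, local_field c Y' \o (coord c \o param e) =1
      (fun x => 'D_(local_field e Y' x) (coord c \o param e) x)}.
    by move=> x; rewrite inE => Ox /=; exact: local_field_change Ox.
  apply: (etrans (derive_eq_near (X' p) oO Op E)).
  rewrite (derive_derive_along oO sT (X' p) Op dYe).
  have -> // : local_field e Y' (coord e p) = Y' p.
  by rewrite (local_field_coord Y' ep) tcoord_chart_at.
have lin := tcoord_linear cp.
have hXY := half X Y sY dY; have hYX := half Y X sX dX.
rewrite (derive_comm (Y p) (X p) oO Op sT) in hYX.
apply/esym; apply: (etrans (congr2 (fun v w => v - w) hXY hYX)).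
by apply: (etrans (subr_addr2 _ _ _)); apply/esym; exact: linear_subr lin.
Qed.

End Charts.
Arguments overlap_open {R m T A} cA c d.

(** * The tangent bundle *)

Section TangentBundle.
Context {R : realType} {n : nat} {M : Type} {A : atlas R n M}.
Hypothesis cA : smooth_charts A.
Local Notation TM := (M * 'rV[R]_n)%type.
Local Notation TA := (tangent_atlas A).
Implicit Types (c d : chart A) (u : TM) (z : 'rV[R]_(n + n)) (w : 'rV[R]_n).

Lemma tangent_coordK c u : dom c u.1 ->
  param (c : chart TA) (coord (c : chart TA) u) = u.
Proof.
by case: u => p y cp; rewrite /= row_mxKl row_mxKr (charts_K cA cp) (tcoordK
  cA).
Qed.

Lemma tangent_overlap c d :
  coord (c : chart TA) @` (dom (c : chart TA) `&` dom (d : chart TA)) =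
  lsubmx @^-1` overlap c d.
Proof.
apply/seteqP; split=> z /=.
  by case=> -[p y] [/= cp dp] <-; rewrite row_mxKl; exact: overlapP.
case=> p [cp dp] pz; exists (p, tparam c (coord c p) (rsubmx z)) => //=.
by rewrite (tparamK cA)// pz hsubmxK.
Qed.

Lemma tangent_transition c d z : overlap c d (lsubmx z) ->
  (coord (d : chart TA) \o param (c : chart TA)) z =
  row_mx ((coord d \o param c) (lsubmx z))
    ('D_(rsubmx z) (coord d \o param c) (lsubmx z)).
Proof.
case=> p [cp dp] pz /=; rewrite -pz (charts_K cA cp); congr row_mx.
by rewrite (tcoord_change cA _ cp dp) (tparamK cA).
Qed.

Lemma tangent_charts : smooth_charts TA.
Proof.
have oO c d : open (lsubmx @^-1` overlap c d : set 'rV[R]_(n + n)).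
  apply: (@open_comp _ _ (@lsubmx R 1 n n) (overlap c d)).
    by move=> z _; exact: continuous_lsubmx.
  exact: overlap_open.
split=> [u|c d|c u|c d]; first exact: (charts_at cA).
- by rewrite tangent_overlap; exact: oO.
- exact: tangent_coordK.
- rewrite tangent_overlap.
  have := oO c d; set D := (X in open X) => oD.
  have sl : smooth_on D (@lsubmx R 1 n n).
    by apply: smooth_on_linear; exact: linear_lsub.
  have sr : smooth_on D (@rsubmx R 1 n n).
    by apply: smooth_on_linear; exact: linear_rsub.
  have lO z : D z -> @overlap _ _ _ A c d (lsubmx z) by [].
  have S1 := smooth_on_comp oD lO (charts_smooth cA c d) sl.
  have S2 := smooth_on_derive_along oD lO (charts_smooth cA c d) sl sr.
  apply: (smooth_on_eq oD _ (smooth_on_row_mx oD S1 S2)) => z; rewrite inE =>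
    Oz.
  by apply/esym; exact: tangent_transition.
Qed.

Lemma gammaE u w : gamma A u w = row_mx 0 w.
Proof.
rewrite /gamma /velocity /=.
have -> : coord (chart_at A u.1 : chart TA) \o (fun t : R => (u.1, u.2 + t *:
  w)) =
    (fun t : R => row_mx (coord (chart_at A u.1) u.1) u.2 + t *: row_mx 0 w).
  (* In the preferred chart of its base point a vector is its own list of components, so the curve
     is a straight line in the fibre coordinates. *)
  apply/funext => t /=; rewrite (tcoord_chart_at cA).
  by rewrite scale_row_mx add_row_mx scaler0 addr0.
exact: (derive_line _ _ _).2.
Qed.

Lemma rhoE u (v : 'rV[R]_(n + n)) : rho A u v = lsubmx v.
Proof.
set c := chart_at A u.1; have cu : dom c u.1 := charts_at cA u.1.
have E : {in overlap (c : chart TA) (c : chart TA),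
    (coord c \o fst) \o param (c : chart TA) =1 @lsubmx R 1 n n}.
  move=> z; rewrite inE /overlap tangent_overlap => -[p [cp _] pz] /=.
  by rewrite -pz (charts_K cA cp).
have oO := overlap_open tangent_charts (c : chart TA) (c : chart TA).
have Oz : overlap (c : chart TA) (c : chart TA) (coord (c : chart TA) u) by
  exists u.
apply: (etrans (derive_eq_near v oO Oz E)).
by rewrite derive_linear//; exact: linear_lsub.
Qed.

Lemma JE u v : J A u v = row_mx 0 (lsubmx v).
Proof. by rewrite /J gammaE rhoE. Qed.

Lemma tangent_tcoord_lsub c u v : dom c u.1 ->
  lsubmx (tcoord (c : chart TA) u v) = tcoord c u.1 (lsubmx v).
Proof.
move=> cu; set e := chart_at A u.1; have eu : dom e u.1 := charts_at cA u.1.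
rewrite /tcoord /dmap /coord_at -/e.
have dT : differentiable (coord (c : chart TA) \o param (e : chart TA))
    (coord (e : chart TA) u).
  exact: (transition_differentiable tangent_charts).
have := derive_linear_comp v (@linear_lsub R n n) dT => <-.
have -> : (fun z => lsubmx ((coord (c : chart TA) \o param (e : chart TA)) z)) =
    (coord c \o param e) \o lsubmx.
  by apply/funext => z /=; rewrite row_mxKl.
have dl : differentiable (@lsubmx R 1 n n) (coord (e : chart TA) u).
  by apply: differentiable_linear; exact: linear_lsub.
have El : lsubmx (coord (e : chart TA) u) = coord e u.1 by rewrite /= row_mxKl.
have dt : differentiable (coord c \o param e) (lsubmx (coord (e : chart TA) u)).
  by rewrite El; exact: (transition_differentiable cA).
have := derive_comp v dl dt => ->.
by rewrite El (derive_linear _ _ (@linear_lsub R n n)).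
Qed.

(** On a single fibre the induced transition map is linear, so it is affine along a vertical line
    and no second derivative of the transition on the base appears. *)
Lemma tangent_tcoord_vert c u w : dom c u.1 ->
  tcoord (c : chart TA) u (row_mx 0 w) = row_mx 0 (tcoord c u.1 w).
Proof.
move=> cu; set e := chart_at A u.1; have eu : dom e u.1 := charts_at cA u.1.
have dT : differentiable (coord (c : chart TA) \o param (e : chart TA))
    (coord (e : chart TA) u).
  exact: (transition_differentiable tangent_charts).
apply: (etrans (derive_on_line (row_mx 0 w) dT)).
have -> : (fun a : R => (coord (c : chart TA) \o param (e : chart TA))
      (coord (e : chart TA) u + a *: row_mx 0 w)) =
    (fun a : R => row_mx (coord c u.1) (tcoord c u.1 u.2) +
       a *: row_mx 0 (tcoord c u.1 w)).
  apply/funext => a; rewrite tangent_transition.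
    rewrite /= scale_row_mx add_row_mx scaler0 addr0 row_mxKl row_mxKr.
    rewrite (charts_K cA)// scale_row_mx add_row_mx scaler0 addr0; congr row_mx.
    rewrite -/e addrC [RHS]addrC (tcoord_chart_at cA).
    exact: (tcoord_linear cA cu a w u.2).
  rewrite /= scale_row_mx add_row_mx scaler0 addr0 row_mxKl.
  exact: overlapP.
exact: (derive_line _ _ _).2.
Qed.

Lemma tangent_coord_lsub c u : lsubmx (coord (c : chart TA) u) = coord c u.1.
Proof. by rewrite /= row_mxKl. Qed.

Lemma tangent_coord_rsub c u : rsubmx (coord (c : chart TA) u) = tcoord c u.1
  u.2.
Proof. by rewrite /= row_mxKr. Qed.

Definition slit_image c : set 'rV[R]_(n + n) :=
  [set z | (coord c @` dom c) (lsubmx z) /\ rsubmx z != 0].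

Lemma slit_image_coord c u : dom c u.1 -> slit u ->
  slit_image c (coord (c : chart TA) u).
Proof.
move=> cu su; split; first by rewrite tangent_coord_lsub; exists u.1.
rewrite tangent_coord_rsub; apply: contra su => /eqP y0.
apply/eqP; apply: (tcoord_inj cA cu); rewrite y0.
by have := linear_subr 0 0 (tcoord_linear cA cu); rewrite !subrr => ->.
Qed.

Lemma slit_imageP c z : slit_image c z ->
  exists u, [/\ dom c u.1, slit u, coord (c : chart TA) u = z &
                param (c : chart TA) z = u].
Proof.
case=> -[p cp pz] z0; pose u : TM := (p, tparam c (coord c p) (rsubmx z)).
have E : coord (c : chart TA) u = z by rewrite /= (tparamK cA)// pz hsubmxK.
have K := @tangent_coordK c u cp; rewrite E in K.
exists u; split; [exact: cp| |exact: E|exact: K].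
rewrite /slit /=; apply: contra z0 => /eqP y0.
have := tparamK cA (rsubmx z) cp; rewrite y0 => <-.
by have := linear_subr 0 0 (tcoord_linear cA cp); rewrite !subrr => ->.
Qed.

Lemma slit_image_open c : open (slit_image c).
Proof.
have -> : slit_image c = (overlap (c : chart TA) (c : chart TA)) `&`
    rsubmx @^-1` [set y : 'rV[R]_n | y != 0].
  rewrite /overlap tangent_overlap; apply/seteqP; split=> z.
    by move=> [[p cp pz] z0]; split=> //; exists p.
  by move=> [[p [cp _] pz] z0]; split=> //; exists p.
apply: open_setI_preimage; first exact: (overlap_open tangent_charts).
  have -> : [set y : 'rV[R]_n | y != 0] = ~` [set 0].
    by apply/seteqP; split=> y /= /eqP.
  apply: closed_openC; apply: accessible_closed_set1.
  by apply: hausdorff_accessible; exact: norm_hausdorff.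
by move=> z _; exact: continuous_rsubmx.
Qed.

End TangentBundle.
Arguments slit_image_open {R n M A} cA c.

(** * Sprays in coordinates *)

Lemma linear_comb_sub (R : pzRingType) (W : lmodType R) (k : R)
    (x1 x2 x3 y1 y2 y3 : W) : x1 = k *: x2 + x3 -> y1 = k *: y2 + y3 ->
  x1 - y1 = k *: (x2 - y2) + (x3 - y3).
Proof. by move=> -> ->; rewrite scalerBr opprD addrACA. Qed.

HB.lock Definition vert (R : realType) (n : nat) (w : 'rV[R]_n) : 'rV[R]_(n +
  n) :=
  row_mx 0 w.

(* With the spray written (y, B), the paper's nonlinear connection has
   coefficients N = - conn B. *)
HB.lock Definition conn (R : realType) (n : nat) (B : 'rV[R]_(n + n) ->
  'rV[R]_n)
  (w : 'rV[R]_n) (z : 'rV[R]_(n + n)) : 'rV[R]_n := 2^-1 *: dd B (vert w) z.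

HB.lock Definition hor (R : realType) (n : nat) (B : 'rV[R]_(n + n) -> 'rV[R]_n)
  (w : 'rV[R]_n) (z : 'rV[R]_(n + n)) : 'rV[R]_(n + n) := row_mx w (conn B w z).

Section LocalSpray.
Context {R : realType} {n : nat}.
Local Notation V := 'rV[R]_(n + n).
Implicit Types (a b w : 'rV[R]_n) (z v : V).

(** Vertical part of the bracket of the horizontal lifts of the constant fields [a] and [b]; this is
    the curvature [S] of the nonlinear connection. *)
Definition hcurv (B : V -> 'rV[R]_n) a b z : 'rV[R]_n :=
  dd (conn B b) (hor B a z) z - dd (conn B a) (hor B b z) z.

Lemma linear_vert : linear (@vert R n).
Proof. by rewrite vert.unlock; exact: linear_row_mxr. Qed.

Lemma vertD w w' : vert (w + w') = vert w + vert w'.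
Proof. by rewrite vert.unlock add_row_mx addr0. Qed.

Lemma vertZ (k : R) w : vert (k *: w) = k *: vert w.
Proof. by rewrite vert.unlock scale_row_mx scaler0. Qed.

Lemma vertN w : vert (- w) = - vert w.
Proof. by rewrite -scaleN1r vertZ scaleN1r. Qed.

Lemma row_mx_vert w w' : row_mx w w' = row_mx w 0 + vert w'.
Proof. by rewrite vert.unlock add_row_mx addr0 add0r. Qed.

Lemma lsub_hor B w z : lsubmx (hor B w z) = w.
Proof. by rewrite hor.unlock row_mxKl. Qed.

Lemma rsub_hor B w z : rsubmx (hor B w z) = conn B w z.
Proof. by rewrite hor.unlock row_mxKr. Qed.

Lemma lsub_vert w : lsubmx (vert w) = 0.
Proof. by rewrite vert.unlock row_mxKl. Qed.

Lemma rsub_vert w : rsubmx (vert w) = w.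
Proof. by rewrite vert.unlock row_mxKr. Qed.

Section Spray.
Variables (D : set V) (B : V -> 'rV[R]_n).
Hypotheses (oD : open D) (sB : smooth_on D B).

Lemma smooth_on_conn w : smooth_on D (conn B w).
Proof.
rewrite (_ : conn B w = (fun z => 2^-1 *: dd B (vert w) z)); last first.
  by apply/funext => z; rewrite conn.unlock.
by apply: smooth_on_scale_cst => //; exact: smooth_on_dd.
Qed.

Lemma connD w w' z : D z -> conn B (w + w') z = conn B w z + conn B w' z.
Proof. by move=> Dz; rewrite conn.unlock vertD (dd_dirD Dz sB) scalerDr. Qed.

Lemma connZ (k : R) w z : D z -> conn B (k *: w) z = k *: conn B w z.
Proof.
by move=> Dz; rewrite conn.unlock vertZ (dd_dirZ Dz sB) scalerA mulrC -scalerA.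
Qed.

Lemma linear_conn z : D z -> linear (fun w => conn B w z).
Proof. by move=> Dz k a b; rewrite (connD _ _ Dz) (connZ _ _ Dz). Qed.

Lemma horD w w' z : D z -> hor B (w + w') z = hor B w z + hor B w' z.
Proof. by move=> Dz; rewrite hor.unlock (connD _ _ Dz) add_row_mx. Qed.

Lemma horZ (k : R) w z : D z -> hor B (k *: w) z = k *: hor B w z.
Proof. by move=> Dz; rewrite hor.unlock (connZ _ _ Dz) scale_row_mx. Qed.

Lemma linear_hor z : D z -> linear (fun w => hor B w z).
Proof. by move=> Dz k a b; rewrite (horD _ _ Dz) (horZ _ _ Dz). Qed.

Lemma smooth_on_hor w : smooth_on D (hor B w).
Proof.
rewrite (_ : hor B w = (fun z => row_mx w (conn B w z))); last first.
  by apply/funext => z; rewrite hor.unlock.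
by apply: smooth_on_row_mx => //; [exact: smooth_on_cst|exact: smooth_on_conn].
Qed.

Lemma smooth_on_hor_field h : smooth_on D h -> smooth_on D (fun z => hor B (h
  z) z).
Proof. exact: (smooth_on_linear_family oD linear_hor smooth_on_hor). Qed.

Lemma dd_connE a v z : D z -> dd (conn B a) v z = 2^-1 *: dd (dd B (vert a)) v
  z.
Proof.
move=> Dz; rewrite (_ : conn B a = (fun z => 2^-1 *: dd B (vert a) z)).
  by rewrite (ddZ Dz)//; exact: smooth_on_dd.
by apply/funext => y; rewrite conn.unlock.
Qed.

(** Up to the factor 1/2 both sides are second vertical derivatives of [B]; this is the vanishing of
    the torsion of the Berwald connection. *)
Lemma conn_sym a b z : D z -> dd (conn B b) (vert a) z = dd (conn B a) (vert b)
  z.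
Proof.
move=> Dz; rewrite (dd_connE _ _ Dz) (dd_connE _ _ Dz).
by rewrite (dd_comm (vert b) (vert a) oD Dz sB).
Qed.

Lemma dd_hor w v z : D z -> dd (hor B w) v z = vert (dd (conn B w) v z).
Proof.
move=> Dz.
rewrite (_ : hor B w = (fun y => row_mx w 0 + vert (conn B w y))); last first.
  by apply/funext => y; rewrite hor.unlock row_mx_vert.
rewrite (ddD Dz (smooth_on_cst _ _)); last first.
  exact: (smooth_on_linear_comp oD linear_vert (smooth_on_conn w)).
by rewrite dd_cst add0r (dd_linear _ linear_vert Dz (smooth_on_conn w)).
Qed.

Lemma dd_hor_field (h : V -> 'rV[R]_n) v z : D z -> smooth_on D h ->
  dd (fun y => hor B (h y) y) v z =
  hor B (dd h v z) z + vert (dd (conn B (h z)) v z).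
Proof.
move=> Dz sh; rewrite (dd_family oD v linear_hor smooth_on_hor Dz sh).
by rewrite -(dd_hor _ _ Dz).
Qed.

Lemma dd_connD a b v z : D z ->
  dd (conn B (a + b)) v z = dd (conn B a) v z + dd (conn B b) v z.
Proof.
move=> Dz; rewrite -(ddD Dz (smooth_on_conn a) (smooth_on_conn b)).
by apply: (dd_eq oD _ Dz) => y; rewrite inE => Dy; exact: connD.
Qed.

Lemma dd_connZ (k : R) a v z : D z ->
  dd (conn B (k *: a)) v z = k *: dd (conn B a) v z.
Proof.
move=> Dz; rewrite -(ddZ Dz (smooth_on_conn a)).
by apply: (dd_eq oD _ Dz) => y; rewrite inE => Dy; exact: connZ.
Qed.

Lemma smooth_on_hcurv a b : smooth_on D (hcurv B a b).
Proof.
by apply: smooth_on_sub_fun => //; apply: smooth_on_dd_field => //;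
  [exact: smooth_on_conn|exact: smooth_on_hor|
   exact: smooth_on_conn|exact: smooth_on_hor].
Qed.

Lemma hcurvC a b z : hcurv B a b z = - hcurv B b a z.
Proof. by rewrite /hcurv opprB. Qed.

Lemma linear_hcurvr a z : D z -> linear (fun b => hcurv B a b z).
Proof.
move=> Dz k b b'; rewrite /hcurv (dd_connD _ _ _ Dz) (dd_connZ _ _ _ Dz).
rewrite (horD _ _ Dz) (horZ _ _ Dz).
rewrite (dd_dirD Dz (smooth_on_conn a)) (dd_dirZ Dz (smooth_on_conn a)).
exact: linear_comb_sub.
Qed.

Lemma linear_hcurvl b z : D z -> linear (fun a => hcurv B a b z).
Proof.
move=> Dz k a a'; rewrite (hcurvC _ b) (hcurvC a b) (hcurvC a' b).
have /(_ k a a') := linear_hcurvr b Dz => ->.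
by rewrite opprD scalerN.
Qed.

(* The right-hand side is the curvature of the Berwald connection with
   Christoffel symbols [- dd (conn B b) (vert d)]. *)
Lemma dd_hcurv_vert a b d z : D z ->
  dd (hcurv B a b) (vert d) z =
  (dd (dd (conn B b) (vert d)) (hor B a z) z +
   dd (conn B b) (vert (dd (conn B a) (vert d) z)) z) -
  (dd (dd (conn B a) (vert d)) (hor B b z) z +
   dd (conn B a) (vert (dd (conn B b) (vert d) z)) z).
Proof.
move=> Dz.
have half a' b' : dd (fun y => dd (conn B b') (hor B a' y) y) (vert d) z =
    dd (dd (conn B b') (vert d)) (hor B a' z) z +
    dd (conn B b') (vert (dd (conn B a') (vert d) z)) z.
  rewrite (dd_field oD Dz (smooth_on_conn b') (vert d) (smooth_on_hor a')).
  rewrite (dd_hor _ _ Dz) addrC.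
  by rewrite (dd_comm (vert d) _ oD Dz (smooth_on_conn b')).
rewrite -!half; apply: (ddB Dz); apply: smooth_on_dd_field => //;
  by [exact: smooth_on_conn|exact: smooth_on_hor].
Qed.

Lemma linear_dd_conn v z : D z -> linear (fun a => dd (conn B a) v z).
Proof. by move=> Dz k a b; rewrite (dd_connD _ _ _ Dz) (dd_connZ _ _ _ Dz). Qed.

Lemma smooth_on_conn_field h : smooth_on D h -> smooth_on D (fun z => conn B (h
  z) z).
Proof. exact: (smooth_on_linear_family oD linear_conn smooth_on_conn). Qed.

Section ConnectionFields.
Variables a b : V -> 'rV[R]_n.
Hypotheses (sa : smooth_on D a) (sb : smooth_on D b).

Let svb : smooth_on D (fun y => vert (b y)).
Proof. exact: (smooth_on_linear_comp oD linear_vert sb). Qed.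

Let sP w : smooth_on D (fun y => dd (conn B w) (vert (b y)) y).
Proof. by apply: smooth_on_dd_field => //; exact: smooth_on_conn. Qed.

Let lP y : D y -> linear (fun w => dd (conn B w) (vert (b y)) y).
Proof. exact: linear_dd_conn. Qed.

Lemma smooth_on_dd_conn_field :
  smooth_on D (fun y => dd (conn B (a y)) (vert (b y)) y).
Proof. exact: (smooth_on_linear_family oD lP sP sa). Qed.

Lemma dd_dd_conn_field v z : D z ->
  dd (fun y => dd (conn B (a y)) (vert (b y)) y) v z =
  dd (conn B (dd a v z)) (vert (b z)) z +
  (dd (conn B (a z)) (vert (dd b v z)) z +
   dd (dd (conn B (a z)) (vert (b z))) v z).
Proof.
move=> Dz; rewrite (dd_family oD v lP sP Dz sa); congr (_ + _).
rewrite (dd_field oD Dz (smooth_on_conn (a z)) v svb).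
by rewrite (dd_linear v linear_vert Dz sb).
Qed.

End ConnectionFields.

End Spray.
End LocalSpray.

(** * Projective invariance in coordinates *)

Section Euler.
Context {R : realType} {n : nat} {W : normedModType R}.
Local Notation V := 'rV[R]_(n + n).
Variables (D : set V) (oD : open D).
Hypothesis comm : forall (f : V -> W) z v (w : V), smooth_on D f -> D z ->
  dd (dd f w) v z = dd (dd f v) w z.

Let vr := fun z : V => vert (rsubmx z).

Lemma smooth_on_vert_rsub : smooth_on D vr.
Proof.
apply: (smooth_on_linear_comp oD linear_vert).
by apply: smooth_on_linear; exact: linear_rsub.
Qed.

Lemma dd_vert_rsub v z : D z -> dd vr v z = vert (rsubmx v).
Proof.
move=> Dz; have sr : smooth_on D (@rsubmx R 1 n n).
  by apply: smooth_on_linear; exact: linear_rsub.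
by rewrite /vr (dd_linear v linear_vert Dz sr) (dd_lin v z (@linear_rsub R n
  n)).
Qed.

Variables (f : V -> W) (k : R).
Hypotheses (sf : smooth_on D f)
  (ef : forall z, D z -> dd f (vert (rsubmx z)) z = k *: f z).

(** The Euler identity is differentiated along [v] and the two derivatives are exchanged; the last
    term arises because the direction [vert (rsubmx z)] moves with [z]. *)
Lemma euler_dd v z : D z ->
  dd (dd f v) (vert (rsubmx z)) z = k *: dd f v z - dd f (vert (rsubmx v)) z.
Proof.
move=> Dz; rewrite (comm _ _ sf Dz).
have E := dd_field oD Dz sf v smooth_on_vert_rsub.
rewrite (dd_vert_rsub _ Dz) in E.
apply/eqP; rewrite eq_sym subr_eq addrC -E -(ddZ Dz sf); apply/eqP.
by apply: (dd_eq oD _ Dz) => y; rewrite inE => Dy; rewrite -ef.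
Qed.

Lemma euler_dd_vert w z : D z ->
  dd (dd f (vert w)) (vert (rsubmx z)) z = (k - 1) *: dd f (vert w) z.
Proof. by move=> Dz; rewrite euler_dd// rsub_vert scalerBl scale1r. Qed.

(** Horizontal differentiation keeps the degree of homogeneity: [conn B a] has degree 1, and the
    variation of the horizontal lift that this causes offsets the correction term of [euler_dd]. *)
Lemma euler_dd_hor (B : V -> 'rV[R]_n) a z : smooth_on D B -> D z ->
  dd (conn B a) (vert (rsubmx z)) z = conn B a z ->
  dd (fun y => dd f (hor B a y) y) (vert (rsubmx z)) z = k *: dd f (hor B a z)
    z.
Proof.
move=> sB Dz ec.
rewrite (dd_field oD Dz sf _ (smooth_on_hor oD sB a)) (dd_hor oD sB _ _ Dz) ec.
by rewrite (euler_dd _ Dz) rsub_hor addrC subrK.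
Qed.

End Euler.

Section ProjectiveInvariants.
Context {R : realType} {n : nat}.
Local Notation V := 'rV[R]_(n + n).
Implicit Types (a b w : 'rV[R]_n) (z v : V) (B : V -> 'rV[R]_n).

Definition htrace B a z : R := \sum_i hcurv B a (delta_mx 0 i) z 0 i.

(** In a chart [R2 X Y] becomes the derivative of [htrace B X] along [vert Y], the curvature being a
    vertical derivative of [hcurv]. This definition and the next three are the originals with that
    substitution, before any use of homogeneity. *)
Definition kscal_loc B z : R :=
  (n%:R - 1)^-1 * dd (htrace B (rsubmx z)) (vert (rsubmx z)) z.

Definition R1_loc B a z : R :=
  (n%:R - 1)^-1 * (n%:R * dd (htrace B a) (vert (rsubmx z)) z +
                   dd (htrace B (rsubmx z)) (vert a) z).

Definition W1_loc B a z : 'rV[R]_n :=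
  dd (hcurv B (rsubmx z) a) (vert (rsubmx z)) z - kscal_loc B z *: a
  + ((n%:R + 1)^-1 *
     (3 * R1_loc B a z - (n%:R + 1) * dd (kscal_loc B) (vert a) z)) *: rsubmx z.

Definition W2_loc B a b z : 'rV[R]_n :=
  dd (hcurv B a b) (vert (rsubmx z)) z + (n%:R + 1)^-1 *:
  ((R1_loc B b z *: a + dd (R1_loc B b) (vert a) z *: rsubmx z) -
   (R1_loc B a z *: b + dd (R1_loc B a) (vert b) z *: rsubmx z)).

Variables (D : set V) (oD : open D).

Let commV (f : V -> 'rV[R]_n) z v (w : V) : smooth_on D f -> D z ->
  dd (dd f w) v z = dd (dd f v) w z.
Proof. by move=> sf Dz; exact: dd_comm oD Dz sf. Qed.

Let commR (f : V -> R) z v (w : V) : smooth_on D f -> D z ->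
  dd (dd f w) v z = dd (dd f v) w z.
Proof. by move=> sf Dz; exact: dd_comm_scalar oD Dz sf. Qed.

Let smooth_rsub : smooth_on D (@rsubmx R 1 n n).
Proof. by apply: smooth_on_linear; exact: linear_rsub. Qed.

Let dd_rsub v z : dd (@rsubmx R 1 n n) v z = rsubmx v.
Proof. exact: dd_lin (@linear_rsub R n n). Qed.

Section Homogeneous.
Variable B : V -> 'rV[R]_n.
Hypotheses (sB : smooth_on D B)
  (eB : forall z, D z -> dd B (vert (rsubmx z)) z = 2 *: B z).

Lemma euler_conn a z : D z -> dd (conn B a) (vert (rsubmx z)) z = conn B a z.
Proof.
move=> Dz; rewrite (dd_connE sB _ _ Dz) (euler_dd_vert oD commV sB eB _ Dz).
by rewrite (_ : 2 - 1 = 1 :> R) ?scale1r ?conn.unlock//; ring.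
Qed.

(** Both halves of [hcurv] are horizontal derivatives of coefficients of degree 1, and horizontal
    differentiation keeps the degree. *)
Lemma euler_hcurv a b z : D z ->
  dd (hcurv B a b) (vert (rsubmx z)) z = hcurv B a b z.
Proof.
move=> Dz.
have half a' b' : dd (fun y => dd (conn B b') (hor B a' y) y) (vert (rsubmx z))
  z =
    dd (conn B b') (hor B a' z) z.
  have e1 y : D y -> dd (conn B b') (vert (rsubmx y)) y = 1 *: conn B b' y.
    by move=> Dy; rewrite scale1r euler_conn.
  rewrite (euler_dd_hor oD commV (smooth_on_conn oD sB b') e1 sB Dz) ?scale1r//.
  exact: euler_conn.
rewrite /hcurv -!half; apply: (ddB Dz); apply: smooth_on_dd_field => //;
  by [exact: smooth_on_conn|exact: smooth_on_hor].
Qed.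

Lemma smooth_on_htrace a : smooth_on D (htrace B a).
Proof.
apply: smooth_on_sum => // i; apply: smooth_on_entry => //.
exact: smooth_on_hcurv.
Qed.

Lemma dd_htrace a v z : D z ->
  dd (htrace B a) v z = \sum_i dd (hcurv B a (delta_mx 0 i)) v z 0 i.
Proof.
move=> Dz; rewrite /htrace.
rewrite (dd_sum v Dz); last first.
  by move=> i; apply: smooth_on_entry => //; exact: smooth_on_hcurv.
apply: eq_bigr => i _.
exact: (dd_linear v (@linear_entry R n i) Dz (smooth_on_hcurv oD sB a (delta_mx
  0 i))).
Qed.

Lemma linear_htrace z : D z -> linear (fun a => htrace B a z : R^o).
Proof.
move=> Dz k a b; rewrite /htrace scaler_sumr -big_split/=; apply: eq_bigr => i
  _.
have /(_ k a b) := linear_hcurvl oD sB (delta_mx 0 i) Dz => ->.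
by rewrite !mxE.
Qed.

Lemma euler_htrace a z : D z -> dd (htrace B a) (vert (rsubmx z)) z = htrace B
  a z.
Proof.
by move=> Dz; rewrite dd_htrace//; apply: eq_bigr => i _; rewrite euler_hcurv.
Qed.

Lemma kscal_locE z : D z ->
  kscal_loc B z = (n%:R - 1)^-1 * htrace B (rsubmx z) z.
Proof. by move=> Dz; rewrite /kscal_loc euler_htrace. Qed.

Lemma smooth_on_htrace_rsub : smooth_on D (fun z => htrace B (rsubmx z) z).
Proof.
exact: (smooth_on_linear_family oD linear_htrace smooth_on_htrace smooth_rsub).
Qed.

Lemma smooth_on_kscal_loc : smooth_on D (kscal_loc B).
Proof.
apply: (smooth_on_eq oD _ (smooth_on_scale_cst (n%:R - 1)^-1 oD
  smooth_on_htrace_rsub)).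
by move=> z; rewrite inE => Dz; rewrite kscal_locE.
Qed.

Lemma dd_kscal_loc v z : D z -> dd (kscal_loc B) v z =
  (n%:R - 1)^-1 * (htrace B (rsubmx v) z + dd (htrace B (rsubmx z)) v z).
Proof.
move=> Dz.
have E : {in D, kscal_loc B =1 (fun z => (n%:R - 1)^-1 *: (htrace B (rsubmx z)
  z : R^o))}.
  by move=> y; rewrite inE => Dy; rewrite kscal_locE.
rewrite (dd_eq oD v Dz E) (ddZ Dz smooth_on_htrace_rsub).
by rewrite (dd_family oD v linear_htrace smooth_on_htrace Dz smooth_rsub)
  dd_rsub.
Qed.

Lemma R1_locE a z : n%:R - 1 != 0 :> R -> D z ->
  R1_loc B a z = htrace B a z + dd (kscal_loc B) (vert a) z.
Proof.
move=> n1 Dz; rewrite /R1_loc euler_htrace// dd_kscal_loc// rsub_vert.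
by field.
Qed.

Lemma W1_locE a z : n%:R - 1 != 0 :> R -> D z ->
  W1_loc B a z = hcurv B (rsubmx z) a z - kscal_loc B z *: a
  + ((n%:R + 1)^-1 *
     (3 * (htrace B a z + dd (kscal_loc B) (vert a) z)
      - (n%:R + 1) * dd (kscal_loc B) (vert a) z)) *: rsubmx z.
Proof. by move=> n1 Dz; rewrite /W1_loc euler_hcurv// R1_locE. Qed.

Lemma smooth_on_R1_loc a : n%:R - 1 != 0 :> R -> smooth_on D (R1_loc B a).
Proof.
move=> n1.
have S := smooth_on_add oD (smooth_on_htrace a) (smooth_on_dd (vert a)
  smooth_on_kscal_loc).
by apply: (smooth_on_eq oD _ S) => z; rewrite inE => Dz; rewrite R1_locE.
Qed.

End Homogeneous.

(** * Effect of a projective change on the curvature and its traces *)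

Section ProjectiveChange.
Variables (B B' : V -> 'rV[R]_n) (P : V -> R).
Hypotheses (sB : smooth_on D B) (sB' : smooth_on D B') (sP : smooth_on D P)
  (eB : forall z, D z -> dd B (vert (rsubmx z)) z = 2 *: B z)
  (eB' : forall z, D z -> dd B' (vert (rsubmx z)) z = 2 *: B' z)
  (eP : forall z, D z -> dd P (vert (rsubmx z)) z = P z)
  (BB' : forall z, D z -> B' z = B z - (2 * P z) *: rsubmx z).

Let PA a := dd P (vert a).
Let Q a z := dd P (hor B a z) z - P z * PA a z.

Let sPA a : smooth_on D (PA a). Proof. exact: smooth_on_dd. Qed.
Let ePZ z : D z -> dd P (vert (rsubmx z)) z = 1 *: (P z : R^o).
Proof. by move=> Dz; rewrite scale1r eP. Qed.
Let ePA a z : D z -> dd (PA a) (vert (rsubmx z)) z = 0.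
Proof.
by move=> Dz; rewrite /PA (euler_dd_vert oD commR sP ePZ _ Dz) subrr scale0r.
Qed.

Lemma conn_projective a z : D z ->
  conn B' a z = conn B a z - (PA a z *: rsubmx z + P z *: a).
Proof.
move=> Dz; have s2P := smooth_on_scale_cst 2 oD sP.
have E : {in D, B' =1 (fun z => B z - (2 *: (P z : R^o)) *: rsubmx z)}.
  by move=> y; rewrite inE; exact: BB'.
rewrite conn.unlock (dd_eq oD _ Dz E) (ddB Dz sB (smooth_on_scale oD s2P
  smooth_rsub)).
rewrite (ddM _ Dz s2P smooth_rsub) (ddZ Dz sP) dd_rsub rsub_vert -/(PA a z).
by apply/rowP => i; rewrite !mxE /GRing.scale/=; field.
Qed.

Lemma hor_projective a z : D z ->
  hor B' a z = hor B a z - (PA a z *: vert (rsubmx z) + P z *: vert a).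
Proof.
move=> Dz; rewrite hor.unlock (conn_projective _ Dz) -!vertZ -vertD.
by rewrite row_mx_vert vertD vertN addrA -row_mx_vert.
Qed.

Lemma dd_conn_projective a v z : D z ->
  dd (conn B' a) v z =
  dd (conn B a) v z - (dd (PA a) v z *: rsubmx z + PA a z *: rsubmx v + dd P v
    z *: a).
Proof.
move=> Dz.
have s1 := smooth_on_scale oD (sPA a) smooth_rsub.
have s2 := smooth_on_scale oD sP (@smooth_on_cst R V 'rV[R]_n D a).
have E : {in D, conn B' a =1 (fun z => conn B a z - (PA a z *: rsubmx z + P z
  *: a))}.
  by move=> y; rewrite inE; exact: conn_projective.
rewrite (dd_eq oD _ Dz E) (ddB Dz (smooth_on_conn oD sB a) (smooth_on_add oD s1
  s2)).
rewrite (ddD Dz s1 s2) (ddM _ Dz (sPA a) smooth_rsub).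
by rewrite (ddM _ Dz sP (smooth_on_cst D a)) dd_cst scaler0 addr0 dd_rsub.
Qed.

Lemma dd_hor_projective (W : normedModType R) (f : V -> W) a z :
  D z -> smooth_on D f -> dd f (hor B' a z) z =
  dd f (hor B a z) z - (PA a z *: dd f (vert (rsubmx z)) z + P z *: dd f (vert
    a) z).
Proof.
move=> Dz sf; rewrite (hor_projective _ Dz) (dd_dirB Dz sf) (dd_dirD Dz sf).
by rewrite !(dd_dirZ Dz sf).
Qed.

Let dPA_sym a b z : D z -> dd (PA a) (vert b) z = dd (PA b) (vert a) z.
Proof. by move=> Dz; exact: commR. Qed.

Let sPhor a : smooth_on D (fun z => dd P (hor B a z) z).
Proof. by apply: smooth_on_dd_field => //; exact: smooth_on_hor. Qed.

Let sPPA a : smooth_on D (fun z => P z * PA a z).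
Proof. exact: (smooth_on_scale oD sP (sPA a)). Qed.

Let sQ a : smooth_on D (Q a).
Proof. exact: smooth_on_sub_fun. Qed.

(** Of the terms in the vertical derivative of [Q], those with [conn], those with the product of two
    [PA] and those with a second vertical derivative of [P] are symmetric in [a] and [b]. Only the
    mixed derivatives of [P] survive, and these are what the change of [hcurv] produces along y. *)
Let dQ a b z : D z -> dd (Q a) (vert b) z - dd (Q b) (vert a) z =
  dd (PA b) (hor B a z) z - dd (PA a) (hor B b z) z.
Proof.
move=> Dz.
have half a' b' : dd (Q a') (vert b') z =
    dd P (vert (dd (conn B a') (vert b') z)) z + dd (PA b') (hor B a' z) z -
    (PA b' z * PA a' z + P z * dd (PA a') (vert b') z).
  rewrite /Q (ddB Dz (sPhor a') (sPPA a')).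
  rewrite (dd_field oD Dz sP _ (smooth_on_hor oD sB a')) (dd_hor oD sB _ _ Dz).
  have /= -> := ddM (vert b') Dz sP (sPA a').
  by rewrite (commR (vert b') (hor B a' z) sP Dz).
rewrite !half (conn_sym oD sB a b Dz) (dPA_sym a b Dz).
by ring.
Qed.

(** The terms symmetric in [a] and [b] drop out. In the coefficient of [b], the derivative of [P]
    along the new horizontal lift contributes [P z * PA a z] twice and the derivative of [rsubmx]
    along the new lift of [b] removes one copy; what is left is [- Q a z]. *)
Lemma hcurv_projective a b z : D z ->
  hcurv B' a b z = hcurv B a b z -
    ((dd (Q a) (vert b) z - dd (Q b) (vert a) z) *: rsubmx z
     + Q a z *: b - Q b z *: a).
Proof.
move=> Dz; rewrite (dQ _ _ Dz) /hcurv !(dd_conn_projective _ _ Dz).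
rewrite !(dd_hor_projective _ Dz (smooth_on_conn oD sB _)).
rewrite !(dd_hor_projective _ Dz (sPA _)) !(dd_hor_projective _ Dz sP).
rewrite (hor_projective a Dz) (hor_projective b Dz).
rewrite !(linear_subr _ _ (@linear_rsub R n n)).
rewrite -!vertZ -!vertD !rsub_vert !rsub_hor.
rewrite !(euler_conn sB eB _ Dz) !(ePA _ Dz) (conn_sym oD sB a b Dz) (eP Dz).
rewrite (dPA_sym a b Dz) /Q -!/(PA _ _).
apply/rowP => i; rewrite !mxE /GRing.scale/=; ring.
Qed.

Let linearQ z : D z -> linear (fun a => Q a z : R^o).
Proof.
move=> Dz k a b; rewrite /Q /PA (linear_hor sB Dz) linear_vert.
rewrite !(dd_dirD Dz sP) !(dd_dirZ Dz sP) /GRing.scale/=; ring.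
Qed.

(** [Q a] has degree 1: the horizontal derivative keeps the degree 1 of [P], while [PA a] has degree
    0. *)
Let eQ a z : D z -> dd (Q a) (vert (rsubmx z)) z = Q a z.
Proof.
move=> Dz; rewrite /Q (ddB Dz (sPhor a) (sPPA a)).
rewrite (euler_dd_hor oD commR sP ePZ sB Dz (euler_conn sB eB a Dz)).
have /= -> := ddM (vert (rsubmx z)) Dz sP (sPA a).
by rewrite (eP Dz) ePA// scale1r scaler0 addr0.
Qed.

Let q z := Q (rsubmx z) z.

Let sq : smooth_on D q.
Proof. exact: (smooth_on_linear_family oD linearQ sQ smooth_rsub). Qed.

Let dq a z : D z -> dd q (vert a) z = Q a z + dd (Q (rsubmx z)) (vert a) z.
Proof.
move=> Dz.
by rewrite /q (dd_family oD _ linearQ sQ Dz smooth_rsub) dd_rsub rsub_vert.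
Qed.

Let linear_dQ v z : D z -> linear (fun a => dd (Q a) v z : R^o).
Proof.
move=> Dz k a b.
have skQ : smooth_on D (fun y => k *: (Q a y : R^o)) by exact:
  smooth_on_scale_cst.
rewrite -(ddZ Dz (sQ a)) -(ddD Dz skQ (sQ b)).
by apply: (dd_eq oD _ Dz) => y; rewrite inE => Dy; exact: linearQ.
Qed.

(** In the trace over [b] the four terms give, in order: [Q a] by the Euler identity; minus the
    derivative of [Q y] at fixed y, that is [Q a] minus the derivative of [q]; n times [Q a]; and
    [- Q a]. Their sum has coefficient n + 1 on [Q a]. *)
Lemma htrace_projective a z : D z ->
  htrace B' a z = htrace B a z - ((n%:R + 1) * Q a z - dd q (vert a) z).
Proof.
move=> Dz; rewrite /htrace.
have E1 : \sum_i dd (Q a) (vert (delta_mx 0 i)) z * rsubmx z 0 i = Q a z.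
  rewrite -(eQ _ Dz); have sQa := sQ a.
  have lv : linear (fun w => dd (Q a) (vert w) z : R^o).
    by move=> k w w'; rewrite linear_vert (dd_dirD Dz sQa) (dd_dirZ Dz sQa).
  rewrite (linear_family_basis (D := setT) (P := fun _ : V => fun w => dd (Q a)
    (vert w) z : R^o) (fun _ _ => lv) (rsubmx z) (I : setT z)).
  by apply: eq_bigr => i _; rewrite mulrC.
have E2 : \sum_i dd (Q (delta_mx 0 i)) (vert a) z * rsubmx z 0 i =
    dd (Q (rsubmx z)) (vert a) z.
  rewrite (linear_family_basis (P := fun _ : V => fun w => dd (Q w) (vert a) z
    : R^o) (fun _ _ => linear_dQ (vert a) Dz) (rsubmx z) (I : setT z)).
  by apply: eq_bigr => i _; rewrite mulrC.
have E3 : \sum_i Q (delta_mx 0 i) z * a 0 i = Q a z.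
  rewrite [RHS](linear_family_basis (P := fun _ : V => fun w => Q w z : R^o)
    (fun _ _ => linearQ Dz) a (I : setT z)).
  by apply: eq_bigr => i _; rewrite mulrC.
have E4 : \sum_(i < n) Q a z * ((i == i)%:R) = n%:R * Q a z.
  under eq_bigr do rewrite eqxx mulr1.
  by rewrite sumr_const card_ord mulr_natl.
rewrite (dq _ Dz) -E2.
rewrite (_ : _ - _ = \sum_i hcurv B a (delta_mx 0 i) z 0 i -
  ((\sum_i dd (Q a) (vert (delta_mx 0 i)) z * rsubmx z 0 i -
    \sum_i dd (Q (delta_mx 0 i)) (vert a) z * rsubmx z 0 i) +
   \sum_(i < n) Q a z * ((i == i)%:R) - \sum_i Q (delta_mx 0 i) z * a 0 i));
     last first.
  by rewrite E1 E2 E3 E4; ring.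
rewrite -!(sumrB, big_split)/=; apply: eq_bigr => i _.
rewrite (hcurv_projective _ _ Dz) !mxE eqxx/=; ring.
Qed.

Hypothesis n_gt1 : (1 < n)%N.

Let n1 : n%:R - 1 != 0 :> R.
Proof. by rewrite subr_eq0 pnatr_eq1 gtn_eqF. Qed.

Let n2 : n%:R + 1 != 0 :> R.
Proof. by rewrite natr1 pnatr_eq0. Qed.

(** [q] is homogeneous of degree 2, so its derivative along y is [2 * q]. At [a] = y the trace
    therefore changes by (n + 1) - 2 = n - 1 times [q], which the factor of [kscal_loc] normalises
    to 1. *)
Lemma kscal_projective z : D z -> kscal_loc B' z = kscal_loc B z - q z.
Proof.
move=> Dz; rewrite (kscal_locE sB' eB' Dz) (kscal_locE sB eB Dz).
have := dq (rsubmx z) Dz; rewrite (eQ _ Dz) => dqz.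
by rewrite (htrace_projective _ Dz) dqz /q; field.
Qed.

Lemma dd_kscal_projective v z : D z ->
  dd (kscal_loc B') v z = dd (kscal_loc B) v z - dd q v z.
Proof.
move=> Dz; rewrite -(ddB Dz (smooth_on_kscal_loc sB eB) sq).
by apply: (dd_eq oD _ Dz) => y; rewrite inE; exact: kscal_projective.
Qed.

(** The derivative of [q] enters the change of [htrace] and that of the derivative of [kscal_loc]
    with opposite signs; adding the two isolates [Q]. *)
Lemma R1_projective a z : D z ->
  R1_loc B' a z = R1_loc B a z - (n%:R + 1) * Q a z.
Proof.
move=> Dz; rewrite (R1_locE sB' eB' _ n1 Dz) (R1_locE sB eB _ n1 Dz).
by rewrite (htrace_projective _ Dz) (dd_kscal_projective _ Dz); ring.
Qed.

Lemma dd_R1_projective a v z : D z ->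
  dd (R1_loc B' a) v z = dd (R1_loc B a) v z - (n%:R + 1) * dd (Q a) v z.
Proof.
move=> Dz; have s1 := smooth_on_R1_loc sB eB a n1.
have s2 : smooth_on D (fun y => (n%:R + 1) *: (Q a y : R^o)) by exact:
  smooth_on_scale_cst.
have E := ddZ Dz (sQ a) (n%:R + 1) v; rewrite /= in E.
rewrite -[_ * _]E -(ddB Dz s1 s2).
by apply: (dd_eq oD _ Dz) => y; rewrite inE; exact: R1_projective.
Qed.

(** With first argument y, the change of [hcurv] is [- q] times [a], compensated by [kscal_loc], and
    along y it is [3 * Q a] minus the derivative of [q]. The 3 collects one [Q a] from the Euler
    identity, one from [dq] and one from the term [Q b a]. The correction in [R1] and in the
    derivative of [kscal_loc] has the opposite change. *)
Lemma W1_projective a z : D z -> W1_loc B' a z = W1_loc B a z.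
Proof.
move=> Dz; rewrite (W1_locE sB' eB' _ n1 Dz) (W1_locE sB eB _ n1 Dz).
rewrite (hcurv_projective _ _ Dz) (htrace_projective _ Dz) (kscal_projective
  Dz).
rewrite (dd_kscal_projective _ Dz) (eQ _ Dz) (dq _ Dz) -/(q z).
by apply/rowP => i; rewrite !mxE; field.
Qed.

(** Here the compensation is term by term: [R1] absorbs the terms of the change of [hcurv] along [a]
    and [b], and the vertical derivatives of [R1] absorb the one along y. *)
Lemma W2_projective a b z : D z -> W2_loc B' a b z = W2_loc B a b z.
Proof.
move=> Dz; rewrite /W2_loc (euler_hcurv sB' eB' _ _ Dz) (euler_hcurv sB eB _ _
  Dz).
rewrite (hcurv_projective _ _ Dz) !(R1_projective _ Dz) !(dd_R1_projective _ _
  Dz).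
by apply/rowP => i; rewrite !mxE; field.
Qed.

End ProjectiveChange.
End ProjectiveInvariants.

(** * The Barthel connection in a chart *)

Lemma smooth_on_smooth_atP (R : realType) (V W : normedModType R) (D : set V)
    (f : V -> W) x : open D -> D x -> smooth_at f x ->
  exists2 U, open_nbhs x U & U `<=` D /\ smooth_on U f.
Proof.
move=> oD Dx [U [oU Ux] sf]; exists (U `&` D).
  by split=> //; exact: openI.
by split=> [y []//|]; apply: smooth_on_sub sf => y [].
Qed.

Lemma half_addxx (R : realType) (m : nat) (v : 'rV[R]_m) : 2^-1 *: (v + v) = v.
Proof. by apply/rowP => i; rewrite !mxE; field. Qed.

Lemma half_sub (R : realType) (m : nat) (v w : 'rV[R]_m) :
  2^-1 *: (v - w) = v - 2^-1 *: (v + w).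
Proof. by apply/rowP => i; rewrite !mxE; field. Qed.

Lemma row_mx_subl (R : realType) (n : nat) (a b c : 'rV[R]_n) :
  row_mx a b - row_mx a c = vert (b - c).
Proof. by rewrite vert.unlock opp_row_mx add_row_mx subrr. Qed.

Lemma row_mx_sub_vert (R : realType) (n : nat) (a b l r : 'rV[R]_n) :
  row_mx a b - vert l - vert (r - l) = row_mx a (b - r).
Proof.
rewrite vert.unlock !opp_row_mx !add_row_mx oppr0 !addr0; congr row_mx.
by rewrite opprB addrA subrK.
Qed.

(* Components in the chart of [TM] induced by [c] of a vector field on [TM]
   ([vrep]) and of a pi-vector field ([prep]). *)
HB.lock Definition vrep (R : realType) (n : nat) (M : Type) (A : atlas R n M)
    (c : chart A) (X : @vfield R n M) : 'rV[R]_(n + n) -> 'rV[R]_(n + n) :=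
  local_field (c : chart (tangent_atlas A)) X.

HB.lock Definition prep (R : realType) (n : nat) (M : Type) (A : atlas R n M)
    (c : chart A) (Z : @pfield R n M) (z : 'rV[R]_(n + n)) : 'rV[R]_n :=
  let u := param (c : chart (tangent_atlas A)) z in tcoord c u.1 (Z u).

Section Operators.
Context {R : realType} {n : nat} {M : Type} {A : atlas R n M}.
Hypothesis cA : smooth_charts A.
Local Notation TM := (M * 'rV[R]_n)%type.
Local Notation TA := (tangent_atlas A).
Let cT := tangent_charts cA.
Implicit Types (c d : chart A) (u : TM) (z v : 'rV[R]_(n + n)) (w : 'rV[R]_n)
  (X Y : @vfield R n M) (Z : @pfield R n M).

Let vrep_local_field c X : local_field (c : chart TA) X = vrep c X.
Proof. by rewrite vrep.unlock. Qed.

Local Notation image := (@slit_image R n M A).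

Lemma vrepE c X u : dom c u.1 ->
  vrep c X (coord (c : chart TA) u) = tcoord (c : chart TA) u (X u).
Proof. by move=> cu; rewrite vrep.unlock; exact: (local_field_coord cT). Qed.

Lemma prepE c Z u : dom c u.1 ->
  prep c Z (coord (c : chart TA) u) = tcoord c u.1 (Z u).
Proof. by move=> cu; rewrite prep.unlock (tangent_coordK cA cu). Qed.

Lemma smooth_on_vrep c X : smooth_vfield_on A slit X -> smooth_on (image c)
  (vrep c X).
Proof.
move=> sX; rewrite vrep.unlock.
apply: smooth_on_at => z /(slit_imageP cA)[u [cu su <- _]].
by apply: (smooth_at_local_field cT _ _ (sX _ su)) => //; exact: (charts_at cA).
Qed.

Lemma smooth_field_at_vrep c X u : dom c u.1 ->
  smooth_at (vrep c X) (coord (c : chart TA) u) <-> smooth_field_at TA X u.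
Proof.
move=> cu; have eu := charts_at cA u.1; rewrite vrep.unlock.
by split; exact: (smooth_at_local_field cT).
Qed.

Lemma vrep_gamma c Z z : image c z -> vrep c (gamma_f A Z) z = vert (prep c Z
  z).
Proof.
move=> /(slit_imageP cA)[u [cu su <- _]]; rewrite vrepE// prepE// vert.unlock.
by rewrite /gamma_f (gammaE cA) (tangent_tcoord_vert cA).
Qed.

Lemma prep_rho c X z : image c z -> prep c (rho_f A X) z = lsubmx (vrep c X z).
Proof.
move=> /(slit_imageP cA)[u [cu su <- _]]; rewrite vrepE// prepE//.
by rewrite /rho_f (rhoE cA) (tangent_tcoord_lsub cA).
Qed.

Lemma vrep_J c X z : image c z -> vrep c (J_f A X) z = vert (lsubmx (vrep c X
  z)).
Proof.
move=> cz; rewrite -[J_f A X]/(gamma_f A (rho_f A X)).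
by rewrite vrep_gamma// prep_rho.
Qed.

Lemma prep_eta c z : image c z -> prep c (@eta R n M) z = rsubmx z.
Proof.
by move=> /(slit_imageP cA)[u [cu su <- _]]; rewrite prepE// tangent_coord_rsub.
Qed.

(** Smoothness of [Z] is given in the preferred chart of each point. It is carried over to [c]
    through the vertical lift [gamma_f A Z], a vector field on [TM], for which independence of the
    chart is known. *)
Lemma smooth_on_prep c Z : smooth_pfield_on A slit Z -> smooth_on (image c)
  (prep c Z).
Proof.
move=> sZ; apply: smooth_on_at => z cz.
have [u [cu su uz _]] := slit_imageP cA cz.
have eu := charts_at cA u.1; set e := chart_at A u.1 in eu.
have oe := slit_image_open cA e.
have [U [oU Uu] [Ue sU]] := smooth_on_smooth_atP oe (slit_image_coord cA eu su)
  (sZ _ su).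
have S : smooth_on U (vrep e (gamma_f A Z)).
  have sU' : smooth_on U (prep e Z) by rewrite prep.unlock.
  apply: (smooth_on_eq oU _ (smooth_on_linear_comp oU linear_vert sU')) => y.
  by rewrite inE => Uy; rewrite vrep_gamma//; exact: Ue.
have Se : smooth_at (vrep e (gamma_f A Z)) (coord (e : chart TA) u) by exists U.
have Sc : smooth_at (vrep c (gamma_f A Z)) z.
  by rewrite -uz; apply/(smooth_field_at_vrep _ cu)/(smooth_field_at_vrep _ eu).
have [U' nU' [Uc sU']] := smooth_on_smooth_atP (slit_image_open cA c) cz Sc.
exists U' => //; have oU' := nU'.1.
apply: (smooth_on_eq oU' _ (smooth_on_rsub oU' sU')) => y; rewrite inE => Uy.
by rewrite vrep_gamma ?rsub_vert//; exact: Uc.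
Qed.

Lemma vrep_bracket c X Y z : image c z -> smooth_at (vrep c X) z ->
  smooth_at (vrep c Y) z ->
  vrep c (bracket TA X Y) z =
  dd (vrep c Y) (vrep c X z) z - dd (vrep c X) (vrep c Y z) z.
Proof.
move=> cz; have [u [cu su uz _]] := slit_imageP cA cz; rewrite -uz => sX sY.
rewrite -!vrep_local_field in sX sY.
have E := bracket_local cT (cu : dom (c : chart TA) u) sX sY.
rewrite !vrep_local_field in E.
have half X' Y' : 'D_(tcoord (c : chart TA) u (X' u)) (vrep c Y') (coord (c :
  chart TA) u) =
    dd (vrep c Y') (vrep c X' (coord (c : chart TA) u)) (coord (c : chart TA)
      u).
  by rewrite (vrepE X' cu); exact: ddE.
apply: (etrans (vrepE _ cu)); apply: (etrans E).
exact: (congr2 (fun a b => a - b) (half X Y) (half Y X)).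
Qed.

Lemma vrep_sub c X Y z : image c z ->
  vrep c (fun u => X u - Y u) z = vrep c X z - vrep c Y z.
Proof.
move=> /(slit_imageP cA)[u [cu su <- _]]; rewrite !vrepE//.
exact: linear_subr (tcoord_linear cT cu).
Qed.

Section Connection.
Variable G : @vfield R n M.
Hypotheses (sG : smooth_vfield_on A slit G)
  (eG : forall u, slit u -> rho A u (G u) = eta u).

Definition spray_coef c z : 'rV[R]_n := rsubmx (vrep c G z).

Lemma smooth_on_spray_coef c : smooth_on (image c) (spray_coef c).
Proof.
by apply: smooth_on_rsub; [exact: slit_image_open|exact: smooth_on_vrep].
Qed.

Lemma vrep_spray c z : image c z -> vrep c G z = row_mx (rsubmx z) (spray_coef
  c z).
Proof.
move=> cz; rewrite -[LHS]hsubmxK; congr row_mx.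
rewrite -(prep_rho _ cz) -[RHS](prep_eta cz).
have [u [cu su <- _]] := slit_imageP cA cz.
by rewrite (prepE (rho_f A G) cu) (prepE (@eta R n M) cu) /rho_f (eG su).
Qed.

Lemma dd_vrep_spray c v z : image c z ->
  dd (vrep c G) v z = row_mx (rsubmx v) (dd (spray_coef c) v z).
Proof.
move=> cz.
have E : {in image c, vrep c G =1
    (fun z => row_mx (rsubmx z) 0 + vert (spray_coef c z))}.
  by move=> y; rewrite inE => cy; rewrite vrep_spray// row_mx_vert.
have sr : smooth_on (image c) (@rsubmx R 1 n n) by apply: smooth_on_linear;
  exact: linear_rsub.
have sB := smooth_on_spray_coef c.
rewrite (dd_eq (slit_image_open cA c) _ cz E) (ddD cz (smooth_on_linear_comp
  (slit_image_open cA c) (@linear_row_mxl R n n) sr)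
  (smooth_on_linear_comp (slit_image_open cA c) linear_vert sB)).
rewrite (dd_linear _ (@linear_row_mxl R n n) cz sr) (dd_linear _ linear_vert cz
  sB).
by rewrite (dd_lin _ _ (@linear_rsub R n n)) -row_mx_vert.
Qed.

Let spray_at c z : image c z -> smooth_at (vrep c G) z.
Proof. by move=> cz; exists (image c); [exact: (conj (slit_image_open cA c)
  cz)|exact: smooth_on_vrep]. Qed.

(** The derivative along [G] of the horizontal components of [X] occurs in the bracket of [J_f A X]
    with [G] and in [J] of the bracket of [X] with [G], and cancels. What remains depends only on
    the value of [X] at the point. *)
Lemma vrep_barthel c X z : image c z -> smooth_at (vrep c X) z ->
  vrep c (barthel A G X) z =
  row_mx (lsubmx (vrep c X z))
    (dd (spray_coef c) (vert (lsubmx (vrep c X z))) z - rsubmx (vrep c X z)).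
Proof.
move=> cz sX.
have [U [oU Uz] [Uc sU]] := smooth_on_smooth_atP (slit_image_open cA c) cz sX.
have sl := smooth_on_lsub oU sU.
have EJ : {in U, vrep c (J_f A X) =1 (fun z => vert (lsubmx (vrep c X z)))}.
  by move=> y; rewrite inE => Uy; rewrite vrep_J//; exact: Uc.
have sJ : smooth_at (vrep c (J_f A X)) z.
  exists U; first exact: (conj oU Uz).
  have S := smooth_on_linear_comp oU linear_vert sl.
  by apply: (smooth_on_eq oU _ S) => y Uy; rewrite (EJ y Uy).
rewrite -[barthel A G X]/(fun u => bracket TA (J_f A X) G u - J_f A (bracket TA
  X G) u).
apply: (etrans (vrep_sub (bracket TA (J_f A X) G) (J_f A (bracket TA X G)) cz)).
apply: (etrans (congr2 (fun v v' : 'rV_(n + n) => v - v') (vrep_bracket cz sJ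
  (spray_at cz))
  (etrans (vrep_J (bracket TA X G) cz)
    (congr1 (fun v => vert (lsubmx v)) (vrep_bracket cz sX (spray_at cz)))))).
rewrite !(dd_vrep_spray _ cz) (vrep_J X cz) rsub_vert.
rewrite (dd_eq oU _ Uz EJ) (dd_linear _ linear_vert Uz sl).
rewrite (dd_linear _ (@linear_lsub R n n) Uz sU).
rewrite (linear_subr _ _ (@linear_lsub R n n)) row_mxKl.
exact: row_mx_sub_vert.
Qed.

Lemma vrep_halves c X Y z (k : R) : image c z ->
  vrep c (fun u => k *: (X u + Y u)) z = k *: (vrep c X z + vrep c Y z).
Proof.
move=> /(slit_imageP cA)[u [cu su <- _]]; rewrite !vrepE//.
have lt := tcoord_linear cT (cu : dom (c : chart TA) u).
have l0 : tcoord (c : chart TA) u 0 = 0.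
  by have := linear_subr 0 0 lt; rewrite !subrr.
have := lt k (X u + Y u) 0; rewrite addr0 l0 addr0 => ->.
by have := lt 1 (X u) (Y u); rewrite !scale1r => ->.
Qed.

Lemma vrep_hproj c X z : image c z -> smooth_at (vrep c X) z ->
  vrep c (hproj A G X) z = hor (spray_coef c) (lsubmx (vrep c X z)) z.
Proof.
move=> cz sX; rewrite /hproj vrep_halves// vrep_barthel//.
rewrite -{1}[vrep c X z]hsubmxK add_row_mx scale_row_mx hor.unlock conn.unlock.
congr row_mx; last by rewrite addrC subrK.
exact: half_addxx.
Qed.

Lemma vrep_vproj c X z : image c z -> smooth_at (vrep c X) z ->
  vrep c (vproj A G X) z =
  vert (rsubmx (vrep c X z) - conn (spray_coef c) (lsubmx (vrep c X z)) z).
Proof.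
move=> cz sX.
have -> : vproj A G X = (fun u => X u - hproj A G X u).
  by apply/funext => u; exact: half_sub.
rewrite vrep_sub// vrep_hproj// -{1}[vrep c X z]hsubmxK hor.unlock.
exact: row_mx_subl.
Qed.

Lemma prep_K c X z : image c z -> smooth_at (vrep c X) z ->
  prep c (K A G X) z =
  rsubmx (vrep c X z) - conn (spray_coef c) (lsubmx (vrep c X z)) z.
Proof.
move=> cz sX; set r := (RHS).
have [u [cu su uz _]] := slit_imageP cA cz.
have gw w : gamma A u w = vproj A G X u <-> tcoord c u.1 w = r.
  have E := vrep_vproj cz sX; rewrite -uz vrepE// uz -/r in E.
  rewrite (gammaE cA); split=> [wE|wr].
    have := tangent_tcoord_vert cA w cu; rewrite wE E => /(congr1 rsubmx).
    by rewrite rsub_vert row_mxKr => ->.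
  apply: (tcoord_inj cT (cu : dom (c : chart TA) u)).
  by rewrite E (tangent_tcoord_vert cA)// wr vert.unlock.
rewrite -uz prepE// /K.
(* The set has exactly one element, [gamma] being injective and [vproj] vertical, so the default 0
   of [xget] is never taken. *)
rewrite (xget_unique _ (x := tparam c (coord c u.1) r)).
- by rewrite (tparamK cA).
- by apply/gw; rewrite (tparamK cA).
- by move=> w /gw <-; rewrite (tcoordK cA).
Qed.

(** By [vrep_hproj] every value of [hproj] is a horizontal lift, determined by its projection; the
    set in the choice of [beta] is thus a singleton once some smooth field is shown to realise that
    lift. *)
Lemma vrep_beta c Z z : image c z ->
  vrep c (beta A G Z) z = hor (spray_coef c) (prep c Z z) z.
Proof.
move=> cz; have [u [cu su uz _]] := slit_imageP cA cz.
have cu' : dom (c : chart TA) u := cu.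
set r := (RHS).
have S v : rho A u v = Z u /\ (exists2 Y, smooth_field_at TA Y u & hproj A G Y
  u = v)
    <-> tcoord (c : chart TA) u v = r.
  split.
    move=> [rv [Y sYu Yv]].
    have sY := iffRL (smooth_field_at_vrep Y cu) sYu; rewrite uz in sY.
    have E := vrep_hproj cz sY.
    have El : lsubmx (tcoord (c : chart TA) u v) = prep c Z z.
      rewrite (tangent_tcoord_lsub cA _ cu) -(rhoE cA u) rv -uz.
      by rewrite (prepE Z cu).
    have := @vrepE c (hproj A G Y) u cu; rewrite uz Yv E => Ev.
    by rewrite -Ev lsub_hor in El; rewrite -Ev El.
  move=> vr; split.
    apply: (tcoord_inj cA cu); rewrite (rhoE cA) -(tangent_tcoord_lsub cA)// vr.
    by rewrite lsub_hor -uz prepE.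
  (* The witness has constant components [r] in [c]; since [r] is already horizontal, [hproj] leaves
     it unchanged. *)
  pose Y : @vfield R n M := fun u' => tparam (c : chart TA) (coord (c : chart
    TA) u') r.
  have EY : {in image c, vrep c Y =1 (fun=> r)}.
    move=> y; rewrite inE => /(slit_imageP cA)[u' [cu1 _ <- _]]; rewrite (vrepE
      Y cu1).
    exact: (tparamK cT).
  have sY : smooth_at (vrep c Y) z.
    exists (image c); first exact: (conj (slit_image_open cA c) cz).
    apply: (smooth_on_eq (slit_image_open cA c) _ (@smooth_on_cst _ _ _ (image
      c) r)) => y cy.
    by rewrite EY.
  have sYu : smooth_field_at TA Y u.
    by apply: (iffLR (smooth_field_at_vrep Y cu)); rewrite uz.
  exists Y; first exact: sYu.
  apply: (tcoord_inj cT cu'); rewrite vr.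
  have := vrep_hproj cz sY; rewrite (EY z (mem_set cz)) /r lsub_hor => <-.
  by rewrite -{1}uz (vrepE _ cu).
have cr := tparamK cT r cu'.
rewrite -uz (vrepE _ cu) /beta.
rewrite (xget_unique _ (x := tparam (c : chart TA) (coord (c : chart TA) u) r)).
- by rewrite cr /r -uz.
- by apply/S.
- by move=> v /S <-; rewrite (tcoordK cT).
Qed.

End Connection.
End Operators.

(** * The Berwald connection in a chart *)

(** This splitting reunites the vertical and horizontal halves of [berwald] into one derivative
    along the given field. *)
Lemma vert_hor_decomp (R : realType) (n : nat) (B : 'rV[R]_(n + n) -> 'rV[R]_n)
    (v z : 'rV[R]_(n + n)) :
  vert (rsubmx v - conn B (lsubmx v) z) + hor B (lsubmx v) z = v.
Proof.
by rewrite hor.unlock row_mx_vert addrCA -vertD subrK -row_mx_vert hsubmxK.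
Qed.

Section BerwaldConnection.
Context {R : realType} {n : nat} {M : Type} {A : atlas R n M}.
Hypothesis cA : smooth_charts A.
Local Notation TM := (M * 'rV[R]_n)%type.
Local Notation TA := (tangent_atlas A).
Implicit Types (u : TM) (z v : 'rV[R]_(n + n)) (w : 'rV[R]_n)
  (X Y : @vfield R n M) (Z : @pfield R n M).
Variable G : @vfield R n M.
Hypotheses (sG : smooth_vfield_on A slit G)
  (eG : forall u, slit u -> rho A u (G u) = eta u).

Section Chart.
Variables (c : chart A) (D : set 'rV[R]_(n + n)).
Hypotheses (oD : open D) (Dc : D `<=` slit_image c).

Local Notation B := (spray_coef G c).

Let sB : smooth_on D B.
Proof. exact: smooth_on_sub Dc (smooth_on_spray_coef cA sG c). Qed.

Let smooth_on_atD (W : normedModType R) (f : 'rV[R]_(n + n) -> W) z :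
  smooth_on D f -> D z -> smooth_at f z.
Proof. by move=> sf Dz; exists D; first exact: (conj oD Dz). Qed.

Lemma prep_add Z Z' z : D z ->
  prep c (fun u => Z u + Z' u) z = prep c Z z + prep c Z' z.
Proof.
move=> /Dc /(slit_imageP cA)[u [cu su <- _]].
rewrite (prepE cA _ cu) (prepE cA Z cu) (prepE cA Z' cu).
by have := tcoord_linear cA cu 1 (Z u) (Z' u); rewrite !scale1r.
Qed.

Lemma prep_opp Z z : D z -> prep c (fun u => - Z u) z = - prep c Z z.
Proof.
move=> /Dc /(slit_imageP cA)[u [cu su <- _]].
rewrite (prepE cA _ cu) (prepE cA Z cu).
by have := linear_scal (-1) (Z u) (tcoord_linear cA cu); rewrite !scaleN1r.
Qed.

Lemma smooth_on_vrep_gamma Z :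
  smooth_on D (prep c Z) -> smooth_on D (vrep c (gamma_f A Z)).
Proof.
move=> sZ; apply: (smooth_on_eq oD _ (smooth_on_linear_comp oD linear_vert sZ)).
by move=> z; rewrite inE => /Dc cz; rewrite (vrep_gamma cA _ cz).
Qed.

Lemma smooth_on_vrep_beta Z :
  smooth_on D (prep c Z) -> smooth_on D (vrep c (beta A G Z)).
Proof.
move=> sZ; apply: (smooth_on_eq oD _ (smooth_on_hor_field oD sB sZ)).
by move=> z; rewrite inE => /Dc cz; rewrite (vrep_beta cA sG eG _ cz).
Qed.

Lemma dd_vrep_gamma Z v z : smooth_on D (prep c Z) -> D z ->
  dd (vrep c (gamma_f A Z)) v z = vert (dd (prep c Z) v z).
Proof.
move=> sZ Dz; rewrite -(dd_linear v linear_vert Dz sZ).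
by apply: (dd_eq oD _ Dz) => y; rewrite inE => /Dc cy; exact: (vrep_gamma cA _
  cy).
Qed.

Lemma dd_vrep_beta Z v z : smooth_on D (prep c Z) -> D z ->
  dd (vrep c (beta A G Z)) v z =
  hor B (dd (prep c Z) v z) z + vert (dd (conn B (prep c Z z)) v z).
Proof.
move=> sZ Dz; rewrite -(dd_hor_field oD sB v Dz sZ).
by apply: (dd_eq oD _ Dz) => y; rewrite inE => /Dc cy; exact: (vrep_beta cA sG
  eG _ cy).
Qed.

Lemma vrep_bracket_on X Y z : smooth_on D (vrep c X) -> smooth_on D (vrep c Y)
  ->
  D z -> vrep c (bracket TA X Y) z =
    dd (vrep c Y) (vrep c X z) z - dd (vrep c X) (vrep c Y z) z.
Proof.
move=> sX sY Dz.
exact: (vrep_bracket cA (Dc Dz) (smooth_on_atD sX Dz) (smooth_on_atD sY Dz)).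
Qed.

Lemma smooth_on_vrep_bracket X Y :
  smooth_on D (vrep c X) -> smooth_on D (vrep c Y) ->
  smooth_on D (vrep c (bracket TA X Y)).
Proof.
move=> sX sY.
have S := smooth_on_sub_fun oD (smooth_on_dd_field oD sY sX)
  (smooth_on_dd_field oD sX sY).
apply: (smooth_on_eq oD _ S) => z; rewrite inE => Dz.
by apply/esym; exact: vrep_bracket_on.
Qed.

Section Berwald.
Variables (X : @vfield R n M) (Z : @pfield R n M).
Hypotheses (sX : smooth_on D (vrep c X)) (sZ : smooth_on D (prep c Z)).

Let a z := lsubmx (vrep c X z).
Let sa : smooth_on D a. Proof. exact: smooth_on_lsub. Qed.

Let prepK z : D z -> prep c (K A G X) z = rsubmx (vrep c X z) - conn B (a z) z.
Proof. by move=> Dz; exact: (prep_K cA sG eG (Dc Dz) (smooth_on_atD sX Dz)).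
  Qed.

Let sK : smooth_on D (prep c (K A G X)).
Proof.
have S := smooth_on_sub_fun oD (smooth_on_rsub oD sX) (smooth_on_conn_field oD
  sB sa).
by apply: (smooth_on_eq oD _ S) => z; rewrite inE => Dz; rewrite prepK.
Qed.

Let prep_rhoX : {in D, a =1 prep c (rho_f A X)}.
Proof. by move=> z; rewrite inE => /Dc cz; rewrite (prep_rho cA _ cz). Qed.

Let srho : smooth_on D (prep c (rho_f A X)).
Proof. exact: (smooth_on_eq oD prep_rhoX sa). Qed.

Let part1 z : D z ->
  prep c (rho_f A (bracket TA (gamma_f A (K A G X)) (beta A G Z))) z =
  dd (prep c Z) (vert (prep c (K A G X) z)) z.
Proof.
move=> Dz; rewrite (prep_rho cA _ (Dc Dz)).
have E := vrep_bracket_on (smooth_on_vrep_gamma sK) (smooth_on_vrep_beta sZ) Dz.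
apply: (etrans (congr1 lsubmx E)).
rewrite (linear_subr _ _ (@linear_lsub R n n)) (dd_vrep_gamma _ sK Dz)
  lsub_vert subr0.
rewrite (dd_vrep_beta _ sZ Dz) (vrep_gamma cA _ (Dc Dz)).
by rewrite hor.unlock vert.unlock add_row_mx addr0 row_mxKl.
Qed.

Let part2 z : D z ->
  prep c (K A G (bracket TA (beta A G (rho_f A X)) (gamma_f A Z))) z =
  dd (prep c Z) (hor B (a z) z) z - dd (conn B (a z)) (vert (prep c Z z)) z.
Proof.
move=> Dz.
have sb := smooth_on_vrep_beta srho; have sg := smooth_on_vrep_gamma sZ.
have E := vrep_bracket_on sb sg Dz.
apply: (etrans (prep_K cA sG eG (Dc Dz) (smooth_on_atD (smooth_on_vrep_bracket
  sb sg) Dz))).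
rewrite E (dd_vrep_gamma _ sZ Dz) (dd_vrep_beta _ srho Dz).
rewrite (vrep_gamma cA _ (Dc Dz)) (vrep_beta cA sG eG _ (Dc Dz)).
rewrite !(linear_subr _ _ (@linear_lsub R n n)) !(linear_subr _ _ (@linear_rsub
  R n n)).
rewrite -(prep_rhoX (mem_set Dz)) lsub_vert rsub_vert sub0r.
(* The derivative of the components of [rho_f A X] enters only through its horizontal lift, which
   [K] annihilates; this is the tensoriality of the connection in [X]. *)
set da := dd (prep c (rho_f A X)) _ _.
have -> : lsubmx (hor B da z + vert (dd (conn B (a z)) (vert (prep c Z z)) z))
  = da.
  by rewrite hor.unlock vert.unlock add_row_mx addr0 row_mxKl.
have -> : rsubmx (hor B da z + vert (dd (conn B (a z)) (vert (prep c Z z)) z)) =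
    conn B da z + dd (conn B (a z)) (vert (prep c Z z)) z.
  by rewrite hor.unlock vert.unlock add_row_mx row_mxKr.
have -> : conn B (- da) z = - conn B da z.
  by rewrite -scaleN1r (connZ sB _ _ Dz) scaleN1r.
by rewrite opprK opprD addrA addrAC subrK.
Qed.

(** The vertical half of [berwald] is a plain derivative and the horizontal half carries the
    connection term, so the Christoffel symbols act on the projection of [X] alone. *)
Lemma prep_berwald z : D z ->
  prep c (berwald A G X Z) z =
  dd (prep c Z) (vrep c X z) z - dd (conn B (a z)) (vert (prep c Z z)) z.
Proof.
move=> Dz.
have E := prep_add (rho_f A (bracket TA (gamma_f A (K A G X)) (beta A G Z)))
  (K A G (bracket TA (beta A G (rho_f A X)) (gamma_f A Z))) Dz.
apply: (etrans E); apply: (etrans (congr2 +%R (part1 Dz) (part2 Dz))).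
rewrite addrA -(dd_dirD Dz sZ) (prepK Dz).
by rewrite (vert_hor_decomp B (vrep c X z) z).
Qed.

Lemma smooth_on_prep_berwald : smooth_on D (prep c (berwald A G X Z)).
Proof.
have S := smooth_on_sub_fun oD (smooth_on_dd_field oD sZ sX)
  (smooth_on_dd_conn_field oD sB sa sZ).
apply: (smooth_on_eq oD _ S) => z; rewrite inE => Dz.
by apply/esym; exact: prep_berwald.
Qed.

End Berwald.

Section Curvature.
Variables X Y Z : @pfield R n M.
Hypotheses (sX : smooth_on D (prep c X)) (sY : smooth_on D (prep c Y))
  (sZ : smooth_on D (prep c Z)).

Let berwald_beta (X' Z' : @pfield R n M) z : smooth_on D (prep c X') ->
  smooth_on D (prep c Z') ->
  D z -> prep c (berwald A G (beta A G X') Z') z =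
    dd (prep c Z') (hor B (prep c X' z) z) z -
    dd (conn B (prep c X' z)) (vert (prep c Z' z)) z.
Proof.
move=> sX' sZ' Dz; rewrite (prep_berwald (smooth_on_vrep_beta sX') sZ' Dz).
by rewrite (vrep_beta cA sG eG _ (Dc Dz)) lsub_hor.
Qed.

(** The groups are, in order: the derivative of the plain part of the inner covariant derivative,
    the derivative of its Christoffel part, and the outer Christoffel term applied to the inner
    derivative. *)
Let second (X' Y' : @pfield R n M) z : smooth_on D (prep c X') -> smooth_on D
  (prep c Y') -> D z ->
  prep c (berwald A G (beta A G X') (berwald A G (beta A G Y') Z)) z =
  (dd (prep c Z) (dd (fun y => hor B (prep c Y' y) y) (hor B (prep c X' z) z)
    z) z +
   dd (dd (prep c Z) (hor B (prep c Y' z) z)) (hor B (prep c X' z) z) z) -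
  (dd (conn B (dd (prep c Y') (hor B (prep c X' z) z) z)) (vert (prep c Z z)) z
    +
   (dd (conn B (prep c Y' z)) (vert (dd (prep c Z) (hor B (prep c X' z) z) z))
     z +
    dd (dd (conn B (prep c Y' z)) (vert (prep c Z z))) (hor B (prep c X' z) z)
      z)) -
  (dd (conn B (prep c X' z)) (vert (dd (prep c Z) (hor B (prep c Y' z) z) z)) z
    -
   dd (conn B (prep c X' z)) (vert (dd (conn B (prep c Y' z)) (vert (prep c Z
     z)) z)) z).
Proof.
move=> sX' sY' Dz.
have sW := smooth_on_prep_berwald (smooth_on_vrep_beta sY') sZ.
rewrite (berwald_beta sX' sW Dz) (berwald_beta sY' sZ Dz).
have sh := smooth_on_hor_field oD sB sY'.
have E : {in D, prep c (berwald A G (beta A G Y') Z) =1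
    (fun z => dd (prep c Z) (hor B (prep c Y' z) z) z -
       dd (conn B (prep c Y' z)) (vert (prep c Z z)) z)}.
  by move=> y; rewrite inE => Dy; exact: berwald_beta.
rewrite (dd_eq oD _ Dz E).
rewrite (ddB Dz (smooth_on_dd_field oD sZ sh) (smooth_on_dd_conn_field oD sB
  sY' sZ)).
rewrite (dd_field oD Dz sZ _ sh) (dd_dd_conn_field oD sB sY' sZ _ Dz).
congr (_ - _).
by rewrite (linear_subr _ _ linear_vert) (dd_dirB Dz (smooth_on_conn oD sB _)).
Qed.

(** Derivatives of the components of [X] and [Y] are compensated by the covariant derivative along
    their bracket, second derivatives of [Z] by symmetry, and the first derivatives of [Z] paired
    with a Christoffel symbol by antisymmetry. The remainder is the expression expanded in
    [dd_hcurv_vert]. *)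
Lemma prep_h_curvature z : D z ->
  prep c (h_curvature A G X Y Z) z =
  dd (hcurv B (prep c X z) (prep c Y z)) (vert (prep c Z z)) z.
Proof.
move=> Dz.
have sbX := smooth_on_vrep_beta sX; have sbY := smooth_on_vrep_beta sY.
have E1 := prep_add (fun u => - berwald A G (beta A G X) (berwald A G (beta A G
  Y) Z) u
    + berwald A G (beta A G Y) (berwald A G (beta A G X) Z) u)
  (berwald A G (bracket TA (beta A G X) (beta A G Y)) Z) Dz.
have E2 := prep_add (fun u => - berwald A G (beta A G X) (berwald A G (beta A G
  Y) Z) u)
    (berwald A G (beta A G Y) (berwald A G (beta A G X) Z)) Dz.
have E3 := prep_opp (berwald A G (beta A G X) (berwald A G (beta A G Y) Z)) Dz.
have E4 := prep_berwald (smooth_on_vrep_bracket sbX sbY) sZ Dz.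
have E5 := vrep_bracket_on sbX sbY Dz.
rewrite E5 in E4.
apply: (etrans E1); apply: (etrans (congr2 +%R (etrans E2 (congr2 +%R
  (etrans E3 (congr1 -%R (second sX sY Dz))) (second sY sX Dz))) E4)).
move=> {E1 E2 E3 E4 E5}.
rewrite (vrep_beta cA sG eG X (Dc Dz)) (vrep_beta cA sG eG Y (Dc Dz)).
rewrite (dd_hcurv_vert oD sB _ _ _ Dz).
have Eb T v : smooth_on D (prep c T) -> dd (vrep c (beta A G T)) v z =
    dd (fun y => hor B (prep c T y) y) v z.
  by move=> sT; rewrite (dd_vrep_beta _ sT Dz) (dd_hor_field oD sB _ Dz sT).
rewrite (Eb _ _ sX) (Eb _ _ sY) (linear_subr _ _ (@linear_lsub R n n)).
have El T v : smooth_on D (prep c T) ->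
    lsubmx (dd (fun y => hor B (prep c T y) y) v z) = dd (prep c T) v z.
  move=> sT; rewrite (dd_hor_field oD sB _ Dz sT).
  by rewrite hor.unlock vert.unlock add_row_mx addr0 row_mxKl.
rewrite (El _ _ sX) (El _ _ sY) (dd_dirB Dz sZ).
rewrite (linear_subr _ _ (linear_dd_conn oD sB _ Dz)).
rewrite (dd_comm (hor B (prep c X z) z) (hor B (prep c Y z) z) oD Dz sZ).
by apply/rowP => i; rewrite !mxE; ring.
Qed.

End Curvature.
End Chart.
End BerwaldConnection.

(** * The projective tensors in a chart *)

Section LinearTrace.
Context {R : realType} {n : nat}.
Implicit Types (f g : 'rV[R]_n -> 'rV[R]_n).

Definition rV_mx f : 'M[R]_n := \matrix_i f (delta_mx 0 i).

Lemma mul_rV_mx f v : linear f -> v *m rV_mx f = f v.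
Proof.
move=> lf; pose fl := GRing.isLinear.Build _ _ _ _ _ lf.
pose F : {linear _ -> _} := HB.pack f fl.
rewrite {2}[v]row_sum_delta -[RHS]/(F _) linear_sum mulmx_sum_row.
by apply: eq_bigr => i _; rewrite linearZ rowK.
Qed.

(** Invariance of the trace under conjugation, by cyclicity: in the row-vector convention
    [cancel s t] says that the matrix of [s] times that of [t] is the identity. It lets [ptrace],
    taken in the preferred chart, be computed in any chart. *)
Lemma linear_trace_conj (F s t : 'rV[R]_n -> 'rV[R]_n) :
  linear F -> linear s -> linear t -> cancel s t ->
  \sum_i s (F (t (delta_mx 0 i))) 0 i = \sum_i F (delta_mx 0 i) 0 i.
Proof.
move=> lF ls lt st.
have E : rV_mx s *m rV_mx t = 1%:M.
  apply/row_matrixP => i; rewrite rowE mulmxA !mul_rV_mx// st.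
  by rewrite row1.
transitivity (\tr (rV_mx t *m (rV_mx F *m rV_mx s))).
  apply: eq_bigr => i _; rewrite -(mul_rV_mx _ ls) -(mul_rV_mx _ lF)
    -(mul_rV_mx _ lt).
  by rewrite -!mulmxA -rowE mxE.
rewrite mxtrace_mulC -mulmxA E mulmx1.
by apply: eq_bigr => i _; rewrite mxE.
Qed.

End LinearTrace.

Section TensorFields.
Context {R : realType} {n : nat} {M : Type} {A : atlas R n M}.
Hypothesis cA : smooth_charts A.
Local Notation TM := (M * 'rV[R]_n)%type.
Local Notation TA := (tangent_atlas A).
Implicit Types (u : TM) (z v : 'rV[R]_(n + n)) (w : 'rV[R]_n)
  (c : chart A) (X Y Z : @pfield R n M).

Lemma pextend_at u w : pextend A u w u = w.
Proof.
rewrite /pextend; apply: (etrans (tparamE cA w (charts_at cA u.1))).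
exact: (transition_self cA w (charts_at cA u.1)).
Qed.

(** [pextend A u w] is controlled only where [c] meets the preferred chart of [u.1]. For this reason
    the formulas for the Berwald connection are established on an arbitrary open part of the slit
    image. *)
Definition overlap_image c u : set 'rV[R]_(n + n) :=
  slit_image c `&` lsubmx @^-1` (overlap c (chart_at A u.1)).

Lemma overlap_image_open c u : open (overlap_image c u).
Proof.
apply: open_setI_preimage; first exact: slit_image_open.
  exact: overlap_open.
by move=> z _; exact: continuous_lsubmx.
Qed.

Lemma smooth_on_prep_pextend c u w :
  smooth_on (overlap_image c u) (prep c (pextend A u w)).
Proof.
set d := chart_at A u.1; have oD := @overlap_image_open c u.
pose g z := (coord d \o param c) (lsubmx z : 'rV_n).
have sg : smooth_on (overlap_image c u) g.
  have DO z : overlap_image c u z -> overlap c d (lsubmx z) by case.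
  apply: (smooth_on_comp oD DO (charts_smooth cA c d)).
  by apply: smooth_on_linear; exact: linear_lsub.
have gD z : overlap_image c u z -> overlap d c (g z).
  by case=> _ [p [cp dp] pz]; rewrite /g -pz /= (charts_K cA cp); exact:
    overlapP.
have sw := @smooth_on_cst R 'rV[R]_(n + n) 'rV[R]_n (overlap_image c u) w.
have S := smooth_on_derive_along oD gD (charts_smooth cA d c) sg sw.
apply: (smooth_on_eq oD _ S) => z; rewrite inE => -[cz Oz].
have [u' [cu su uz _]] := slit_imageP cA cz.
have du : dom d u'.1.
  case: Oz => p [cp dp]; rewrite -uz tangent_coord_lsub => E.
  by rewrite -(charts_K cA cu) -E (charts_K cA cp).
rewrite -uz (prepE cA _ cu) /pextend -/d (tcoord_change cA _ du cu).
rewrite (tparamK cA _ du) /g tangent_coord_lsub /=.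
by rewrite (charts_K cA cu).
Qed.

Variable G : @vfield R n M.
Hypotheses (sG : smooth_vfield_on A slit G)
  (eG : forall u, slit u -> rho A u (G u) = eta u).

Section Chart.
Variable c : chart A.
Local Notation D := (slit_image c).
Local Notation B := (spray_coef G c).

Let oD : open D := slit_image_open cA c.
Let sB : smooth_on D B := smooth_on_spray_coef cA sG c.

(** By [prep_h_curvature] the curvature depends only on the values of its arguments at the point, so
    the extension of the basis vectors is immaterial; the two bases, of the preferred chart and of
    [c], are related by a conjugation. *)
Lemma R2_local X Y u : dom c u.1 -> slit u ->
  smooth_on D (prep c X) -> smooth_on D (prep c Y) ->
  let z := coord (c : chart TA) u in
  R2 A G X Y u = dd (htrace B (prep c X z)) (vert (prep c Y z)) z.
Proof.
move=> cu su sX sY z; have Dz : D z by exact: slit_image_coord.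
rewrite (dd_htrace oD sB _ _ Dz) /R2 /ptrace.
pose F w := dd (hcurv B (prep c X z) w) (vert (prep c Y z)) z.
have lF : linear F.
  move=> k a b; rewrite /F.
  have s1 := smooth_on_hcurv oD sB (prep c X z) a.
  have s2 := smooth_on_hcurv oD sB (prep c X z) b.
  rewrite -(ddZ Dz s1) -(ddD Dz (smooth_on_scale_cst k oD s1) s2).
  apply: (dd_eq oD _ Dz) => y; rewrite inE => Dy.
  exact: (linear_hcurvr oD sB (prep c X z) Dy k a b).
have lt := tcoord_linear cA cu; have ls := tparam_linear cA cu.
rewrite -(linear_trace_conj lF ls lt (fun w => tparamK cA w cu)).
apply: eq_bigr => i _; set e := delta_mx 0 i.
have OD : overlap_image c u `<=` D by move=> y [].
have Oz : overlap_image c u z.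
  split; first exact: Dz.
  by rewrite /= row_mxKl; exact: overlapP cu (charts_at cA _).
have := prep_h_curvature cA sG eG (@overlap_image_open c u) OD
  (smooth_on_sub OD sX) (@smooth_on_prep_pextend c u e) (smooth_on_sub OD sY)
    Oz.
rewrite (prepE cA (h_curvature A G X (pextend A u e) Y) cu).
rewrite (prepE cA (pextend A u e) cu) pextend_at => E.
by rewrite /F -E (tcoordK cA _ cu).
Qed.

Hypothesis eB : forall z, D z -> dd B (vert (rsubmx z)) z = 2 *: B z.

Let seta : smooth_on D (prep c (@eta R n M)).
Proof.
apply: (@smooth_on_eq _ _ _ _ (@rsubmx R 1 n n)) => //.
  by move=> z; rewrite inE => Dz; rewrite (prep_eta cA Dz).
by apply: smooth_on_linear; exact: linear_rsub.
Qed.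

Lemma kscal_local u : dom c u.1 -> slit u ->
  kscal A G u = kscal_loc B (coord (c : chart TA) u).
Proof.
move=> cu su; rewrite /kscal (R2_local cu su seta seta).
by rewrite (prep_eta cA (slit_image_coord cA cu su)).
Qed.

Lemma R1_local X u : dom c u.1 -> slit u -> smooth_on D (prep c X) ->
  R1 A G X u = R1_loc B (prep c X (coord (c : chart TA) u)) (coord (c : chart
    TA) u).
Proof.
move=> cu su sX; rewrite /R1 (R2_local cu su sX seta) (R2_local cu su seta sX).
by rewrite (prep_eta cA (slit_image_coord cA cu su)).
Qed.

Hypothesis n_gt1 : (1 < n)%N.

Let n1 : n%:R - 1 != 0 :> R.
Proof. by rewrite subr_eq0 pnatr_eq1 gtn_eqF. Qed.

Let linear_R1_loc z : D z -> linear (fun a => R1_loc B a z : R^o).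
Proof.
move=> Dz k a b; rewrite !(R1_locE oD sB eB _ n1 Dz).
have sk := smooth_on_kscal_loc oD sB eB.
have /(_ k a b) /= -> := linear_htrace oD sB Dz.
rewrite linear_vert (dd_dirD Dz sk) (dd_dirZ Dz sk) /GRing.scale/=.
by ring.
Qed.

Let sR1 a : smooth_on D (R1_loc B a).
Proof. exact: smooth_on_R1_loc. Qed.

(* The preferred chart at [u] identifies fibre components with vectors. *)
Variable u : TM.
Hypotheses (su : slit u) (cE : c = chart_at A u.1).

Let cu : dom c u.1.
Proof. by rewrite cE; exact: charts_at. Qed.

Local Notation z := (coord (c : chart TA) u).

Let Dz : D z. Proof. exact: slit_image_coord. Qed.

Let prep_at X : prep c X z = X u.
Proof. by rewrite (prepE cA _ cu) cE (tcoord_chart_at cA). Qed.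

Let rsub_at : rsubmx z = eta u.
Proof. by rewrite -(prep_eta cA Dz) prep_at. Qed.

Lemma lie_der_gamma_local (f : TM -> R) (F : 'rV[R]_(n + n) -> R) X :
  (forall u', dom c u'.1 -> slit u' -> f u' = F (coord (c : chart TA) u')) ->
  lie_der TA (gamma_f A X) f u = dd F (vert (X u)) z.
Proof.
move=> fF.
have E : {in D, f \o param (c : chart TA) =1 F}.
  move=> y; rewrite inE => Dy; have [u' [cu' su' uy py]] := slit_imageP cA Dy.
  by rewrite /= -[in RHS]uy -(fF u' cu' su'); congr f.
rewrite -(dd_eq oD _ Dz E) -ddE /lie_der /dmap /gamma_f (gammaE cA) vert.unlock.
by rewrite /coord_at /= -cE.
Qed.

Lemma W1_local X : smooth_on D (prep c X) -> W1 A G X u = W1_loc B (X u) z.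
Proof.
move=> sX; rewrite /W1 /W1_loc.
have h : deviation A G X u = dd (hcurv B (rsubmx z) (X u)) (vert (rsubmx z)) z.
  rewrite -(prep_at (deviation A G X)) rsub_at.
  rewrite (prep_h_curvature cA sG eG oD (fun _ h => h) seta sX seta Dz).
  by rewrite !prep_at.
rewrite h (kscal_local cu su) (R1_local cu su sX) prep_at -rsub_at.
by rewrite (lie_der_gamma_local X kscal_local).
Qed.

(** Along a vertical field the Christoffel term vanishes, so the covariant derivative of [Y] is the
    plain derivative of its components. Subtracting [R1] of it cancels the part of the Leibniz rule
    that differentiates [Y], leaving [Y u] frozen. *)
Lemma berwald_form_R1_local X Y : smooth_on D (prep c X) -> smooth_on D (prep c
  Y) ->
  berwald_form A G (gamma_f A X) (R1 A G) Y u = dd (R1_loc B (Y u)) (vert (X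
    u)) z.
Proof.
move=> sX sY; rewrite /berwald_form.
have sgX := smooth_on_vrep_gamma cA oD (fun _ h => h) sX.
have sb := smooth_on_prep_berwald cA sG eG oD (fun _ h => h) sgX sY.
rewrite (R1_local cu su sb).
rewrite (prep_berwald cA sG eG oD (fun _ h => h) sgX sY Dz).
rewrite (vrep_gamma cA _ Dz) lsub_vert.
have -> : dd (conn B 0) (vert (prep c Y z)) z = 0.
  by have := linear_subr 0 0 (linear_dd_conn oD sB (vert (prep c Y z)) Dz);
    rewrite !subrr.
rewrite subr0.
rewrite (@lie_der_gamma_local (R1 A G Y) (fun z => R1_loc B (prep c Y z) z));
  last first.
  by move=> u' cu' su'; exact: R1_local.
rewrite (dd_family oD _ linear_R1_loc sR1 Dz sY) !prep_at.
by rewrite addrAC subrr add0r.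
Qed.

Lemma W2_local X Y : smooth_on D (prep c X) -> smooth_on D (prep c Y) ->
  W2 A G X Y u = W2_loc B (X u) (Y u) z.
Proof.
move=> sX sY; rewrite /W2 /W2_loc /antisym.
have h : h_torsion A G X Y u = dd (hcurv B (X u) (Y u)) (vert (rsubmx z)) z.
  rewrite -(prep_at (h_torsion A G X Y)) rsub_at.
  rewrite (prep_h_curvature cA sG eG oD (fun _ h => h) sX sY seta Dz).
  by rewrite !prep_at.
rewrite h (R1_local cu su sX) (R1_local cu su sY) !prep_at -rsub_at.
pose W p q := dd (hcurv B (X u) (Y u)) (vert (rsubmx z)) z + (n%:R + 1)^-1 *:
  ((R1_loc B (Y u) z *: X u + p *: rsubmx z) -
   (R1_loc B (X u) z *: Y u + q *: rsubmx z)).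
exact: (congr2 W (berwald_form_R1_local sX sY) (berwald_form_R1_local sY sX)).
Qed.

End Chart.
End TensorFields.

(** * Canonical sprays are homogeneous *)

Lemma linear_rsub_0 (R : realType) (n : nat) :
  rsubmx (0 : 'rV[R]_(n + n)) = 0.
Proof. by rewrite linear0. Qed.

Section FibreScaling.
Context {R : realType} {n : nat}.
Local Notation V := 'rV[R]_(n + n).
Implicit Types (z v : V) (a b : 'rV[R]_n).

Definition fscale (t : R) z : V := row_mx (lsubmx z) (t *: rsubmx z).

Lemma fscale_line (t : R) z : fscale (1 + t) z = z + t *: vert (rsubmx z).
Proof.
rewrite /fscale -{3}[z]hsubmxK -vertZ vert.unlock add_row_mx addr0.
by rewrite scalerDl scale1r.
Qed.

Lemma linear_fscale t : linear (fscale t).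
Proof.
move=> k v w; rewrite /fscale (@linear_lsub R n n) (@linear_rsub R n n).
rewrite scale_row_mx add_row_mx; congr row_mx.
by rewrite scalerDr !scalerA mulrC.
Qed.

Lemma lsub_fscale t z : lsubmx (fscale t z) = lsubmx z.
Proof. by rewrite row_mxKl. Qed.

Lemma rsub_fscale t z : rsubmx (fscale t z) = t *: rsubmx z.
Proof. by rewrite row_mxKr. Qed.

Lemma fscaleK (t : R) : t != 0 -> cancel (fscale t^-1) (fscale t).
Proof.
move=> t0 z; rewrite /fscale row_mxKl row_mxKr scalerA mulfV// scale1r.
exact: hsubmxK.
Qed.

Lemma fscale_vert t b : fscale t (vert b) = t *: vert b.
Proof.
by rewrite /fscale lsub_vert rsub_vert -vertZ vert.unlock.
Qed.

Lemma derive_expDn (W : normedModType R) (w : W) (k : nat) :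
  'D_1 (fun t : R => (1 + t) ^+ k.+1 *: w) 0 = k.+1%:R *: w.
Proof.
have d1 : differentiable (fun t : R => 1 + t : R) 0 by exact: differentiableD.
have D1 : 'D_1 (fun t : R => 1 + t : R) 0 = 1.
  have did : differentiable (id : R -> R) 0 by [].
  have := @derive_addf R R R (cst 1) id 0 1 (differentiable_cst _ _) did.
  by rewrite derive_cst derive_id add0r.
have dX : differentiable ((fun t : R => 1 + t : R) ^+ k.+1) 0 by exact:
  differentiableX.
have EX : 'D_1 ((fun t : R => 1 + t : R) ^+ k.+1) 0 = k.+1%:R.
  by rewrite deriveX ?D1 ?addr0 ?expr1n ?mulr1 ?/GRing.scale/= ?mulr1//; exact:
    diff_derivable.
have fX : (fun t : R => (1 + t) ^+ k.+1) = (fun t : R => 1 + t : R) ^+ k.+1.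
  by apply/funext => t; rewrite exprfctE.
rewrite -fX in dX EX.
by rewrite (derive_mulf (1 : R) dX (differentiable_cst w 0)) derive_cst scaler0
  addr0 EX.
Qed.

(** Scaling the fibre by 1 + t moves [z] along the straight line with direction [vert (rsubmx z)],
    so the derivative in that direction is the derivative of a power at t = 0. The degree is written
    [k.+1] and thus starts at 1. *)
Lemma euler_of_homogeneous (W : normedModType R) (D : set V) (f : V -> W) (k :
  nat) z :
  smooth_on D f -> D z ->
  (forall t, 0 < t -> f (fscale t z) = t ^+ k.+1 *: f z) ->
  dd f (vert (rsubmx z)) z = k.+1%:R *: f z.
Proof.
move=> sf Dz hf; rewrite -ddE (derive_on_line _ (smooth_on_differentiable sf
  Dz)).
rewrite -derive_expDn; apply: near_eq_derive.
near=> t; rewrite -fscale_line; apply: hf.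
(* Homogeneity concerns positive factors, and 1 + t is positive for small t. *)
have : `|t| < 1.
  near: t; apply/nbhs_ballP; exists 1 => //= y.
  by rewrite -ball_normE/= sub0r normrN.
by rewrite ltr_norml => /andP[t1 _]; rewrite -ltrBlDl sub0r.
Unshelve. all: by end_near. Qed.

Lemma dd_fscale (W : normedModType R) (D : set V) (f : V -> W) t v z :
  smooth_on D f -> D (fscale t z) ->
  dd f (fscale t v) (fscale t z) = dd (fun y => f (fscale t y)) v z.
Proof.
move=> sf Dt; have lt := linear_fscale t.
have := derive_comp v (differentiable_linear z lt) (smooth_on_differentiable sf
  Dt).
by rewrite (derive_linear _ _ lt) -!ddE.
Qed.

End FibreScaling.

(** * The spray equation in a chart *)

Section LocalFinsler.
Context {R : realType} {n : nat}.
Local Notation V := 'rV[R]_(n + n).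
Implicit Types (z v : V) (a b : 'rV[R]_n).

(** Coordinate form of dd_J F: the form d_J F sends [v'] to the derivative of [F] along
    [vert (lsubmx v')], and its exterior derivative is evaluated on constant fields. *)
Definition hessian_form (F : V -> R) z v v' : R :=
  dd (dd F (vert (lsubmx v'))) v z - dd (dd F (vert (lsubmx v))) v' z.

Variables (D : set V) (F : V -> R).
Hypotheses (oD : open D) (sF : smooth_on D F)
  (D_fscale : forall t z, 0 < t -> D z -> D (fscale t z))
  (hF : forall t z, 0 < t -> D z -> F (fscale t z) = t ^+ 2 * F z).

Let linear_ddF v z : D z -> linear (fun a => dd (dd F (vert a)) v z : R^o).
Proof.
move=> Dz k a b; have s1 := smooth_on_dd (vert a) sF; have s2 := smooth_on_dd
  (vert b) sF.
rewrite -(ddZ Dz s1) -(ddD Dz (smooth_on_scale_cst k oD s1) s2).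
apply: (dd_eq oD _ Dz) => y; rewrite inE => Dy.
by rewrite linear_vert (dd_dirD Dy sF) (dd_dirZ Dy sF).
Qed.

Let ddF0 v z : D z -> dd (dd F (vert 0)) v z = 0.
Proof.
by move=> Dz; have := linear_subr 0 0 (linear_ddF v Dz); rewrite !subrr.
Qed.

Lemma hessian_form_sub z v1 v2 v' : D z ->
  hessian_form F z (v1 - v2) v' = hessian_form F z v1 v' - hessian_form F z v2
    v'.
Proof.
move=> Dz; rewrite /hessian_form (dd_dirB Dz (smooth_on_dd _ sF)).
rewrite (linear_subr _ _ (@linear_lsub R n n)).
have -> := linear_subr (lsubmx v1) (lsubmx v2) (linear_ddF v' Dz).
by ring.
Qed.

Lemma hessian_form_scale z k v v' : D z ->
  hessian_form F z (k *: v) v' = k * hessian_form F z v v'.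
Proof.
move=> Dz; rewrite /hessian_form (dd_dirZ Dz (smooth_on_dd _ sF)).
have l0 := linear_subr 0 0 (@linear_lsub R n n); rewrite !subrr in l0.
have := @linear_lsub R n n k v 0; rewrite addr0 l0 addr0 => ->.
have := linear_ddF v' Dz k (lsubmx v) 0; rewrite addr0 (ddF0 _ Dz) addr0 => ->.
by rewrite /GRing.scale/= mulrBr.
Qed.

Let commR (f : V -> R) z v v' : smooth_on D f -> D z ->
  dd (dd f v') v z = dd (dd f v) v' z.
Proof. by move=> sf Dz; exact: dd_comm_scalar oD Dz sf. Qed.

Let eF z : D z -> dd F (vert (rsubmx z)) z = 2 *: (F z : R^o).
Proof.
move=> Dz; apply: (@euler_of_homogeneous R n R D F 1 z sF Dz) => t t0.
by rewrite hF.
Qed.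

(** Tested on a vertical [vert b], the spray equation says that the vertical Hessian of [F] pairs
    [lsubmx g] with [b] to the derivative of [F] along [vert b]; the Euler identity in degree 2 says
    the same of [rsubmx z]. Their difference [a] is in the kernel of this Hessian, so [vert a] is in
    the kernel of the full form. *)
Lemma spray_second_order z g : D z ->
  (forall v, hessian_form F z g v = - dd F v z) ->
  (forall v, (forall v', hessian_form F z v v' = 0) -> v = 0) ->
  lsubmx g = rsubmx z.
Proof.
move=> Dz Hg nd; apply/eqP; rewrite -subr_eq0; apply/eqP.
set a := _ - _.
have Ha b : dd (dd F (vert a)) (vert b) z = 0.
  have /(_ (lsubmx g) (rsubmx z)) := linear_subr _ _ (linear_ddF (vert b) Dz).
  rewrite -/a => ->; have := Hg (vert b).
  rewrite /hessian_form lsub_vert (ddF0 _ Dz) sub0r => /oppr_inj ->.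
  rewrite (commR _ _ sF Dz) (euler_dd_vert oD commR sF eF _ Dz).
  by rewrite (_ : 2 - 1 = 1 :> R) ?scale1r ?subrr//; ring.
have /nd : forall v', hessian_form F z (vert a) v' = 0.
  move=> v'; rewrite /hessian_form lsub_vert (ddF0 _ Dz) subr0.
  by rewrite (commR _ _ sF Dz) Ha.
by move=> /(congr1 rsubmx); rewrite rsub_vert => ->; rewrite (@linear_rsub_0 R
  n).
Qed.

Let ddF_fscale t v z : 0 < t -> D z ->
  dd F (fscale t v) (fscale t z) = t ^+ 2 * dd F v z.
Proof.
move=> t0 Dz; rewrite (dd_fscale _ sF (D_fscale t0 Dz)).
have E : {in D, (fun y => F (fscale t y)) =1 (fun y => t ^+ 2 *: (F y : R^o))}.
  by move=> y; rewrite inE => Dy; rewrite hF.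
by rewrite (dd_eq oD _ Dz E) (ddZ Dz sF).
Qed.

Let ddF_vert_fscale t b z : 0 < t -> D z ->
  dd F (vert b) (fscale t z) = t * dd F (vert b) z.
Proof.
move=> t0 Dz; have := ddF_fscale (vert b) t0 Dz; rewrite fscale_vert.
rewrite (dd_dirZ (D_fscale t0 Dz) sF) /GRing.scale/= expr2 -mulrA.
exact: mulfI (lt0r_neq0 t0) _ _.
Qed.

Let ddddF_fscale t b v z : 0 < t -> D z ->
  dd (dd F (vert b)) (fscale t v) (fscale t z) = t * dd (dd F (vert b)) v z.
Proof.
move=> t0 Dz; have sb := smooth_on_dd (vert b) sF.
rewrite (dd_fscale _ sb (D_fscale t0 Dz)).
have E : {in D, (fun y => dd F (vert b) (fscale t y)) =1
    (fun y => t *: (dd F (vert b) y : R^o))}.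
  by move=> y; rewrite inE => Dy; exact: ddF_vert_fscale.
by rewrite (dd_eq oD _ Dz E) (ddZ Dz sb).
Qed.

(** The factor is [t] rather than its square because the inner direction [vert (lsubmx v)] is not
    rescaled: first vertical derivatives of [F] have degree 1. *)
Lemma hessian_form_fscale t z v v' : 0 < t -> D z ->
  hessian_form F (fscale t z) (fscale t v) (fscale t v') = t * hessian_form F z
    v v'.
Proof.
move=> t0 Dz; rewrite /hessian_form !lsub_fscale !ddddF_fscale//.
by rewrite mulrBr.
Qed.

(** Both [g'] and [t *: fscale t g] solve the spray equation at [fscale t z]: the form contributes
    one factor [t], the outer multiple another, and the differential of [F] scales by [t ^+ 2].
    Nondegeneracy gives uniqueness. *)
Lemma spray_homogeneous t z g g' : 0 < t -> D z ->
  (forall v, hessian_form F z g v = - dd F v z) ->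
  (forall v, hessian_form F (fscale t z) g' v = - dd F v (fscale t z)) ->
  (forall v, (forall v', hessian_form F (fscale t z) v v' = 0) -> v = 0) ->
  g' = t *: fscale t g.
Proof.
move=> t0 Dz Hg Hg' nd; apply/eqP; rewrite -subr_eq0; apply/eqP; apply: nd => v.
have Dt := D_fscale t0 Dz.
rewrite (hessian_form_sub _ _ _ Dt) (hessian_form_scale _ _ _ Dt).
rewrite -[v](fscaleK (lt0r_neq0 t0)); set v0 := fscale _ v.
rewrite (hessian_form_fscale _ _ t0 Dz) Hg Hg' ddF_fscale//.
by ring.
Qed.

End LocalFinsler.

(** * Canonical sprays in an arbitrary chart *)

Section FinslerSpray.
Context {R : realType} {n : nat} {M : Type} {A : atlas R n M}.
Hypothesis cA : smooth_charts A.
Local Notation TM := (M * 'rV[R]_n)%type.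
Local Notation TA := (tangent_atlas A).
Implicit Types (u : TM) (z v : 'rV[R]_(n + n)) (w : 'rV[R]_n) (c : chart A).

Let cT := tangent_charts cA.

Lemma smooth_on_param c (f : TM -> R) : smooth_fun_on TA slit f ->
  smooth_on (slit_image c) (f \o param (c : chart TA)).
Proof.
move=> sf; apply: smooth_on_at => z /(slit_imageP cA)[u [cu su <- _]].
by apply: (smooth_at_param cT _ _ (sf _ su)) => //; exact: (charts_at cA).
Qed.

Lemma fscale_coord c u t : dom c u.1 ->
  fscale t (coord (c : chart TA) u) = coord (c : chart TA) (u.1, t *: u.2).
Proof.
move=> cu; rewrite /fscale tangent_coord_lsub tangent_coord_rsub /=; congr
  row_mx.
have l0 := linear_subr 0 0 (tcoord_linear cA cu); rewrite !subrr in l0.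
by have := tcoord_linear cA cu t u.2 0; rewrite !addr0 l0 addr0.
Qed.

Lemma slit_image_fscale c t z : 0 < t -> slit_image c z -> slit_image c (fscale
  t z).
Proof.
move=> t0 [cz z0]; split; first by rewrite lsub_fscale.
by rewrite rsub_fscale scaler_eq0 negb_or (gt_eqF t0).
Qed.

Lemma param_fscale c t z u : param (c : chart TA) z = u -> dom c u.1 ->
  coord (c : chart TA) u = z ->
  param (c : chart TA) (fscale t z) = (u.1, t *: u.2).
Proof.
by move=> _ cu <-; rewrite (fscale_coord t cu) (tangent_coordK cA).
Qed.

Lemma pos_homogeneous1_local c (f : TM -> R) t z : pos_homogeneous1 f -> 0 < t
  ->
  slit_image c z -> (f \o param (c : chart TA)) (fscale t z) =
  t * (f \o param (c : chart TA)) z.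
Proof.
move=> hf t0 /(slit_imageP cA)[u [cu su uz zu]].
apply: (etrans (congr1 f (param_fscale t zu cu uz))).
rewrite hf// -surjective_pairing; congr (_ * _); exact: (congr1 f (esym zu)).
Qed.

Lemma euler_pos_homogeneous1 c (f : TM -> R) z : smooth_fun_on TA slit f ->
  pos_homogeneous1 f -> slit_image c z ->
  dd (f \o param (c : chart TA)) (vert (rsubmx z)) z = (f \o param (c : chart
    TA)) z.
Proof.
move=> sf hf cz.
rewrite (euler_of_homogeneous (k := 0) (smooth_on_param c sf) cz) ?scale1r// =>
  t t0.
by rewrite (pos_homogeneous1_local hf t0 cz) expr1.
Qed.

Section EulerSpray.
Variable G : @vfield R n M.
Hypotheses (sG : smooth_vfield_on A slit G)
  (eG : forall u, slit u -> rho A u (G u) = eta u).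

Lemma vrep_bracket_liouville c z : slit_image c z ->
  vrep c (bracket TA (liouville A) G) z =
  row_mx (rsubmx z)
    (dd (spray_coef G c) (vert (rsubmx z)) z - spray_coef G c z).
Proof.
move=> cz; have oD := slit_image_open cA c.
have sr : smooth_on (slit_image c) (@rsubmx R 1 n n).
  by apply: smooth_on_linear; exact: linear_rsub.
have E : {in slit_image c, vrep c (liouville A) =1 (fun z => vert (rsubmx z))}.
  move=> y; rewrite inE => cy; rewrite /liouville (vrep_gamma cA _ cy).
  by rewrite (prep_eta cA cy).
have sC : smooth_on (slit_image c) (vrep c (liouville A)).
  apply: (smooth_on_eq oD _ (smooth_on_linear_comp oD linear_vert sr)) => y Dy.
  by rewrite (E y Dy).
have at_z (f : 'rV[R]_(n + n) -> 'rV[R]_(n + n)) : smooth_on (slit_image c) f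
  -> smooth_at f z.
  by move=> sf; exists (slit_image c); first exact: (conj oD cz).
have E0 := vrep_bracket cA cz (at_z _ sC) (at_z _ (smooth_on_vrep cA c sG)).
apply: (etrans E0).
rewrite (dd_vrep_spray cA sG eG _ cz) (dd_eq oD _ cz E) (E z (mem_set cz)).
rewrite (dd_linear _ linear_vert cz sr) (dd_lin _ _ (@linear_rsub R n n)).
by rewrite rsub_vert vert.unlock opp_row_mx add_row_mx oppr0 addr0.
Qed.

(** The bracket of the Liouville field with [G] has fibre components equal to the Euler derivative
    of [spray_coef] minus [spray_coef]. The Euler identity thus becomes an equality of tangent
    vectors, in which no chart occurs. *)
Lemma euler_bracket c z u : slit_image c z -> dom c u.1 -> slit u ->
  coord (c : chart TA) u = z ->
  dd (spray_coef G c) (vert (rsubmx z)) z = 2 *: spray_coef G c z <->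
  bracket TA (liouville A) G u = G u.
Proof.
move=> cz cu su uz.
have E1 := vrep_bracket_liouville cz.
have E2 := vrep_spray cA eG cz.
split=> [eB|bG].
  apply: (tcoord_inj cT (cu : dom (c : chart TA) u)).
  rewrite -(vrepE cA G cu) -(vrepE cA (bracket TA (liouville A) G) cu) uz E1 E2
    eB.
  by congr row_mx; rewrite scaler_nat mulr2n addrK.
have := vrepE cA (bracket TA (liouville A) G) cu.
rewrite bG -(vrepE cA G cu) uz E1 E2 => /(congr1 rsubmx).
rewrite !row_mxKr => /eqP; rewrite subr_eq => /eqP ->.
by rewrite scaler_nat mulr2n.
Qed.

(** [Omega] is computed in the preferred chart, so homogeneity is first obtained there; the
    intrinsic form of the Euler identity transports it to [c]. *)
Lemma euler_change_chart c z u : slit_image c z -> slit u ->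
  coord (c : chart TA) u = z -> dom c u.1 ->
  (let e := chart_at A u.1 in let y := coord (e : chart TA) u in
   dd (spray_coef G e) (vert (rsubmx y)) y = 2 *: spray_coef G e y) ->
  dd (spray_coef G c) (vert (rsubmx z)) z = 2 *: spray_coef G c z.
Proof.
move=> cz su uz cu ee; apply: (iffRL (euler_bracket cz cu su uz)).
have eu := charts_at cA u.1.
exact: (iffLR (euler_bracket (slit_image_coord cA eu su) eu su erefl) ee).
Qed.

End EulerSpray.

Variables (L : TM -> R) (G : @vfield R n M).
Hypotheses (fL : finsler A L) (cG : canonical_spray A L G).

Let sG : smooth_vfield_on A slit G := cG.1.
Let E := energy L.

Let Erep c := E \o param (c : chart TA).

Let smooth_Erep c : smooth_on (slit_image c) (Erep c).
Proof.
have oD := slit_image_open cA c; have sL := smooth_on_param c (finsler_smooth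
  fL).
by apply: (smooth_on_scale_cst 2^-1 oD (smooth_on_scale oD sL sL)).
Qed.

Let Erep_fscale c t z : 0 < t -> slit_image c z ->
  Erep c (fscale t z) = t ^+ 2 * Erep c z.
Proof.
move=> t0 cz; rewrite /Erep /E /energy /=.
have /= -> := pos_homogeneous1_local (finsler_homogeneous fL) t0 cz.
by rewrite exprMn mulrCA.
Qed.

Let dmap_energy c u v : dom c u.1 -> slit u ->
  dmap TA E u v = dd (Erep c) (tcoord (c : chart TA) u v) (coord (c : chart TA)
    u).
Proof.
move=> cu su; rewrite -ddE; apply: (dmapE cT) => //.
exact: smooth_on_differentiable (@smooth_Erep c) (slit_image_coord cA cu su).
Qed.

Let local_form_energy c v : {in slit_image c,
  local_form (c : chart TA) (d_J A E) v =1 dd (Erep c) (vert (lsubmx v))}.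
Proof.
move=> z; rewrite inE => cz; have [u [cu su uz zu]] := slit_imageP cA cz.
rewrite /local_form zu /d_J (dmap_energy _ cu su) uz; congr (dd _ _ _).
rewrite (JE cA) (tangent_tcoord_vert cA _ cu) -(tangent_tcoord_lsub cA _ cu).
by rewrite -uz (tparamK cT v (cu : dom (c : chart TA) u)) vert.unlock.
Qed.

Let Omega_local u v v' : slit u ->
  let c := chart_at A u.1 in
  Omega A L u v v' = hessian_form (Erep c) (coord (c : chart TA) u) v v'.
Proof.
move=> su c; have cu : dom c u.1 := charts_at cA u.1.
have Dz := slit_image_coord cA cu su; have oD := slit_image_open cA c.
have half (w w' : 'rV[R]_(n + n)) :
    'D_w (local_form (c : chart TA) (d_J A E) w') (coord (c : chart TA) u) =
    dd (dd (Erep c) (vert (lsubmx w'))) w (coord (c : chart TA) u).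
  exact: (etrans (ddE _ _ _) (dd_eq oD _ Dz (@local_form_energy c w'))).
exact: (congr2 (fun a b : R => a - b) (half v v') (half v' v)).
Qed.

Let spray_local u v : slit u ->
  let c := chart_at A u.1 in
  hessian_form (Erep c) (coord (c : chart TA) u) (G u) v =
  - dd (Erep c) v (coord (c : chart TA) u).
Proof.
move=> su c; have cu : dom c u.1 := charts_at cA u.1.
have := cG.2 u su v; rewrite (Omega_local _ _ su) (dmap_energy _ cu su) => ->.
by rewrite -[c in tcoord c]/(chart_at TA u) (tcoord_chart_at cT).
Qed.

Let nondegenerate_local u : slit u ->
  let c := chart_at A u.1 in forall v,
  (forall v', hessian_form (Erep c) (coord (c : chart TA) u) v v' = 0) -> v = 0.
Proof.
move=> su c v Hv; apply: (finsler_nondegenerate fL su) => v'.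
by rewrite (Omega_local _ _ su).
Qed.

Lemma rho_canonical_spray u : slit u -> rho A u (G u) = eta u.
Proof.
move=> su; set c := chart_at A u.1; have cu : dom c u.1 := charts_at cA u.1.
have Dz := slit_image_coord cA cu su.
rewrite (rhoE cA).
rewrite (spray_second_order (slit_image_open cA c) (@smooth_Erep c)
  (@Erep_fscale c) Dz (fun v => spray_local v su) (nondegenerate_local su)).
by rewrite tangent_coord_rsub (tcoord_chart_at cA).
Qed.

Lemma euler_canonical_spray c z : slit_image c z ->
  dd (spray_coef G c) (vert (rsubmx z)) z = 2 *: spray_coef G c z.
Proof.
move=> cz; have [u [cu su uz _]] := slit_imageP cA cz.
apply: (euler_change_chart sG rho_canonical_spray cz su uz cu) => e y.
have eu : dom e u.1 := charts_at cA u.1.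
have Dy : slit_image e y := slit_image_coord cA eu su.
apply: (@euler_of_homogeneous R n 'rV[R]_n (slit_image e) (spray_coef G e) 1 y
  (smooth_on_spray_coef cA sG e) Dy) => t t0.
have su' : slit (u.1, t *: u.2).
  by rewrite /slit/= scaler_eq0 negb_or (gt_eqF t0).
(* The preferred chart of a vector depends only on its base point, so [G] at [u] and at its
   rescalings is expressed in the same chart [e]. *)
have spray_at u' : u'.1 = u.1 -> spray_coef G e (coord (e : chart TA) u') =
  rsubmx (G u').
  move=> pu; have eu' : dom e u'.1 by rewrite pu.
  rewrite /spray_coef (vrepE cA _ eu').
  have -> : (e : chart TA) = chart_at TA u' by rewrite /= pu.
  by rewrite (tcoord_chart_at cT).
have Hg v : hessian_form (Erep e) y (G u) v = - dd (Erep e) v y.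
  exact: spray_local.
have Hg' v : hessian_form (Erep e) (fscale t y) (G (u.1, t *: u.2)) v =
    - dd (Erep e) v (fscale t y).
  by rewrite /y (fscale_coord t eu); exact: (spray_local v su').
have nd v : (forall v', hessian_form (Erep e) (fscale t y) v v' = 0) -> v = 0.
  by rewrite /y (fscale_coord t eu); exact: (nondegenerate_local su').
have := spray_homogeneous (slit_image_open cA e) (@smooth_Erep e)
  (@slit_image_fscale e) (@Erep_fscale e) t0 Dy Hg Hg' nd.
rewrite /y (fscale_coord t eu) => Gt.
apply: (etrans (spray_at (u.1, t *: u.2) erefl)); rewrite Gt.
(* Degree 2: one factor [t] is the outer multiple in [Gt], the other comes from [fscale] acting on
   the fibre part. *)
apply: (etrans (linear_scal _ _ (@linear_rsub R n n))).
rewrite rsub_fscale scalerA; congr (_ *: _).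
exact: (esym (spray_at u erefl)).
Qed.

End FinslerSpray.

(** * Projectively related sprays in a chart *)

Section Projective.
Context {R : realType} {n : nat} {M : Type} {A : atlas R n M}.
Hypothesis cA : smooth_charts A.
Local Notation TM := (M * 'rV[R]_n)%type.
Local Notation TA := (tangent_atlas A).

Lemma spray_coef_projective (G G' : @vfield R n M) (lam : TM -> R) c z :
  (forall u, slit u -> G' u = G u - (2 * lam u) *: liouville A u) ->
  slit_image c z ->
  spray_coef G' c z =
  spray_coef G c z - (2 * (lam \o param (c : chart TA)) z) *: rsubmx z.
Proof.
move=> GG cz; have [u [cu su uz zu]] := slit_imageP cA cz.
have lt := tcoord_linear (tangent_charts cA) (cu : dom (c : chart TA) u).
have E : vrep c G' z = vrep c G z - (2 * lam u) *: vrep c (liouville A) z.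
  rewrite -uz (vrepE cA G' cu) (vrepE cA G cu) (vrepE cA (liouville A) cu) (GG
    u su).
  rewrite (linear_subr _ _ lt); congr (_ - _).
  exact: linear_scal lt.
rewrite /spray_coef E (linear_subr _ _ (@linear_rsub R n n)) (linear_scal _ _
  (@linear_rsub R n n)).
have -> : (lam \o param (c : chart TA)) z = lam u by exact: (congr1 lam zu).
by rewrite /liouville (vrep_gamma cA _ cz) rsub_vert (prep_eta cA cz).
Qed.

End Projective.

Theorem theorem3p5 (R : realType) (n : nat) (M : topologicalType)
    (A : atlas R n M) (L L' : M * 'rV[R]_n -> R)
    (G G' : M * 'rV[R]_n -> 'rV[R]_(n + n)) :
  (2 < n)%N ->
  hausdorff_space M -> paracompact_space M -> smooth_atlas A ->
  finsler A L -> finsler A L' ->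
  canonical_spray A L G -> canonical_spray A L' G' ->
  projectively_related A G G' ->
  (forall X : M * 'rV[R]_n -> 'rV[R]_n,
     smooth_pfield_on A slit X ->
     forall u, slit u -> W1 A G' X u = W1 A G X u) /\
  (forall X Y : M * 'rV[R]_n -> 'rV[R]_n,
     smooth_pfield_on A slit X -> smooth_pfield_on A slit Y ->
     forall u, slit u -> W2 A G' X Y u = W2 A G X Y u).
Proof.
move=> /ltnW n1 _ _ /smooth_atlas_charts cA fL fL' cG cG' [lam [sl hl GG]].
have rG := rho_canonical_spray cA fL cG; have rG' := rho_canonical_spray cA fL'
  cG'.
have eG := euler_canonical_spray cA fL cG; have eG' := euler_canonical_spray cA
  fL' cG'.
have sG := cG.1; have sG' := cG'.1.
have change c := fun z (cz : slit_image c z) => spray_coef_projective cA GG cz.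
have euler_lam c := fun z (cz : slit_image c z) => euler_pos_homogeneous1 cA sl
  hl cz.
have su_image u (su : slit u) := slit_image_coord cA (charts_at cA u.1) su.
(* In the preferred chart at [u.1] the components of a vector are the vector itself, so equality of
   the local tensors is already equality of [W1] and [W2] at [u]. *)
split=> [X sX u su|X Y sX sY u su]; set c := chart_at A u.1.
  have pX := smooth_on_prep cA c sX.
  rewrite (W1_local cA sG rG su erefl pX).
  rewrite (W1_local cA sG' rG' su erefl pX).
  exact: (W1_projective (slit_image_open cA c) (smooth_on_spray_coef cA sG c)
    (smooth_on_spray_coef cA sG' c) (smooth_on_param cA c sl) (@eG c) (@eG' c)
    (@euler_lam c) (@change c) n1 (X u) (su_image u su)).
have pX := smooth_on_prep cA c sX; have pY := smooth_on_prep cA c sY.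
rewrite (W2_local cA sG rG (@eG c) n1 su erefl pX pY).
rewrite (W2_local cA sG' rG' (@eG' c) n1 su erefl pX pY).
exact: (W2_projective (slit_image_open cA c) (smooth_on_spray_coef cA sG c)
  (smooth_on_spray_coef cA sG' c) (smooth_on_param cA c sl) (@eG c) (@eG' c)
  (@euler_lam c) (@change c) n1 (X u) (Y u) (su_image u su)).
Qed.
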